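(* Let $C\subset\mathbb{P}^2_{\mathbb{C}}$ be a reduced plane curve of degree $d$, let $e\ge 1$ be an integer, and consider the rational map $$\Phi:\operatorname{Mor}_e(\mathbb{P}^1,\mathbb{P}^2)\dashrightarrow\mathbb{P}(H^0(\mathbb{P}^1,\mathscr{O}_{\mathbb{P}^1}(ed))),\qquad[\iota]\mapsto[\iota^{-1}(C)].$$ Then $\Phi$ fails to have maximal rank if and only if one of the following holds: (1) $d\geq 5$ and $C$ is a union of orbits under a nontrivial action of $\mathbb{G}_m$ or $\mathbb{G}_a$ on $\mathbb{P}^2$; (2a) $d=4$, $e=1$, and $C$ is the union of four concurrent lines; (2b) $d=4$, $e\geq 2$, and $C$ is a union of orbits under a nontrivial action of $\mathbb{G}_m$ or $\mathbb{G}_a$ on $\mathbb{P}^2$; (3) $d=3$, $e\geq 2$, and $C$ is a union of concurrent lines.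
   Context: Everything is over $\mathbb{C}$; plane curves may be reducible. $\operatorname{Mor}_e(\mathbb{P}^1,\mathbb{P}^2)$ is the variety of morphisms $\iota:\mathbb{P}^1\to\mathbb{P}^2$ with $\iota^*\mathscr{O}(1)=\mathscr{O}(e)$, i.e. the open subset of $\mathbb{P}(H^0(\mathscr{O}_{\mathbb{P}^1}(e))^{\oplus 3})$ of triples of degree $e$ binary forms without common zero. If $C=\{F=0\}$, the map $\Phi$ sends $\iota$ to the class of the form $\iota^*F$; it is defined when $\iota(\mathbb{P}^1)\not\subset C$. $\Phi$ has maximal rank if the dimension of its image is $\min\{\dim\operatorname{Mor}_e(\mathbb{P}^1,\mathbb{P}^2),\dim\mathbb{P}H^0(\mathscr{O}_{\mathbb{P}^1}(ed))\}$; equivalently, the derivative of $\Phi$ at a general point has maximum rank. Actions of $\mathbb{G}_m,\mathbb{G}_a$ are algebraic. Lines are concurrent if they all pass through a common point. *)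

(* Defs.v *)
From HB Require Import structures.
From mathcomp Require Import all_boot all_order all_algebra.
From mathcomp Require Import reals complex mpoly.

Set Implicit Arguments.
Unset Strict Implicit.
Unset Printing Implicit Defensive.

Import GRing.Theory.
Local Open Scope ring_scope.

Section Projective.
Variables (K : fieldType) (V : vectType K).

(* P(V) is the set of lines through 0 in V. *)
Definition projective := {U : {vspace V} | \dim U == 1%N}.

(* p = [v]; this forces v != 0, since <[0]> has dimension 0. *)
Definition is_class (p : projective) (v : V) : Prop := val p = <[v]>%VS.

Definition affine_cone (S : projective -> Prop) (v : V) : Prop :=
  exists2 p, S p & v \in val p.

Definition coords (v : V) (i : 'I_(\dim {:V})) : K :=
  coord (vbasis {:V}) i v.

(* The polynomial functions f_0, ..., f_(r-1) on V have algebraically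
   independent restrictions to S. *)
Definition alg_independent_on (S : V -> Prop) (r : nat)
    (f : 'I_r -> {mpoly K[\dim {:V}]}) : Prop :=
  forall P : {mpoly K[r]},
    (forall v, S v -> P.@[fun i => (f i).@[coords v]] = 0) -> P = 0.

(* n is the transcendence degree over K of the ring of restrictions to S of
   the polynomial functions on V, i.e. the dimension of the Zariski closure
   of S. *)
Definition has_trdeg (S : V -> Prop) (n : nat) : Prop :=
  (exists f : 'I_n -> {mpoly K[\dim {:V}]}, alg_independent_on S f) /\
  (forall (r : nat) (f : 'I_r -> {mpoly K[\dim {:V}]}),
     alg_independent_on S f -> (r <= n)%N).

(* The dimension of a subset of P(V) (that of its Zariski closure) is the
   transcendence degree of its homogeneous coordinate ring, minus one. *)
Definition has_dim (S : projective -> Prop) (n : nat) : Prop :=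
  has_trdeg (affine_cone S) n.+1.

End Projective.

Section Curves.
Variable K : fieldType.

Notation P2 := (projective 'rV[K]_3).

Definition curve (d : nat) (F : dhomog 3 K d) (p : P2) : Prop :=
  exists2 v : 'rV[K]_3, is_class p v & (F : {mpoly K[3]}).@[v 0] = 0.

(* F is nonzero and squarefree. *)
Definition reduced_form (d : nat) (F : dhomog 3 K d) : Prop :=
  F != 0 /\
  forall G H : {mpoly K[3]},
    (F : {mpoly K[3]}) = G ^+ 2 * H -> exists c : K, G = c%:MP.

(* Lines of P^2 are the planes through 0 in K^3. *)
Definition union_of_concurrent_lines (n : nat) (C : P2 -> Prop) : Prop :=
  exists L : 'I_n -> {vspace 'rV[K]_3},
    [/\ injective L,
        forall i, \dim (L i) = 2%N,
        exists p : P2, forall i, (val p <= L i)%VS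
      & forall p : P2, C p <-> exists i, (val p <= L i)%VS].

End Curves.

Section MaximalRank.
Variable K : fieldType.

Definition form_triple (e : nat) : vectType K :=
  {ffun 'I_3 -> dhomog 2 K e}.

Definition no_common_zero (e : nat) (iota : form_triple e) : Prop :=
  forall s : 'rV[K]_2, s != 0 ->
    exists i : 'I_3, (iota i : {mpoly K[2]}).@[s 0] != 0.

Definition Mor (e : nat) (p : projective (form_triple e)) : Prop :=
  exists2 iota, is_class p iota & no_common_zero iota.

Definition pullback (d e : nat) (F : dhomog 3 K d) (iota : form_triple e) :
    {mpoly K[2]} :=
  (F : {mpoly K[3]}) \mPo [tuple (iota i : {mpoly K[2]}) | i < 3].

(* The graph of [iota] |-> [iota^* F].  If iota^* F = 0 then [iota] has no
   image, because is_class q G forces G != 0. *)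
Definition Phi (d e : nat) (F : dhomog 3 K d)
    (p : projective (form_triple e))
    (q : projective (dhomog 2 K (e * d))) : Prop :=
  exists (iota : form_triple e) (G : dhomog 2 K (e * d)),
    [/\ is_class p iota, no_common_zero iota,
        (G : {mpoly K[2]}) = pullback F iota & is_class q G].

Definition Phi_image (d e : nat) (F : dhomog 3 K d)
    (q : projective (dhomog 2 K (e * d))) : Prop :=
  exists p : projective (form_triple e), Phi F p q.

Definition maximal_rank (d e : nat) (F : dhomog 3 K d) : Prop :=
  exists m n : nat,
    [/\ has_dim (@Mor e) m,
        has_dim (fun _ : projective (dhomog 2 K (e * d)) => True) n
      & has_dim (@Phi_image d e F) (minn m n)].

End MaximalRank.

Section Actions.
Variable K : fieldType.

Notation P2 := (projective 'rV[K]_3).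

Definition eval_forms (A : 'I_3 -> {mpoly {poly K}[3]}) (t : K)
    (v : 'rV[K]_3) : 'rV[K]_3 :=
  \row_i (map_mpoly (horner_eval t) (A i)).@[v 0].

(* For an open subset G of the affine line, s : G * P^2 -> P^2 is a morphism:
   around each point it is given by three forms of the same degree in the
   homogeneous coordinates of P^2, with coefficients polynomial in t.
   Denominators of the coefficients can be cleared, and multiplying the three
   forms by an equation of the complement of a small open set makes the formula
   valid wherever the forms do not all vanish. *)
Definition regular_map (G : {pred K}) (s : K -> P2 -> P2) : Prop :=
  forall (t0 : K) (p0 : P2), t0 \in G ->
    exists (m : nat) (A : 'I_3 -> {mpoly {poly K}[3]}),
      [/\ forall i, A i \is m.-homog,
          exists2 v, is_class p0 v & eval_forms A t0 v != 0
        & forall (t : K) (p : P2) (v : 'rV[K]_3),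
            t \in G -> is_class p v -> eval_forms A t v != 0 ->
            is_class (s t p) (eval_forms A t v)].

(* Values of s outside G are irrelevant. *)
Definition algebraic_action (G : {pred K}) (op : K -> K -> K) (e : K)
    (s : K -> P2 -> P2) : Prop :=
  [/\ forall p, s e p = p,
      forall t u p, t \in G -> u \in G -> s (op t u) p = s t (s u p)
    & regular_map G s].

Definition nontrivial_action (G : {pred K}) (s : K -> P2 -> P2) : Prop :=
  exists (t : K) (p : P2), t \in G /\ s t p <> p.

Definition in_orbit (G : {pred K}) (s : K -> P2 -> P2) (q p : P2) : Prop :=
  exists2 t, t \in G & p = s t q.

Definition union_of_orbits (G : {pred K}) (s : K -> P2 -> P2)
    (C : P2 -> Prop) : Prop :=
  exists S : P2 -> Prop,
    forall p, C p <-> exists2 q, S q & in_orbit G s q p.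

Definition Gm : {pred K} := [pred t | t != 0].
Definition Ga : {pred K} := predT.

Definition Gm_action (s : K -> P2 -> P2) : Prop :=
  algebraic_action Gm *%R 1 s.
Definition Ga_action (s : K -> P2 -> P2) : Prop :=
  algebraic_action Ga +%R 0 s.

Definition union_of_Gm_or_Ga_orbits (C : P2 -> Prop) : Prop :=
  exists s : K -> P2 -> P2,
    [/\ Gm_action s, nontrivial_action Gm s & union_of_orbits Gm s C] \/
    [/\ Ga_action s, nontrivial_action Ga s & union_of_orbits Ga s C].

End Actions.

(* Main.v *)
Require Import Defs.
From HB Require Import structures.
From mathcomp Require Import all_boot all_order all_algebra.
From mathcomp Require Import boolp reals complex mpoly ring zify separable.
Set Implicit Arguments.
Unset Strict Implicit.
Unset Printing Implicit Defensive.
Import Order.TTheory GRing.Theory Num.Theory.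
Local Open Scope ring_scope.

(* The differential of [iota |-> iota^* F] at [iota] sends [g] to
   [\sum_i g_i F_i(iota)], where [F_i] are the partial derivatives. If its generic
   rank drops, a generic [iota] carries a syzygy [\sum_i S_i F_i(iota) = 0] of
   degree at most [e]. Let [S] be one of least degree [D]. A dimension count shows
   [D + e + 2 <= e (d - 1)]; since the [F_i(iota)] have no common factor, every
   syzygy of degree at most [D + 1] is then parallel to [S]. Applied to derivatives
   of [S] with respect to the coefficients of [iota], and to its translates in [x],
   this shows that the direction of [S(x)] depends only on [iota(x)], so that [S]
   is parallel to [s(iota)] for coprime forms [s_i] with [\sum_i s_i F_i = 0], of
   degree at most [D / e <= 1]. Hence [F] is annihilated by a constant or by a
   linear vector field; conversely such a field produces a kernel.

   A constant field means that the curve is a cone, i.e. a union of concurrent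
   lines. For a linear field, the semisimple and nilpotent parts also annihilate
   [F]: the nilpotent part exponentiates to [Ga], and the weights of the
   semisimple part may be replaced by integers, giving [Gm]. Conversely, the
   velocity of an action at [v] is defined modulo [v]; its cross product with [v]
   is a polynomial field, quadratic and orthogonal to [v], hence of the form
   [v x M v] with [M] linear. The field [M] is tangent to the curve, so after
   subtracting a multiple of the Euler field it annihilates [F]. *)

(** * Unique factorization in polynomial rings *)

(** The obstacle is that nothing is known about the syzygy beyond its degree in [x]; its
    coefficients are arbitrary polynomials in the coefficients [u_ij] of [iota]. Everything is
    squeezed out of one principle. Two syzygies [S], [T] are orthogonal to the gradient along
    [iota], so [S x T] is proportional to it. The gradient has degree [e (d - 1)] in [x] and no
    common factor, hence [S x T = 0] as soon as the degree of [S x T] is smaller. With [T] of degree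
    [D + 1] this asks for [2 D + 1 < e (d - 1)], which the count supplies because [D <= e].

    The margin of one degree is what the derivatives cost: the operator [d/du_i(j+1) - x d/du_ij]
    annihilates every [P(iota(x))], so it maps syzygies to syzygies, but it raises the degree by
    one.

    Unique factorization serves to show that partial derivatives without common factor stay so along
    the universal [iota]: a divisor of [P(iota(x))] is itself of the form [g(iota(x))].

    A field of degree [k] forces [k e + e + 2 <= e (d - 1)]; the list of cases is the solution of
    this inequality for [k = 0] and [k = 1]. *)

Definition divides (A : idomainType) (a b : A) : Prop := exists c, b = c * a.

Definition prime_elt (A : idomainType) (p : A) : Prop :=
  [/\ p != 0, p \isn't a GRing.unit
    & forall a b, divides p (a * b) -> divides p a \/ divides p b].

Definition factorial (A : idomainType) : Prop :=
  forall a : A, a != 0 -> exists u ps,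
    [/\ u \is a GRing.unit, forall p, p \in ps -> prime_elt p
      & a = u * \prod_(p <- ps) p].

Section Divides.
Variable A : idomainType.
Implicit Types a b c p : A.

Lemma divides_mull a b c : divides a b -> divides a (c * b).
Proof. by case=> k ->; exists (c * k); rewrite mulrA. Qed.

Lemma divides_mulr a b c : divides a b -> divides a (b * c).
Proof. by move=> h; rewrite mulrC; apply: divides_mull. Qed.

Lemma dividesD a b c : divides a b -> divides a c -> divides a (b + c).
Proof. by case=> k -> [l ->]; exists (k + l); rewrite mulrDl. Qed.

Lemma dividesB a b c : divides a b -> divides a c -> divides a (b - c).
Proof. by case=> k -> [l ->]; exists (k - l); rewrite mulrBl. Qed.

Lemma divides_trans a b c : divides a b -> divides b c -> divides a c.
Proof. by case=> k -> [l ->]; exists (l * k); rewrite mulrA. Qed.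

Lemma divides0 a : divides a 0. Proof. by exists 0; rewrite mul0r. Qed.

Lemma divides_refl a : divides a a. Proof. by exists 1; rewrite mul1r. Qed.

Lemma divides_sum a I (r : seq I) (P : pred I) (F : I -> A) :
  (forall i, P i -> divides a (F i)) -> divides a (\sum_(i <- r | P i) F i).
Proof.
move=> h; elim/big_ind: _ => //; first exact: divides0.
exact: dividesD.
Qed.

Lemma prime_dvd_prod p (s : seq A) : prime_elt p ->
  divides p (\prod_(x <- s) x) -> exists2 x, x \in s & divides p x.
Proof.
case=> p0 pu pp; elim: s => [|x s IH].
  by rewrite big_nil => -[k e]; case/negP: pu; apply/unitrPr; exists k; rewrite mulrC -e.
rewrite big_cons => /pp [|/IH[y ys h]]; first by exists x; rewrite ?mem_head.
by exists y; rewrite // inE ys orbT.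
Qed.

Lemma divides_unitM p u a : u \is a GRing.unit -> divides p (u * a) -> divides p a.
Proof. by move=> uu [k e]; exists (u^-1 * k); rewrite -mulrA -e mulKr. Qed.

End Divides.

Section GaussLemma.
Variable A : idomainType.
Implicit Types (f g h : {poly A}) (c p : A).

Lemma divides_polyC p f : divides p%:P f <-> forall i, divides p f`_i.
Proof.
split=> [[g ->] i|h]; first by exists g`_i; rewrite coefMC.
have h' i : exists c, f`_i == c * p by have [c ->] := h i; exists c.
exists (\poly_(i < size f) xchoose (h' i)); apply/polyP => i.
rewrite coefMC coef_poly; case: ltnP => [_|/leq_sizeP->//].
  exact/eqP/(xchooseP (h' i)).
by rewrite mul0r.
Qed.

(** Gauss: if [i] and [j] are the least indices of coefficients of [f] and [g] not divisible by [p],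
    then in the coefficient [i + j] of [f * g] all terms but [f_i g_j] are divisible by [p]. *)
Lemma prime_polyC p : prime_elt p -> prime_elt p%:P.
Proof.
case=> p0 pu pp; split; first by rewrite polyC_eq0.
  by rewrite poly_unitE coefC eqxx (negPf pu) andbF.
move=> f g pfg; apply: contrapT => /not_orP[nf ng].
have ex h : ~ divides p%:P h -> exists i, `[< ~ divides p h`_i >].
  move=> nh; apply: contrapT => /forallNP all; apply: nh; apply/divides_polyC => i.
  by apply: contrapT => ni; apply: (all i); apply/asboolP.
case: (ex_minnP (ex _ nf)) => i /asboolP ni mini.
case: (ex_minnP (ex _ ng)) => j /asboolP nj minj.
have small h k m : (forall l, `[< ~ divides p h`_l >] -> (m <= l)%N) -> (k < m)%N ->
    divides p h`_k.
  move=> min lt; apply: contrapT => /asboolP/min; by rewrite leqNgt lt.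
have /divides_polyC/(_ (i + j)%N) := pfg; rewrite coefM.
have lt_i : (i < (i + j).+1)%N by rewrite ltnS leq_addr.
rewrite (bigD1 (Ordinal lt_i)) //= addKn => d.
suff /pp[] : divides p (f`_i * g`_j) by [].
rewrite -[X in divides p X](addrK (\sum_(k < (i + j).+1 | k != Ordinal lt_i) f`_k * g`_(i + j - k))).
apply: dividesB => //; apply: divides_sum => -[k ltk] /=.
rewrite -val_eqE /= neq_ltn => /orP[lt|gt].
  by apply: divides_mulr; apply: small mini lt.
apply: divides_mull; apply: small minj _.
rewrite ltn_subLR //.
by rewrite ltn_add2r.
Qed.

Hypothesis fA : factorial A.

(* The scalar [c] is distributed over the two factors, one prime at a time. *)
Lemma gauss_scale c f g h : c != 0 -> c *: f = g * h ->
  exists g' h' c1 c2,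
    [/\ c1 != 0, c2 != 0, g = c1 *: g', h = c2 *: h' & f = g' * h'].
Proof.
move=> c0 e; have [u [ps [uu pps ec]]] := fA c0.
elim: ps pps c c0 ec g h e => [|p ps IH] pps c c0 ec g h e.
  rewrite big_nil mulr1 in ec; exists g, (u^-1 *: h), 1, u.
  have u0 : u != 0 by apply: contraTneq uu => ->; rewrite unitr0.
  rewrite oner_eq0 scale1r scalerA divrr // scale1r; split=> //.
  by rewrite -scalerAr -e ec scalerA mulVr // scale1r.
have pp : prime_elt p by apply: pps; rewrite mem_head.
have [p0 _ _] := pp.
rewrite big_cons mulrCA in ec.
have c'0 : u * \prod_(x <- ps) x != 0.
  by move: c0; rewrite ec mulf_eq0 negb_or => /andP[].
have pps' q : q \in ps -> prime_elt q by move=> qs; apply: pps; rewrite inE qs orbT.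
have [_ _ /(_ g h)] := prime_polyC pp.
have: divides p%:P (g * h).
  by rewrite -e ec -scalerA -mul_polyC mulrC; exists ((u * \prod_(x <- ps) x) *: f).
move=> d /(_ d) [] [k ek]; rewrite mulrC mul_polyC in ek; subst.
  have: (u * \prod_(x <- ps) x) *: f = k * h.
    apply/eqP; rewrite -subr_eq0.
    suff: p *: ((u * \prod_(x <- ps) x) *: f - k * h) == 0.
      by rewrite -mul_polyC mulf_eq0 polyC_eq0 (negPf p0).
    by rewrite scalerBr scalerA e -scalerAl subrr.
  move=> /(IH pps' _ c'0 erefl)[g' [h' [c1 [c2 [c10 c20 -> -> ->]]]]].
  by exists g', h', (p * c1), c2; rewrite mulf_neq0 // scalerA.
have: (u * \prod_(x <- ps) x) *: f = g * k.
  apply/eqP; rewrite -subr_eq0.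
  suff: p *: ((u * \prod_(x <- ps) x) *: f - g * k) == 0.
    by rewrite -mul_polyC mulf_eq0 polyC_eq0 (negPf p0).
  by rewrite scalerBr scalerA e -scalerAr subrr.
move=> /(IH pps' _ c'0 erefl)[g' [h' [c1 [c2 [c10 c20 -> -> ->]]]]].
by exists g', h', c1, (p * c2); rewrite mulf_neq0 // scalerA.
Qed.

Definition primitive f : Prop := forall p, prime_elt p -> ~ divides p%:P f.

(** Each prime that divides [f] also divides its leading coefficient, so at most as many can be
    removed as that coefficient has prime factors. *)
Lemma primitive_part f : f != 0 ->
  exists c g, [/\ c != 0, f = c *: g & primitive g].
Proof.
move=> f0; have lf0 : lead_coef f != 0 by rewrite lead_coef_eq0.
have [u [ps [uu pps e]]] := fA lf0.
have [n le_n] := ubnP (size ps).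
elim: n ps f u le_n f0 lf0 uu pps e => // n IH ps f u le_n f0 lf0 uu pps e.
case: (pselect (primitive f)) => [pf|].
  by exists 1, f; rewrite oner_eq0 scale1r.
move=> /existsNP[p /not_implyP[pp /contrapT[k ek]]]; rewrite mulrC mul_polyC in ek.
have [p0 pu _] := pp.
have k0 : k != 0 by apply: contraNneq f0 => k0; rewrite ek k0 scaler0.
have lk0 : lead_coef k != 0 by rewrite lead_coef_eq0.
have lfE : lead_coef f = p * lead_coef k by rewrite ek lead_coefZ.
have: divides p (\prod_(x <- ps) x).
  by apply: divides_unitM uu _; rewrite -e lfE; exists (lead_coef k); rewrite mulrC.
move=> /(prime_dvd_prod pp)[q qs [w ew]].
have [q0 qu qp] := pps _ qs.
(* From [q = w * p] with both [p] and [q] prime, [p] and [q] are associates. *)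
have wu : w \is a GRing.unit.
  have [[k' ek']|[k' ek']] : divides q w \/ divides q p by apply: qp; rewrite -ew; apply: divides_refl.
    have: k' * p = 1; last by move=> e1; case/negP: pu; apply/unitrPr; exists k'; rewrite mulrC e1.
    by apply: (mulIf q0); rewrite mul1r [RHS]ew ek' mulrAC.
  apply/unitrPr; exists k'; rewrite mulrC.
  by apply: (mulIf p0); rewrite mul1r -mulrA -ew ek'.
have e' : lead_coef k = (u * w) * \prod_(x <- rem q ps) x.
  apply: (mulfI p0); rewrite -lfE e (big_rem _ qs) /= ew; ring.
case: (IH (rem q ps) k (u * w)) => //.
- by rewrite size_rem // prednK // -ltnS //; case: (ps) qs.
- by rewrite unitrM uu.
- by move=> x /mem_rem /pps.
move=> c [g [c0 ekg pg]]; exists (p * c), g; split=> //; first by rewrite mulf_neq0.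
by rewrite ek ekg scalerA.
Qed.

Lemma primitive_scale c f g : c != 0 -> f = c *: g -> primitive f ->
  c \is a GRing.unit.
Proof.
move=> c0 e pf; have [u [[|p ps] [uu pps ec]]] := fA c0.
  by rewrite ec big_nil mulr1.
case: (pf p); first by apply: pps; rewrite mem_head.
rewrite e ec big_cons mulrCA; exists ((u * \prod_(x <- ps) x) *: g).
by rewrite [RHS]mulrC mul_polyC scalerA.
Qed.

(** When [c] is distributed over [k] and [g], the part that falls on the primitive [g] is a unit. *)
Lemma primitive_dvd c f g k : c != 0 -> primitive g -> c *: f = k * g ->
  divides g f.
Proof.
move=> c0 pg /(gauss_scale c0)[k' [g' [c1 [c2 [c10 c20 ek eg ->]]]]].
have cu := primitive_scale c20 eg pg.
by exists (c2^-1 *: k'); rewrite eg -scalerAl -scalerAr scalerA mulVr // scale1r.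
Qed.

End GaussLemma.

Section FactorialPoly.
Variable A : idomainType.
Hypothesis fA : factorial A.
Implicit Types f g h : {poly A}.

(** Irreducibility leaves two options for the pseudo-gcd of [f] and [g]. If the cofactor of [f] is
    constant, [f] divides [g] up to a scalar; if the pseudo-gcd is constant, Bezout multiplied by
    [h] shows that [f] divides [h] up to a scalar. Primitivity of [f] removes the scalar. *)
Lemma primitive_irreducible_prime f : (1 < size f)%N -> primitive f ->
  (forall g h, f = g * h -> size g = 1%N \/ size h = 1%N) -> prime_elt f.
Proof.
move=> sf pf irr; have f0 : f != 0 by rewrite -size_poly_gt0 (ltn_trans _ sf).
split=> //; first by rewrite poly_unitE gtn_eqF.
move=> g h [k ek].
have [u eu] := Bezoutp f g; set d := gcdp f g in eu.
have := dvdp_gcdl f g; rewrite -/d => /Pdiv.WeakIdomain.dvdpP[[c q] /= c0 e].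
have [q' [d' [c1 [c2 [c10 c20 eq ed ef]]]]] := gauss_scale fA c0 e.
have /eqpP[[a b] /andP[/= a0 b0] eab] := eu.
have [sq|sd] := irr _ _ ef.
  have /eqP/size_poly1P[r r0 er] := sq.
  left; have := dvdp_gcdr f g; rewrite -/d => /Pdiv.WeakIdomain.dvdpP[[c' k'] /= c'0 e'].
  apply: (@primitive_dvd _ fA (r * c') _ _ (c2 *: k')); rewrite ?mulf_neq0 //.
  by rewrite -scalerA e' ed ef er mul_polyC -!scalerAr -!scalerAl !scalerA mulrC.
right; have /eqP/size_poly1P[r r0 er] := sd.
apply: (@primitive_dvd _ fA (b * c2 * r) _ _ (a *: (u.1 * h + u.2 * k))) => //.
  by rewrite !mulf_neq0.
have -> : (b * c2 * r) *: h = (a *: (u.1 * f + u.2 * g)) * h.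
  by rewrite eab ed er -!mul_polyC !polyCM !mulrA.
rewrite -!scalerAl; congr (_ *: _); rewrite !mulrDl -!mulrA ek; ring.
Qed.

Lemma factorial_poly : factorial {poly A}.
Proof.
move=> f f0; have [n le_n] := ubnP (size f).
elim: n f f0 le_n => // n IH f f0 le_n.
have prodM u1 u2 (s1 s2 : seq {poly A}) :
   (u1 * \prod_(x <- s1) x) * (u2 * \prod_(x <- s2) x) = (u1 * u2) * \prod_(x <- s1 ++ s2) x.
  by rewrite big_cat /=; ring.
have constF (c : A) : c != 0 -> exists (u : {poly A}) (ps : seq {poly A}),
    [/\ u \is a GRing.unit, forall p, p \in ps -> prime_elt p & c%:P = u * \prod_(p <- ps) p].
  move=> c0; have [u [ps [uu pps ->]]] := fA c0.
  exists u%:P, (map polyC ps); split.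
  - have u0 : u != 0 by apply: contraTneq uu => ->; rewrite unitr0.
    by rewrite poly_unitE size_polyC coefC eqxx uu u0.
  - by move=> p /mapP[q /pps pq ->]; apply: prime_polyC.
  by rewrite polyCM rmorph_prod big_map.
have [c [g [c0 ef pg]]] := primitive_part fA f0.
have [u1 [ps1 [uu1 pps1 e1]]] := constF c c0.
have g0 : g != 0 by apply: contraNneq f0 => g0; rewrite ef g0 scaler0.
have sfg : size f = size g by rewrite ef size_scale.
suff [u2 [ps2 [uu2 pps2 e2]]] : exists (u : {poly A}) (ps : seq {poly A}),
    [/\ u \is a GRing.unit, forall p, p \in ps -> prime_elt p & g = u * \prod_(p <- ps) p].
  exists (u1 * u2), (ps1 ++ ps2); split; first by rewrite unitrM uu1.
    by move=> p; rewrite mem_cat => /orP[/pps1|/pps2].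
  by rewrite ef -mul_polyC e1 {1}e2 prodM.
case: (leqP (size g) 1) => [|sg].
  move=> /size1_polyC eg; rewrite eg; apply: constF.
  by apply: contraNneq g0 => e; rewrite eg e.
case: (pselect (forall a b, g = a * b -> size a = 1%N \/ size b = 1%N)) => [irr|].
  exists 1, [:: g]; rewrite unitr1 big_seq1 mul1r; split=> // p.
  by rewrite inE => /eqP->; apply: primitive_irreducible_prime.
move=> /existsNP[a /existsNP[b /not_implyP[eab /not_orP[na nb]]]].
have [a0 b0] : a != 0 /\ b != 0.
  by apply/andP; rewrite -negb_or -mulf_eq0 -eab.
have sab := size_mul a0 b0; rewrite -eab -sfg in sab.
have sa : (1 < size a)%N by rewrite ltn_neqAle eq_sym size_poly_gt0 a0 andbT; apply/eqP.
have sb : (1 < size b)%N by rewrite ltn_neqAle eq_sym size_poly_gt0 b0 andbT; apply/eqP.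
have [la lb] : (size a < n)%N /\ (size b < n)%N.
  by move: sab sa sb le_n; move: (size f) (size a) (size b) => x y z; lia.
have [u3 [ps3 [uu3 pps3 e3]]] := IH a a0 la.
have [u4 [ps4 [uu4 pps4 e4]]] := IH b b0 lb.
exists (u3 * u4), (ps3 ++ ps4); split; first by rewrite unitrM uu3.
  by move=> p; rewrite mem_cat => /orP[/pps3|/pps4].
by rewrite eab {1}e3 {1}e4 prodM.
Qed.

Lemma bezout_family n (g : 'I_n -> {poly A}) : exists (G : {poly A}) (h : 'I_n -> {poly A}),
  \sum_i h i * g i = G /\ forall i, exists2 ck, ck.1 != 0 & ck.1 *: g i = ck.2 * G.
Proof.
elim: n g => [|n IH] g; first by exists 0, g; rewrite big_ord0; split=> // -[].
have [G' [h [eG dG]]] := IH (fun i => g (lift ord0 i)).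
have [u eu] := Bezoutp (g ord0) G'.
exists (u.1 * g ord0 + u.2 * G'),
  (fun i => if unlift ord0 i is Some j then u.2 * h j else u.1); split.
  rewrite big_ord_recl unlift_none; congr (_ + _).
  rewrite -eG mulr_sumr; apply: eq_bigr => i _; rewrite liftK mulrA //.
have d0 : (u.1 * g ord0 + u.2 * G') %| g ord0 by rewrite (eqp_dvdl _ eu) dvdp_gcdl.
have d1 : (u.1 * g ord0 + u.2 * G') %| G' by rewrite (eqp_dvdl _ eu) dvdp_gcdr.
move=> i; apply/Pdiv.WeakIdomain.dvdpP; case: (unliftP ord0 i) => [j|] -> //.
apply: dvdp_trans d1 _; apply/Pdiv.WeakIdomain.dvdpP; exact: dG.
Qed.

(* A pseudo-gcd divides the family only up to scalars; its primitive part
   divides it on the nose. *)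
Lemma coprime_bezout n (g : 'I_n -> {poly A}) :
  (exists i, g i != 0) ->
  (forall G, (forall i, divides G (g i)) -> (size G <= 1)%N) ->
  exists (h : 'I_n -> {poly A}) (r : A), r != 0 /\ \sum_i h i * g i = r%:P.
Proof.
move=> [i0 gi0] cop; have [G [h [eG dG]]] := bezout_family g.
have G0 : G != 0.
  apply: contraNneq gi0 => G0; have [[c k] /= c0] := dG i0.
  rewrite G0 mulr0 => /eqP; rewrite -mul_polyC mulf_eq0 polyC_eq0 (negPf c0) //.
have [c [G1 [c0 e pG]]] := primitive_part fA G0.
have sG : (size G <= 1)%N.
  rewrite e size_scale //; apply: cop => i; have [[c' k] /= c'0 e'] := dG i.
  apply: (primitive_dvd fA c'0 pG (k := c *: k)).
  by rewrite e' e -scalerAl -scalerAr.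
exists h, G`_0; rewrite eG -size1_polyC // ; split=> //.
by apply: contraNneq G0 => e0; rewrite (size1_polyC sG) e0.
Qed.

End FactorialPoly.

Lemma exists_neq0 (I : Type) (V : nmodType) (f : I -> V) :
  ~ (forall i, f i = 0) -> exists i, f i != 0.
Proof.
move=> h; apply: contrapT => /forallNP k; apply: h => i.
exact/eqP/negPn/negP/k.
Qed.

Lemma factorial_iso (A B : idomainType) (f : {rmorphism A -> B}) (g : {rmorphism B -> A}) :
  cancel f g -> cancel g f -> factorial A -> factorial B.
Proof.
move=> fK gK fA b b0.
have gb0 : g b != 0 by apply: contraNneq b0 => e; rewrite -[b]gK e rmorph0.
have [u [ps [uu pps e]]] := fA _ gb0.
exists (f u), (map f ps); split; first exact: rmorph_unit.
  move=> _ /mapP[p /pps[p0 pu pp] ->]; split.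
  - by apply: contraNneq p0 => e0; rewrite -[p]fK e0 rmorph0.
  - by apply: contra pu => /(rmorph_unit g); rewrite fK.
  move=> x y [k ek]; have [] : divides p (g x) \/ divides p (g y).
  - by apply: pp; exists (g k); rewrite -rmorphM ek rmorphM fK.
  - by move=> [k' e']; left; exists (f k'); rewrite -rmorphM -e' gK.
  - by move=> [k' e']; right; exists (f k'); rewrite -rmorphM -e' gK.
by rewrite big_map -rmorph_prod -rmorphM -e gK.
Qed.

(** * Multivariate polynomial rings are factorial *)

Section MuniIso.
Variables (R : comNzRingType) (n : nat).

(** Inverse of [muni]: it lets factoriality pass from [n] to [n + 1] variables. *)
Definition mjoin (p : {poly {mpoly R[n]}}) : {mpoly R[n.+1]} :=
  (map_poly (@mwiden n R) p).['X_ord_max].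

Lemma mjoin_is_additive : additive mjoin.
Proof. by move=> p q; rewrite /mjoin rmorphB hornerD hornerN. Qed.
HB.instance Definition _ := GRing.isAdditive.Build _ _ mjoin mjoin_is_additive.

Lemma mjoin_is_multiplicative : multiplicative mjoin.
Proof. by split=> [p q|]; rewrite /mjoin ?rmorphM ?rmorph1 ?hornerM // hornerC. Qed.
HB.instance Definition _ := GRing.isMultiplicative.Build _ _ mjoin mjoin_is_multiplicative.

Lemma mjoinD : {morph mjoin : p q / p + q}. Proof. exact: raddfD. Qed.

Lemma mjoinM : {morph mjoin : p q / p * q}. Proof. exact: rmorphM. Qed.

Lemma mjoinXn k : {morph mjoin : p / p ^+ k}. Proof. exact: rmorphXn. Qed.

Lemma mjoinC q : mjoin q%:P = mwiden q.
Proof. by rewrite /mjoin map_polyC hornerC. Qed.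

Lemma mjoinX : mjoin 'X = 'X_ord_max.
Proof. by rewrite /mjoin map_polyX hornerX. Qed.

Lemma muniX (m : 'X_{1..n.+1}) : muni 'X_[R, m] =
  'X_[[multinom (m (widen_ord (leqnSn n) i)) | i < n]] *: 'X^(m ord_max).
Proof. by rewrite muniE msuppX big_seq1 mcoeffX eqxx scale1r. Qed.

Lemma muni_mwiden (q : {mpoly R[n]}) : muni (mwiden q) = q%:P.
Proof.
elim/mpolyind: q => [|c m q _ _ IH]; first by rewrite !raddf0.
rewrite mwidenD muniD IH polyCD mwidenZ mwidenX muniZ muniX mnmwiden_ordmax.
rewrite expr0 alg_polyC -[c%:MP *: _]mul_polyC -polyCM mul_mpolyC.
rewrite (_ : [multinom _ | i < n] = m) //.
by apply/mnmP => i; rewrite mnmE mnmwiden_widen.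
Qed.

Lemma mjoinK : cancel mjoin (@muni n R).
Proof.
move=> p; elim/poly_ind: p => [|p c IH]; first by rewrite !raddf0.
rewrite !rmorphD !rmorphM /= IH mjoinX mjoinC.
rewrite muni_mwiden muniX mnm1E eqxx expr1; congr (_ * _ + _).
rewrite (_ : [multinom _ | i < n] = 0%MM) ?mpolyX0 ?scale1r //.
apply/mnmP => j; rewrite mnmE mnm1E mnm0E; case: eqP => // /(congr1 val) /= e.
by have := ltn_ord j; rewrite -e ltnn.
Qed.

Lemma muniK : cancel (@muni n R) mjoin.
Proof.
have HD q r : mjoin (muni q) = q -> mjoin (muni r) = r -> mjoin (muni (q + r)) = q + r.
  by rewrite muniD mjoinD => e1 e2; apply: f_equal2.
move=> p; elim/mpolyind: p => [|c m p _ _]; first by rewrite !raddf0.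
apply: HD.
rewrite muniZ muniX -[c%:MP *: _]mul_polyC -['X_[_] *: _]mul_polyC !mjoinM.
rewrite mjoinXn !mjoinC mjoinX mwidenC mul_mpolyC mwidenX.
rewrite mpolyXn -mpolyXD; congr (_ *: 'X_[_]); apply/mnmP => i.
rewrite mnmDE mulmnE mnm1E; case: (unliftP ord_max i) => [j|] ->; last first.
  by rewrite eqxx mnmwiden_ordmax mul1n.
have -> : lift ord_max j = widen_ord (leqnSn n) j by apply: val_inj; rewrite /= /bump leqNgt ltn_ord.
rewrite mnmwiden_widen mnmE; case: eqP => [/(congr1 val) /= e|_].
  by have := ltn_ord j; rewrite -e ltnn.
by rewrite addn0.
Qed.

End MuniIso.

Lemma mpoly_factorial (K : fieldType) n : factorial {mpoly K[n]}.
Proof.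
elim: n => [|n IH].
  move=> a a0; exists a, [::]; rewrite big_nil mulr1; split=> //.
  move: a0; rewrite (nvar0_mpolyC a) => a0; apply: rmorph_unit.
  by rewrite unitfE -(mpolyC_eq0 0).
exact: (factorial_iso (@mjoinK K n) (@muniK K n) (factorial_poly IH)).
Qed.

(** * Polynomials as functions over an infinite field *)

Section Nonvanishing.
Variable K : numFieldType.

Lemma poly_nonroot (p : {poly K}) : p != 0 -> exists x, p.[x] != 0.
Proof.
move=> p0; pose s := [seq (i%:R : K) | i <- iota 0 (size p)].
have us : uniq s by rewrite map_inj_uniq ?iota_uniq //; move=> i j /eqP; rewrite eqr_nat => /eqP.
apply: contrapT => /forallNP h.
have: (size s < size p)%N.
  apply: max_poly_roots => //; apply/allP => x _; apply/rootP.
  by apply/eqP; apply/negPn/negP; apply: h.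
by rewrite size_map size_iota ltnn.
Qed.

Lemma poly_ext_off (p q r : {poly K}) : r != 0 ->
  (forall x, r.[x] != 0 -> p.[x] = q.[x]) -> p = q.
Proof.
move=> r0 h; apply/eqP; rewrite -subr_eq0; apply: contraT => pq.
have [x] := poly_nonroot (mulf_neq0 pq r0).
by rewrite hornerM mulf_eq0 negb_or hornerD hornerN => /andP[/eqP n0 /h e]; case: n0; rewrite e subrr.
Qed.

Lemma poly_ext (p q : {poly K}) : (forall x, p.[x] = q.[x]) -> p = q.
Proof. by move=> h; apply: (poly_ext_off (oner_neq0 _)) => x _. Qed.

Lemma meval_muni n (p : {mpoly K[n.+1]}) v :
  p.@[v] = (map_poly (meval (fun i => v (widen_ord (leqnSn n) i))) (muni p)).[v ord_max].
Proof.
rewrite muniE raddf_sum /= horner_sum mevalE; apply: eq_bigr => m _.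
rewrite -!mul_polyC !rmorphM /= map_polyC /= map_polyXn !hornerE -mul_mpolyC.
rewrite mevalM mevalC mevalX -mulrA; congr (_ * _); rewrite big_ord_recr; congr (_ * _).
by apply: eq_bigr => i _; rewrite mnmE.
Qed.

Lemma mpoly_nonroot n (p : {mpoly K[n]}) : p != 0 -> exists v, p.@[v] != 0.
Proof.
elim: n p => [|n IH] p p0.
  exists (fun=> 0); move: p0; rewrite (nvar0_mpolyC p) mevalC.
  by rewrite mpolyC_eq0.
have: muni p != 0 by apply: contraNneq p0 => e; rewrite -[p]muniK e raddf0.
rewrite -lead_coef_eq0 => /IH[v hv].
have: map_poly (meval v) (muni p) != 0.
  by apply: contraNneq hv => /polyP/(_ (size (muni p)).-1); rewrite coef_map coef0 => ->.
move=> /poly_nonroot[x hx]; pose w i := if unlift ord_max i is Some j then v j else x.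
exists w; rewrite meval_muni {2}/w unlift_none.
suff -> : map_poly (meval (fun i => w (widen_ord (leqnSn n) i))) (muni p) =
  map_poly (meval v) (muni p) by [].
apply: eq_map_poly => q; apply: meval_eq => i; rewrite /w.
have -> : widen_ord (leqnSn n) i = lift ord_max i by apply: val_inj; rewrite /= /bump leqNgt ltn_ord.
by rewrite liftK.
Qed.

Lemma mpoly_zero n (p : {mpoly K[n]}) : (forall v, p.@[v] = 0) -> p = 0.
Proof.
move=> h; apply/eqP; apply: contraT => /mpoly_nonroot[v]; by rewrite h eqxx.
Qed.

Lemma mpoly_zero_off n (p q : {mpoly K[n]}) : q != 0 ->
  (forall v, q.@[v] != 0 -> p.@[v] = 0) -> p = 0.
Proof.
move=> q0 h; apply/eqP; apply: contraT => p0.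
have [x] := mpoly_nonroot (mulf_neq0 p0 q0).
by rewrite mevalM mulf_eq0 negb_or => /andP[px /h]; move/eqP: px.
Qed.

End Nonvanishing.

(** * Chain rule and Euler's identity *)

Section Derivations.
Variables (R S : comNzRingType) (n : nat) (f : {rmorphism R -> S}) (h : 'I_n -> S).
Variable D : S -> S.
Hypothesis DD : {morph D : x y / x + y}.
Hypothesis DM : forall x y, D (x * y) = D x * y + x * D y.
Hypothesis Df : forall c, D (f c) = 0.

(** One chain rule for all later uses: [D] will be the derivative in [x], a partial derivative, or a
    partial derivative applied to the coefficients of a polynomial in [x]. *)
Lemma mmap_derivation (p : {mpoly R[n]}) :
  D (mmap f h p) = \sum_i mmap f h p^`M(i) * D (h i).
Proof.
pose Q q := D (mmap f h q) = \sum_i mmap f h q^`M(i) * D (h i).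
have QD q r : Q q -> Q r -> Q (q + r).
  rewrite /Q raddfD DD /= => -> ->; rewrite -big_split; apply: eq_bigr => i _ /=.
  by rewrite mderivD raddfD mulrDl.
have QM q r : Q q -> Q r -> Q (q * r).
  rewrite /Q rmorphM DM /= => -> ->; rewrite mulr_suml mulr_sumr -big_split.
  apply: eq_bigr => i _ /=; rewrite mderivM rmorphD !rmorphM /=; ring.
have QC c : Q c%:MP.
  rewrite /Q mmapC Df big1 // => i _; by rewrite mderivC raddf0 mul0r.
have QX i : Q 'X_i.
  rewrite /Q mmapX mmap1U (bigD1 i) //= mderivX mnm1E eqxx (_ : _ - _ = 0)%MM; last first.
    by apply/mnmP => k; rewrite mnmBE mnm0E subnn.
  rewrite mpolyX0 scale1r.
  rewrite rmorph1 mul1r big1 ?addr0 // => j ne.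
  by rewrite mderivX mnm1E eq_sym (negPf ne) scale0r raddf0 mul0r.
have Q1 : Q 1 by apply: QC.
rewrite -/(Q p) [p]mpolyE; elim/big_ind: _ => //; first by rewrite -mpolyC0.
move=> m _; rewrite -mul_mpolyC mpolyXE_id; apply: (QM) => //.
elim/big_ind: _ => // i _; elim: (m i) => // k IH.
by rewrite exprS; apply: QM.
Qed.

End Derivations.

Section MpolyFacts.
Variable n : nat.

Lemma mderiv_homog (R : nzRingType) d (p : {mpoly R[n]}) i :
  p \is d.-homog -> p^`M(i) \is d.-1.-homog.
Proof.
move=> /dhomogP hp; apply/dhomogP => m; rewrite mcoeff_msupp mcoeff_deriv => h.
have /hp /= : (m + U_(i))%MM \in msupp p.
  by rewrite mcoeff_msupp; apply: contraNneq h => ->; rewrite mul0rn.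
by rewrite mdegD mdeg1 addn1 => <-.
Qed.

Lemma euler_identity (R : comNzRingType) d (p : {mpoly R[n]}) :
  p \is d.-homog -> \sum_i 'X_i * p^`M(i) = p *+ d.
Proof.
move=> /dhomogP hp; rewrite [in RHS](mpolyE p) -sumrMnl.
have e i : 'X_i * p^`M(i) = \sum_(m <- msupp p) ((m i)%:R * p@_m) *: 'X_[m].
  rewrite mulr_sumr; apply: eq_bigr => m _; rewrite -scalerAr -mpolyXD.
  have [->|m0] := eqVneq (m i) 0%N; first by rewrite mul0r !scale0r.
  by rewrite addmC submK // lep1mP.
under eq_bigr do rewrite e; rewrite exchange_big; apply: eq_big_seq => m mp /=.
by rewrite -scaler_suml -mulr_suml -natr_sum -mdegE (hp m mp) mulr_natl scalerMnl.
Qed.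

Lemma mderiv_var (R : nzRingType) i j : ('X_i : {mpoly R[n]})^`M(j) = (i == j)%:R.
Proof.
rewrite mderivX mnm1E; have [<-|_] := eqVneq; last by rewrite scale0r.
by rewrite scale1r -{1}[U_(i)%MM]addm0 addmC addmK mpolyX0.
Qed.

Lemma mderiv_eq0 (K : numFieldType) (p : {mpoly K[n]}) :
  (forall i, p^`M(i) = 0) -> p = (p@_0%MM)%:MP.
Proof.
move=> h; apply/mpolyP => m; rewrite mcoeffC; have [->|m0] := eqVneq m 0%MM.
  by rewrite mulr1.
have [i mi] : exists i, m i != 0%N.
  by apply: exists_neq0 => k; case/eqP: m0; apply/mnmP => i; rewrite mnm0E.
have /(congr1 (mcoeff (m - U_(i))%MM)) := h i.
rewrite mcoeff_deriv mcoeff0 submK ?lep1mP // => /eqP.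
by rewrite mulrn_eq0 /= mulr0 => /eqP.
Qed.

Lemma meval_homog (R : comNzRingType) d (p : {mpoly R[n]}) a v :
  p \is d.-homog -> p.@[fun i => a * v i] = a ^+ d * p.@[v].
Proof.
move=> /dhomogP hp; rewrite !mevalE mulr_sumr; apply: eq_big_seq => m mp.
rewrite mulrCA; congr (_ * _); under eq_bigr => i _ do rewrite exprMn.
by rewrite big_split /= -(big_morph _ (exprD a) (expr0 a)) -mdegE (hp m mp).
Qed.

End MpolyFacts.

(** * Transcendence degree and Jacobian rank *)

Lemma mmap_morph (R S T : comNzRingType) n (phi : {rmorphism S -> T}) (f : R -> S)
    (f' : R -> T) (h : 'I_n -> S) (h' : 'I_n -> T) (p : {mpoly R[n]}) :
  (forall c, phi (f c) = f' c) -> (forall i, phi (h i) = h' i) ->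
  phi (mmap f h p) = mmap f' h' p.
Proof.
move=> ef eh; rewrite /mmap rmorph_sum; apply: eq_bigr => m _.
rewrite rmorphM ef /mmap1 rmorph_prod; congr (_ * _); apply: eq_bigr => i _.
by rewrite rmorphXn eh.
Qed.

Lemma mmapXU (R S : comNzRingType) n (f : {rmorphism R -> S}) (h : 'I_n -> S) i :
  mmap f h 'X_i = h i.
Proof. by rewrite mmapX mmap1U. Qed.

Lemma horner_mmap (R : comNzRingType) n (h : 'I_n -> {poly R}) P x :
  (mmap (@polyC R) h P).[x] = P.@[fun i => (h i).[x]].
Proof.
by apply: (mmap_morph (phi := horner_eval x)) => // c; rewrite /= /horner_eval hornerC.
Qed.

Lemma deriv_mmap (R : comNzRingType) n (h : 'I_n -> {poly R}) P :
  (mmap (@polyC R) h P)^`() = \sum_i mmap (@polyC R) h P^`M(i) * (h i)^`().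
Proof.
rewrite (@mmap_derivation _ _ _ (@polyC R) h (@deriv R)) // => [x y|x y|c].
- exact: derivD.
- exact: derivM.
exact: derivC.
Qed.

Lemma mmap_const_var (K : numFieldType) (S : comNzRingType) n (f : {rmorphism K -> S})
    (P : {mpoly K[n]}) i (g g' : 'I_n -> S) :
  P^`M(i) = 0 -> (forall j, j != i -> g j = g' j) -> mmap f g P = mmap f g' P.
Proof.
move=> dP eg; apply: eq_big_seq => m; rewrite mcoeff_msupp => mP; congr (_ * _).
apply: eq_bigr => j _; have [->|/eg->//] := eqVneq j i.
suff -> : m i = 0%N by rewrite !expr0.
apply/eqP; apply: contraTT mP => m0.
have := mcoeff_deriv i (m - U_(i))%MM P; rewrite dP mcoeff0 submK ?lep1mP //.
by move=> /esym/eqP; rewrite mulrn_eq0 /= negbK.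
Qed.

Lemma mmap_var (R : comNzRingType) n (P : {mpoly R[n]}) :
  mmap (@mpolyC n R) (fun i => 'X_i) P = P.
Proof.
rewrite -[RHS]comp_mpoly_id; apply: eq_bigr => m _; congr (_ * _).
by apply: eq_bigr => i _; rewrite tnth_mktuple.
Qed.

Lemma msizeM_leq (R : idomainType) n (p q : {mpoly R[n]}) :
  (msize (p * q) <= (msize p + msize q).-1)%N.
Proof.
have [->|p0] := eqVneq p 0; first by rewrite mul0r msize0.
have [->|q0] := eqVneq q 0; first by rewrite mulr0 msize0.
by rewrite msizeM.
Qed.

Section AlgebraicIndependence.
Variables (K : numFieldType) (N : nat).
Local Notation R := {mpoly K[N]}.

Definition subst n (g : 'I_n -> R) (P : {mpoly K[n]}) : R := mmap (@mpolyC N K) g P.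

Lemma meval_subst n (g : 'I_n -> R) P v :
  (subst g P).@[v] = P.@[fun i => (g i).@[v]].
Proof. by apply: mmap_morph => // c; rewrite /= mevalC. Qed.

Lemma mderiv_subst n (g : 'I_n -> R) P k :
  (subst g P)^`M(k) = \sum_i subst g P^`M(i) * (g i)^`M(k).
Proof.
apply: (@mmap_derivation _ _ _ (@mpolyC N K) g (mderiv k)) => [x y|x y|c].
- exact: mderivD.
- exact: mderivM.
exact: mderivC.
Qed.

Definition alg_independent n (g : 'I_n -> R) : Prop :=
  forall P : {mpoly K[n]}, subst g P = 0 -> P = 0.

Definition jacobian n (g : 'I_n -> R) (c : 'I_N -> K) : 'M[K]_(n, N) :=
  \matrix_(i, k) (g i)^`M(k).@[c].

Lemma msize_mderiv n (P : {mpoly K[n]}) i : P^`M(i) != 0 ->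
  (msize P^`M(i) < msize P)%N.
Proof.
move=> nz; rewrite -(mlead_deg nz); have := mlead_supp nz.
rewrite mcoeff_msupp mcoeff_deriv => h.
have /msize_mdeg_lt : (mlead P^`M(i) + U_(i))%MM \in msupp P.
  by rewrite mcoeff_msupp; apply: contraNneq h => ->; rewrite mul0rn.
by rewrite mdegD mdeg1 addn1.
Qed.

(* Take [P] of least degree. *)
Lemma minimal_annihilator n (g : 'I_n -> R) : ~ alg_independent g ->
  exists P, [/\ P != 0, subst g P = 0
    & forall i, subst g P^`M(i) = 0 -> P^`M(i) = 0].
Proof.
move=> /existsNP[P0 /not_implyP[e0 /eqP n0]].
pose Q k := `[< exists P, [/\ P != 0, subst g P = 0 & msize P = k] >].
have ex : exists k, Q k by exists (msize P0); apply/asboolP; exists P0.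
case: (ex_minnP ex) => k /asboolP[P [nP eP sP]] mink.
exists P; split=> // i ei; apply/eqP; apply: contraT => ni.
have := msize_mderiv ni; rewrite sP ltnNge => /negP[].
by apply: mink; apply/asboolP; exists P^`M(i).
Qed.

(** A right inverse of the matrix at [c], read as a constant matrix, makes a square product whose
    determinant is 1 at [c], hence nonzero; the adjugate then cancels it. *)
Lemma kernel_row_free_at m n (J : 'M[R]_(m, n)) (a : 'rV[R]_m) c :
  row_free (map_mx (meval c) J) -> a *m J = 0 -> a = 0.
Proof.
move=> /row_freeP[B eB] aJ; pose M := J *m map_mx (@mpolyC N K) B.
have eM : (\det M).@[c] = 1.
  rewrite -det_map_mx map_mxM (_ : map_mx _ (map_mx _ B) = B) ?eB ?det1 //.
  by apply/matrixP => i k; rewrite !mxE /= mevalC.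
have dM : \det M != 0.
  by apply/eqP => e0; have := oner_neq0 K; rewrite -eM e0 meval0 eqxx.
have : a *m M *m \adj M = 0 by rewrite mulmxA aJ !mul0mx.
rewrite -mulmxA mul_mx_adj mul_mx_scalar => e.
apply/rowP => i; have /rowP/(_ i) := e; rewrite !mxE => /eqP.
by rewrite mulf_eq0 (negPf dM) => /eqP.
Qed.

(** Differentiating a relation [P] of least degree puts the row of the [P_i(g)] in the left kernel
    of the Jacobian matrix. So all [P_i(g)] vanish, by minimality all [P_i] do, and [P] is a
    constant equal to 0. *)
Lemma jacobian_independent n (g : 'I_n -> R) c :
  \rank (jacobian g c) = n -> alg_independent g.
Proof.
move=> rk; apply: contrapT => /minimal_annihilator[P [nP eP minP]].
pose a : 'rV[R]_n := \row_i subst g P^`M(i).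
pose J : 'M[R]_(n, N) := \matrix_(i, k) (g i)^`M(k).
have a0 : a = 0.
  apply: (@kernel_row_free_at _ _ J a c).
    rewrite (_ : map_mx _ J = jacobian g c); first by rewrite /row_free rk.
    by apply/matrixP => i k; rewrite !mxE.
  apply/rowP => k; have := mderiv_subst g P k; rewrite eP raddf0 => e.
  by rewrite !mxE [RHS]e; apply: eq_bigr => i _; rewrite !mxE.
have dP i : P^`M(i) = 0.
  by apply: minP; have /rowP/(_ i) := a0; rewrite !mxE.
have eC := mderiv_eq0 dP; case/eqP: nP.
move: eP; rewrite eC /subst mmapC => /eqP; rewrite mpolyC_eq0 => /eqP->.
exact: mpolyC0.
Qed.

(** Counting: if [n > N], there are more monomials with exponents below [k] in the [g_i] than
    monomials in [N] variables available to write them, so two combinations coincide. *)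
Lemma alg_independent_leq n (g : 'I_n -> R) : alg_independent g -> (n <= N)%N.
Proof.
move=> ind; rewrite leqNgt; apply/negP => lt_Nn.
pose D := \max_i msize (g i).
(* Large enough that [B ^ N <= ((n D + 1) k) ^ N < k ^ (N + 1) <= k ^ n]. *)
pose k := (((n * D).+1) ^ N).+1.
pose B := (n * k * D).+1.
pose mon (al : {ffun 'I_n -> 'I_k}) : 'X_{1..n} := [multinom (al i : nat) | i < n].
pose mon' (be : {ffun 'I_N -> 'I_B}) : 'X_{1..N} := [multinom (be i : nat) | i < N].
have mon_inj : injective mon.
  move=> al al' /mnmP e; apply/ffunP => i; apply/val_inj.
  by have := e i; rewrite !mnmE.
have size_mon al : (msize (subst g 'X_[mon al]) <= B)%N.
  have -> : subst g 'X_[mon al] = \prod_i g i ^+ mon al i by rewrite /subst mmapX.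
  have sX (p : R) j : (msize p <= D)%N -> (msize (p ^+ j) <= (j * D).+1)%N.
    move=> sp; elim: j => [|j IH]; first by rewrite expr0 msize1.
    rewrite exprS; apply: leq_trans (msizeM_leq _ _) _.
    rewrite mulSn; move: (msize p) (msize (p ^+ j)) (j * D)%N sp IH => a b c; lia.
  suff H (s : seq 'I_n) : (msize (\prod_(i <- s) g i ^+ mon al i) <= (size s * k * D).+1)%N.
    by have := H (index_enum 'I_n); rewrite /index_enum -enumT size_enum_ord.
  elim: s => [|i s IH]; first by rewrite big_nil msize1.
  rewrite big_cons; apply: leq_trans (msizeM_leq _ _) _.
  have h1 := sX (g i) (mon al i) (leq_bigmax i).
  have h2 : (mon al i * D <= k * D)%N by rewrite leq_mul2r mnmE ltnW ?orbT.
  rewrite /= mulSn mulnDl; move: IH h1 h2.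
  by move: (msize _) (msize _) (mon al i * D)%N (k * D)%N (size s * k * D)%N => a b c e f; lia.
have card_lt : (#|{ffun 'I_N -> 'I_B}| < #|{ffun 'I_n -> 'I_k}|)%N.
  rewrite !card_ffun !card_ord; apply: (@leq_trans (k ^ N.+1)%N); last first.
    by rewrite leq_pexp2l.
  rewrite expnS; apply: (@leq_ltn_trans ((n * D).+1 ^ N * k ^ N)%N); last first.
    by rewrite ltn_mul2r expn_gt0 /=.
  rewrite -expnMn; apply: (@leq_trans (((n * D).+1 * k) ^ N)%N) => //.
  case: (N) => // N'; rewrite leq_exp2r // /B mulSn -mulnA [(k * D)%N]mulnC mulnA.
  by rewrite addnC -addn1 leq_add2l.
pose M : 'M[K]_(#|{ffun 'I_n -> 'I_k}|, #|{ffun 'I_N -> 'I_B}|) :=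
  \matrix_(i, j) (subst g 'X_[mon (enum_val i)])@_(mon' (enum_val j)).
have /rowV0Pn[a /sub_kermxP aM a0] : kermx M != 0.
  rewrite -mxrank_eq0 mxrank_ker subn_eq0 -ltnNge.
  by apply: leq_ltn_trans card_lt; apply: rank_leq_col.
pose P := \sum_i a 0 i *: 'X_[mon (enum_val i)].
have eP : subst g P = 0.
  have -> : subst g P = \sum_i a 0 i *: subst g 'X_[mon (enum_val i)].
    rewrite /subst raddf_sum; apply: eq_bigr => i _.
    by rewrite /= mmapZ mul_mpolyC.
  apply/mpolyP => m; rewrite mcoeff0 raddf_sum /=.
  have [lt_m|ge_m] := ltnP (mdeg m) B; last first.
    rewrite big1 // => i _; rewrite mcoeffZ memN_msupp_eq0 ?mulr0 //.
    by apply: msize_mdeg_ge; apply: leq_trans ge_m.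
  have lt_mi i : (m i < B)%N.
    by apply: leq_ltn_trans lt_m; rewrite mdegE (bigD1 i) //= leq_addr.
  pose be : {ffun 'I_N -> 'I_B} := [ffun i => Ordinal (lt_mi i)].
  have em : mon' be = m by apply/mnmP => i; rewrite mnmE ffunE.
  have /rowP/(_ (enum_rank be)) := aM; rewrite mxE [in X in _ = X -> _]mxE => e0.
  rewrite -[RHS]e0; apply: eq_bigr => i _.
  by rewrite mxE enum_rankK em mcoeffZ.
case/negP: a0; apply/eqP/rowP => i; rewrite mxE.
have /(congr1 (mcoeff (mon (enum_val i)))) := ind P eP.
rewrite mcoeff0 raddf_sum /= (bigD1 i) //= mcoeffZ mcoeffX eqxx mulr1 big1 ?addr0 //.
move=> j ne; rewrite mcoeffZ mcoeffX; case: eqP => [/mon_inj/enum_val_inj e|_].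
  by rewrite e eqxx in ne.
by rewrite mulr0.
Qed.

Definition extend n (g : 'I_n -> R) (x : R) (i : 'I_n.+1) : R :=
  if unlift ord_max i is Some j then g j else x.

Lemma extend_max n (g : 'I_n -> R) x : extend g x ord_max = x.
Proof. by rewrite /extend unlift_none. Qed.

Lemma extend_widen n (g : 'I_n -> R) x i : extend g x (widen_ord (leqnSn n) i) = g i.
Proof.
rewrite /extend (_ : widen_ord _ _ = lift ord_max i) ?liftK //.
by apply: val_inj; rewrite /= /bump leqNgt ltn_ord.
Qed.

(** Adjoin variables [X_k] as long as independence lasts; rows may be dropped from a matrix of full
    row rank. At the end every [X_k] is algebraic over the [g_i], and differentiating its relation
    expresses the unit row [k] through the rows of the Jacobian matrix, so the latter has rank
    [N]. *)
Lemma independent_jacobian n (g : 'I_n -> R) : alg_independent g ->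
  exists c, \rank (jacobian g c) = n.
Proof.
have [m le_m] := ubnP (N - n).
elim: m n g le_m => // m IH n g le_m ind.
have le_nN := alg_independent_leq ind.
case: (pselect (exists k, alg_independent (extend g 'X_k))) => [[k indk]|].
  have lt_nN := alg_independent_leq indk.
  have [|c rk] := IH _ _ _ indk; first by move: le_m lt_nN; lia.
  exists c; apply/eqP; rewrite -/(row_free _).
  have /row_freeP[B eB] : row_free (jacobian (extend g 'X_k) c) by rewrite /row_free rk.
  apply/row_freeP; exists (colsub (lift ord_max) B).
  apply/matrixP => i j; rewrite !mxE.
  have /matrixP/(_ (lift ord_max i) (lift ord_max j)) := eB; rewrite !mxE.
  rewrite (inj_eq lift_inj) => <-; apply: eq_bigr => l _.
  by rewrite !mxE /extend liftK.
move=> /forallNP nind.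
(* A minimal relation really involves [X_k]: were its derivative in the last variable zero, it would
   be a relation between the [g_i] alone. *)
have ann k : exists P : {mpoly K[n.+1]}, subst (extend g 'X_k) P = 0 /\
    subst (extend g 'X_k) P^`M(ord_max) != 0.
  have [P [nP eP minP]] := minimal_annihilator (nind k).
  exists P; split=> //; apply/eqP => /minP dP; case/eqP: nP.
  pose w (i : 'I_n.+1) : {mpoly K[n]} := if unlift ord_max i is Some j then 'X_j else 0.
  pose Q : {mpoly K[n]} := mmap (@mpolyC n K) w P.
  have Q0 : Q = 0.
    apply: ind; rewrite -eP.
    have -> : subst g Q = subst (extend g 0) P.
      apply: mmap_morph => [c|i]; first by rewrite /= mmapC.
      rewrite /w /extend; case: unlift => [j|]; last by rewrite raddf0.
      exact: mmapXU.
    by apply: (mmap_const_var _ dP) => j; rewrite /extend; case: unliftP => // ->;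
      rewrite eqxx.
  pose phi := mmap (@mpolyC n.+1 K) (fun j : 'I_n => 'X_(lift ord_max j)).
  rewrite -[P]mmap_var (mmap_const_var (g' := phi \o w) _ dP) => [|j]; last first.
    rewrite /w /=; case: unliftP => [l ->|->]; last by rewrite eqxx.
    by rewrite /phi mmapXU.
  rewrite -[RHS](raddf0 phi) -Q0; apply/esym; apply: mmap_morph => // c.
  by rewrite /phi /= mmapC.
have [P hP] := choice ann.
have q0 : \prod_k subst (extend g 'X_k) (P k)^`M(ord_max) != 0.
  by apply/prodf_neq0 => k _; case: (hP k).
have [c] := mpoly_nonroot q0; rewrite rmorph_prod => /prodf_neq0 hc.
exists c; apply/eqP; rewrite eqn_leq rank_leq_row /=.
apply: leq_trans le_nN _; rewrite -[X in (X <= _)%N](mxrank1 K N); apply: mxrankS.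
apply/row_subP => k; rewrite row1.
have [eP _] := hP k.
pose q := (subst (extend g 'X_k) (P k)^`M(ord_max)).@[c].
pose a := \row_i (subst (extend g 'X_k) (P k)^`M(widen_ord (leqnSn n) i)).@[c].
have q1 : q != 0 by apply: hc.
suff <- : - q^-1 *: a *m jacobian g c = delta_mx 0 k by rewrite submxMl.
apply/rowP => l; have := congr1 (fun p => p^`M(l).@[c]) eP.
rewrite mderiv0 meval0 mderiv_subst big_ord_recr /= mevalD mevalM -/q.
rewrite extend_max mderiv_var rmorph_nat => /eqP.
rewrite addr_eq0 rmorph_sum /= => /eqP e.
rewrite -scalemxAl mxE [X in _ * X](_ : _ = - (q * (k == l)%:R)); last first.
  rewrite -e mxE; apply: eq_bigr => i _; rewrite !mxE mevalM.
  by rewrite extend_widen.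
by rewrite mulrN mulNr opprK mulKf // !mxE eqxx eq_sym.
Qed.

End AlgebraicIndependence.

Section TrdegParam.
Variables (K : numFieldType) (V : vectType K) (S : V -> Prop).
Variables (N : nat) (h : 'I_(\dim {:V}) -> {mpoly K[N]}).
Hypothesis param : forall P : {mpoly K[\dim {:V}]},
  (forall v, S v -> P.@[coords v] = 0) <-> subst h P = 0.

(** By the chain rule, functions of the coordinates have a Jacobian matrix of rank at most that of
    [h]; conversely, coordinates whose rows form a basis at a point of maximal rank are
    independent. *)
Lemma has_trdeg_param r : (exists c, \rank (jacobian h c) = r) ->
  (forall c, \rank (jacobian h c) <= r)%N -> has_trdeg S r.
Proof.
have comp n (f : 'I_n -> {mpoly K[\dim {:V}]}) P :
    subst (fun i => subst h (f i)) P = subst h (subst f P).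
  by apply/esym; apply: mmap_morph => // c; rewrite /= mmapC.
have ind n (f : 'I_n -> {mpoly K[\dim {:V}]}) :
    alg_independent_on S f <-> alg_independent (fun i => subst h (f i)).
  have E P : (forall v, S v -> P.@[fun i => (f i).@[coords v]] = 0) <->
      subst (fun i => subst h (f i)) P = 0.
    rewrite comp -param; split=> hP v Sv; have := hP v Sv; by rewrite meval_subst.
  by split=> i P /E/i.
move=> [c <-] max; split; last first.
  move=> n f /ind/independent_jacobian[c' <-]; apply: leq_trans (max c').
  suff -> : jacobian (fun i => subst h (f i)) c' =
      jacobian f (fun i => (h i).@[c']) *m jacobian h c' by apply: mxrankM_maxr.
  apply/matrixP => i k; rewrite !mxE mderiv_subst rmorph_sum; apply: eq_bigr => j _.
  by rewrite /= !mxE mevalM meval_subst.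
pose sel := maxrankfun (jacobian h c).
exists (fun i => 'X_(sel i)); apply/ind; apply: (jacobian_independent (c := c)).
rewrite (_ : jacobian _ c = rowsub sel (jacobian h c)); first exact/eqP/maxrowsub_free.
by apply/matrixP => i k; rewrite !mxE /subst mmapXU.
Qed.

Lemma has_trdeg_uniq r r' : has_trdeg S r -> has_trdeg S r' -> r = r'.
Proof.
move=> [[f hf] m] [[f' hf'] m']; apply/eqP; rewrite eqn_leq.
by rewrite (m' _ _ hf) (m _ _ hf').
Qed.

End TrdegParam.

Lemma has_trdeg_full (K : numFieldType) (V : vectType K) (S : V -> Prop) :
  (forall P : {mpoly K[\dim {:V}]}, (forall v, S v -> P.@[coords v] = 0) -> P = 0) ->
  has_trdeg S (\dim {:V}).
Proof.
move=> hS; apply: (@has_trdeg_param _ _ _ _ (fun i => 'X_i)) => [P||c].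
- rewrite /subst mmap_var; split=> [|->]; first exact: hS.
  by move=> v _; rewrite meval0.
- exists (fun=> 0); rewrite (_ : jacobian _ _ = 1%:M) ?mxrank1 //.
  by apply/matrixP => i j; rewrite !mxE mderiv_var rmorph_nat.
exact: rank_leq_row.
Qed.

(** * Parametrized curves and the differential of the pullback *)

Section Homogenization.
Variable K : fieldType.

Definition dehomog (q : {mpoly K[2]}) : {poly K} :=
  mmap (@polyC K) (fun i : 'I_2 => if i == ord0 then 'X else 1) q.
HB.instance Definition _ := GRing.RMorphism.copy dehomog
  (mmap (@polyC K) (fun i : 'I_2 => if i == ord0 then 'X else 1)).

Definition bmon (n k : nat) : 'X_{1..2} :=
  [multinom if i == ord0 then k else (n - k)%N | i < 2].

Definition homog_of (n : nat) (p : {poly K}) : {mpoly K[2]} :=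
  \sum_(k < n.+1) p`_k *: 'X_[bmon n k].

Lemma dehomogX m : dehomog 'X_[m] = 'X^(m ord0).
Proof.
by rewrite /dehomog mmapX /mmap1 big_ord_recl big_ord1 /= expr1n mulr1.
Qed.

Lemma dehomogZ c q : dehomog (c *: q) = c *: dehomog q.
Proof. by rewrite /dehomog mmapZ mul_polyC. Qed.

Lemma mdeg_bmon n k : (k <= n)%N -> mdeg (bmon n k) = n.
Proof. by move=> le; rewrite mdegE big_ord_recl big_ord1 !mnmE /= subnKC. Qed.

Lemma homog_of_homog n p : homog_of n p \is n.-homog.
Proof.
apply: rpred_sum => k _; apply: rpredZ.
by rewrite dhomogX; apply/eqP/mdeg_bmon; rewrite -ltnS.
Qed.

Implicit Types p : {poly K}.

Lemma homog_ofK n p : (size p <= n.+1)%N -> dehomog (homog_of n p) = p.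
Proof.
move=> sp; rewrite /homog_of rmorph_sum -[RHS](coefK p) /=.
rewrite poly_def (big_ord_widen_cond n.+1 xpredT (fun i => p`_i *: 'X^i)) //=.
rewrite [RHS]big_mkcond /=; apply: eq_bigr => k _; rewrite dehomogZ dehomogX mnmE.
by case: ltnP => // /leq_sizeP -> //; rewrite scale0r.
Qed.

Lemma bmon_deg n (m : 'X_{1..2}) : mdeg m = n -> m = bmon n (m ord0).
Proof.
move=> e; apply/mnmP => i; rewrite mnmE -e mdegE big_ord_recl big_ord1 addKn.
by case: (unliftP ord0 i) => [j|] ->; rewrite ?ord1.
Qed.

Lemma dehomog_inj n : {in n.-homog &, injective dehomog}.
Proof.
suff H q : q \is n.-homog -> dehomog q = 0 -> q = 0.
  move=> p q hp hq e; apply/subr0_eq/H; first exact: rpredB.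
  by rewrite rmorphB /= e subrr.
move=> hq e; apply/mpolyP => m; rewrite mcoeff0.
have [em|nm] := eqVneq (mdeg m) n; last by apply: dhomog_nemf_coeff hq nm.
apply/eqP; apply: contraT => nz.
have := congr1 (fun p : {poly K} => p`_(m ord0)) e; rewrite coef0 => /eqP.
rewrite {1}[q]mpolyE rmorph_sum coef_sum /= (bigD1_seq m) ?msupp_uniq ?mcoeff_msupp //=.
rewrite dehomogZ dehomogX coefZ coefXn eqxx mulr1 big_seq_cond big1 ?addr0.
  by rewrite (negPf nz).
move=> m' /andP[m'q ne]; rewrite dehomogZ dehomogX coefZ coefXn.
case: eqP => [e'|_]; last by rewrite mulr0.
case/eqP: ne; rewrite (bmon_deg em) (bmon_deg (dhomog_mf hq m'q)).
by rewrite e'.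
Qed.

Lemma size_dehomog n q : q \is n.-homog -> (size (dehomog q) <= n.+1)%N.
Proof.
move=> /dhomogP hq; rewrite [q]mpolyE rmorph_sum big_seq /=.
apply: (big_ind (fun p : {poly K} => (size p <= n.+1)%N)) => [|p r sp sr|m mq].
- by rewrite size_poly0.
- by apply: leq_trans (size_polyD _ _) _; rewrite geq_max sp.
rewrite dehomogZ; apply: leq_trans (size_scale_leq _ _) _.
rewrite dehomogX size_polyXn ltnS; have <- : mdeg m = n := hq m mq.
by rewrite mdegE big_ord_recl leq_addr.
Qed.

Lemma dehomogK n q : q \is n.-homog -> homog_of n (dehomog q) = q.
Proof.
move=> hq; apply: (@dehomog_inj n) => //; first exact: homog_of_homog.
by rewrite homog_ofK // size_dehomog.
Qed.

Lemma homog_ofD n p q : homog_of n (p + q) = homog_of n p + homog_of n q.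
Proof. by rewrite -big_split; apply: eq_bigr => k _; rewrite coefD scalerDl. Qed.

Lemma homog_ofZ n c p : homog_of n (c *: p) = c *: homog_of n p.
Proof. by rewrite scaler_sumr; apply: eq_bigr => k _; rewrite coefZ scalerA. Qed.

Lemma prod_bmon n k (s : 'I_2 -> K) :
  \prod_i s i ^+ bmon n k i = s ord0 ^+ k * s ord_max ^+ (n - k).
Proof.
rewrite big_ord_recl big_ord1 !mnmE; congr (_ * s _ ^+ _); exact: val_inj.
Qed.

Lemma meval_homog_of n p (s : 'I_2 -> K) : s ord_max != 0 -> (size p <= n.+1)%N ->
  (homog_of n p).@[s] = s ord_max ^+ n * p.[s ord0 / s ord_max].
Proof.
move=> s1 sp; rewrite (horner_coef_wide _ sp) mulr_sumr raddf_sum /=.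
apply: eq_bigr => k _; rewrite mevalZ mevalX prod_bmon.
rewrite [RHS]mulrCA; congr (_ * _); rewrite exprMn exprVn.
have le_kn : (k <= n)%N by rewrite -ltnS.
rewrite (_ : s ord_max ^+ n = s ord_max ^+ (n - k) * s ord_max ^+ k); last first.
  by rewrite -exprD subnK.
by rewrite mulrACA mulfV ?expf_neq0 // mulr1 mulrC.
Qed.

Lemma meval_homog_of_infty n p (s : 'I_2 -> K) : s ord_max = 0 ->
  (homog_of n p).@[s] = p`_n * s ord0 ^+ n.
Proof.
move=> s1; rewrite raddf_sum big_ord_recr /= big1 => [|k _].
  by rewrite add0r mevalZ mevalX prod_bmon subnn expr0 mulr1.
by rewrite mevalZ mevalX prod_bmon s1 expr0n subn_eq0 leqNgt ltn_ord /= !mulr0.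
Qed.

End Homogenization.

(** * The universal parametrized curve *)

Section GenericCurve.
Variables (K : numClosedFieldType) (e : nat).
Local Notation N := (3 * e.+1)%N.
Local Notation R := {mpoly K[N]}.
Local Notation M3 := 'M[K]_(3, e.+1).
Implicit Types (A : M3) (P : {mpoly K[3]}).

Definition pt A (k : 'I_N) : K := mxvec A 0 k.

Definition ixj (k : 'I_N) : 'I_3 * 'I_e.+1 := enum_val (cast_ord (esym (mxvec_cast 3 e.+1)) k).

Lemma ixjE i j : ixj (mxvec_index i j) = (i, j).
Proof. by rewrite /ixj /mxvec_index cast_ordK enum_rankK. Qed.

Lemma pt_index A i j : pt A (mxvec_index i j) = A i j.
Proof. by rewrite /pt mxvecE. Qed.

Lemma pt_surj (v : 'I_N -> K) : exists A, pt A =1 v.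
Proof.
exists (vec_mx (\row_k v k)) => k; by rewrite /pt vec_mxK mxE.
Qed.

Lemma R_zero (q : R) : (forall A, q.@[pt A] = 0) -> q = 0.
Proof.
move=> h; apply: mpoly_zero => v; have [A eA] := pt_surj v.
by rewrite -(meval_eq q eA).
Qed.

Lemma R_nonroot (q : R) : q != 0 -> exists A, q.@[pt A] != 0.
Proof.
by move=> /mpoly_nonroot[v]; have [A eA] := pt_surj v; rewrite -(meval_eq q eA); exists A.
Qed.

(** The variable of [{poly R}] is the affine coordinate [x] of the projective line, the variables of
    [R] are the coefficients [u_ij] of the universal map [iota]. Thus [tau P] is [P(iota(x))], and
    [ev A P] is its specialization to the map with coefficient matrix [A]. *)
Definition gen (i : 'I_3) : {poly R} := rVpoly (\row_j 'X_(mxvec_index i j)).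
Definition tau P : {poly R} := mmap (polyC \o @mpolyC N K) gen P.
HB.instance Definition _ := GRing.RMorphism.copy tau (mmap (polyC \o @mpolyC N K) gen).

Definition line A i : {poly K} := rVpoly (row i A).
Definition ev A P : {poly K} := mmap (@polyC K) (line A) P.
HB.instance Definition _ A := GRing.RMorphism.copy (ev A) (mmap (@polyC K) (line A)).

Lemma tauX i : tau 'X_i = gen i. Proof. exact: mmapXU. Qed.

Lemma tauC c : tau c%:MP = (c%:MP)%:P. Proof. exact: mmapC. Qed.

Lemma map_gen A i : map_poly (meval (pt A)) (gen i) = line A i.
Proof.
rewrite map_rVpoly; congr rVpoly; apply/rowP => j.
by rewrite !mxE /= mevalXU pt_index.
Qed.

Lemma ev_tau A P : map_poly (meval (pt A)) (tau P) = ev A P.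
Proof.
apply: mmap_morph => [c|i]; last exact: map_gen.
by rewrite /= map_polyC /= mevalC.
Qed.

Lemma horner_ev A P x : (ev A P).[x] = P.@[fun i => (line A i).[x]].
Proof. exact: horner_mmap. Qed.

(** Constant maps already reach every point. *)
Lemma tau_inj P : tau P = 0 -> P = 0.
Proof.
move=> e0; apply: mpoly_zero => v.
pose A : M3 := \matrix_(i, j) if j == ord0 then v i else 0.
have := horner_ev A P 0; rewrite -ev_tau e0 rmorph0 horner0 => ->.
apply: meval_eq => i; rewrite horner_coef0 /line (coef_rVpoly_ord _ ord0) !mxE //.
Qed.

Lemma size_mmap_le (S : comNzRingType) (f : {rmorphism K -> {poly S}}) (h : 'I_3 -> {poly S}) d P :
  (forall c, (size (f c) <= 1)%N) -> (forall i, (size (h i) <= e.+1)%N) ->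
  (msize P <= d.+1)%N -> (size (mmap f h P) <= (e * d).+1)%N.
Proof.
move=> sf sh sP; rewrite /mmap big_seq.
apply: (big_ind (fun p : {poly S} => (size p <= (e * d).+1)%N)) => [|p r sp sr|m mq].
- by rewrite size_poly0.
- by apply: leq_trans (size_polyD _ _) _; rewrite geq_max sp.
have sM (p q : {poly S}) a b : (size p <= a.+1)%N -> (size q <= b.+1)%N -> (size (p * q)%R <= (a + b).+1)%N.
  by move=> sp sq; apply: leq_trans (size_polyMleq _ _) _; lia.
rewrite -[(e * d)%N]add0n; apply: (sM) => //.
have dm : (mdeg m <= d)%N by have := msize_mdeg_lt mq; lia.
apply: (@leq_trans (e * mdeg m).+1); last by rewrite ltnS leq_mul2l dm orbT.
rewrite mdegE big_distrr /= /mmap1.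
have sX (p : {poly S}) k : (size p <= e.+1)%N -> (size (p ^+ k) <= (e * k).+1)%N.
  move=> sp; elim: k => [|k IH]; first by rewrite expr0 size_poly1.
  by rewrite exprS mulnS; apply: (sM).
elim/big_rec2: _ => [|i a p _ IH]; first by rewrite size_poly1.
by apply: (sM) => //; apply: (sX).
Qed.

Lemma size_tau d P : (msize P <= d.+1)%N -> (size (tau P) <= (e * d).+1)%N.
Proof.
apply: size_mmap_le => [c|i]; first by rewrite size_polyC_leq1.
exact: size_poly.
Qed.

Lemma size_ev A d P : (msize P <= d.+1)%N -> (size (ev A P) <= (e * d).+1)%N.
Proof.
apply: size_mmap_le => [c|i]; first by rewrite size_polyC_leq1.
exact: size_poly.
Qed.

Lemma mxvec_index_eq m n (i i' : 'I_m) (j j' : 'I_n) :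
  (mxvec_index i j == mxvec_index i' j') = (i == i') && (j == j').
Proof.
by rewrite (inj_eq (@cast_ord_inj _ _ _)) (inj_eq enum_rank_inj) xpair_eqE.
Qed.

Lemma mderiv_gen k i j :
  map_poly (mderiv (mxvec_index i j)) (gen k) = (k == i)%:R *: 'X^j :> {poly R}.
Proof.
apply/polyP => l; rewrite coef_map coefZ coefXn /= /gen coef_rVpoly.
case: insubP => [l' _ <-|]; last first.
  rewrite raddf0; have [->|_] := l =P j; last by rewrite mulr0.
  by rewrite ltn_ord.
by rewrite mxE mderiv_var mxvec_index_eq -natrM mulnb.
Qed.

Lemma mderiv_polyM k (p q : {poly R}) : map_poly (mderiv k) (p * q) =
  map_poly (mderiv k) p * q + p * map_poly (mderiv k) q.
Proof.
apply/polyP => l; rewrite coef_map coefD !coefM raddf_sum -big_split /=.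
by apply: eq_bigr => m _; rewrite mderivM !coef_map.
Qed.

(** Since [j] enters only through [x^j], the operator [d/du_i(j+1) - x d/du_ij] kills every
    [tau P]. *)
Lemma mderiv_tau P i j :
  map_poly (mderiv (mxvec_index i j)) (tau P) = 'X^j * tau P^`M(i).
Proof.
rewrite (@mmap_derivation _ _ _ (polyC \o @mpolyC N K) gen
  (map_poly (mderiv (mxvec_index i j)))).
- rewrite (bigD1 i) //= big1 ?addr0 => [|k ne]; rewrite mderiv_gen.
    by rewrite eqxx scale1r mulrC.
  by rewrite (negPf ne) scale0r mulr0.
- by move=> p q; rewrite raddfD.
- exact: mderiv_polyM.
by move=> c; rewrite /= map_polyC /= mderivC.
Qed.

(* No common zero on the affine chart, nor at infinity. *)
Definition nowhere_zero A : Prop :=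
  (forall x, exists i, (line A i).[x] != 0) /\ exists i, A i ord_max != 0.

(** Start from [A] with [q(A)] nonzero and the first coordinate of exact degree [e], so that
    infinity is no common zero. A common zero is then one of the finitely many roots of the first
    coordinate, and adding a general constant [s] to the second coordinate avoids them all. *)
Lemma nowhere_zero_dense (q : R) :
  (forall A, nowhere_zero A -> q.@[pt A] = 0) -> q = 0.
Proof.
move=> hq; apply/eqP; apply: contraT => q0.
have : q * 'X_(mxvec_index ord0 ord_max) != 0.
  by rewrite mulf_neq0 // -msupp_eq0 msuppX.
move=> /R_nonroot[A]; rewrite mevalM mevalXU pt_index mulf_eq0 negb_or => /andP[qA A0].
have l0 : line A ord0 != 0.
  apply: contraNneq A0 => l0; have := congr1 (fun p : {poly K} => p`_(@ord_max e)) l0.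
  by rewrite coef0 /line coef_rVpoly_ord mxE => ->.
have [rs ers] := closed_field_poly_normal (line A ord0).
pose i1 : 'I_3 := lift ord0 ord0.
pose B s : M3 := A + s *: delta_mx i1 ord0.
pose Q : {poly K} := mmap (@polyC K)
  (fun k => (pt A k)%:P + pt (delta_mx i1 ord0) k *: 'X) q.
have eQ s : Q.[s] = q.@[pt (B s)].
  rewrite [LHS]horner_mmap; apply: meval_eq => k.
  by case/mxvec_indexP: k => a b; rewrite !hornerE !pt_index !mxE mulrC.
have lB s : line (B s) i1 = line A i1 + s%:P.
  rewrite /line /B !linearD /= linearZ /= linearZ /=; congr (_ + _).
  rewrite (_ : row _ _ = delta_mx 0 ord0) ?rVpoly_delta ?expr0 ?alg_polyC //.
  by apply/rowP => j; rewrite !mxE eqxx.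
have lB0 s : line (B s) ord0 = line A ord0.
  by congr rVpoly; apply/rowP => j; rewrite !mxE /= mulr0 addr0.
pose T : {poly K} := \prod_(r <- rs) ((line A i1).[r]%:P + 'X).
have T0 : T != 0.
  by rewrite prodf_seq_neq0; apply/allP => r _; rewrite /= addrC -size_poly_eq0 size_XaddC.
have Q0 : Q != 0.
  by apply: contraNneq qA => e0; move: (eQ 0); rewrite e0 horner0 /B scale0r addr0 => <-.
have [s] := poly_nonroot (mulf_neq0 Q0 T0); rewrite hornerM mulf_eq0 negb_or eQ.
move=> /andP[/eqP qB TB]; case: qB; apply: hq; split; last first.
  by exists ord0; rewrite /B !mxE /= mulr0 addr0.
move=> x; have [rx|] := eqVneq (line (B s) ord0).[x] 0; last by exists ord0.
exists i1; rewrite lB hornerD hornerC; move: TB; rewrite horner_prod.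
rewrite prodf_seq_neq0 => /allP/(_ x); rewrite !hornerE addrC; apply.
move/eqP: rx; rewrite lB0 ers hornerZ mulf_eq0 lead_coef_eq0 (negPf l0) /=.
by rewrite -/(root _ x) root_prod_XsubC.
Qed.

End GenericCurve.

Lemma dhomog_comp (K : fieldType) n k (F : {mpoly K[n]}) d e
    (t : n.-tuple {mpoly K[k]}) :
  F \is d.-homog -> (forall i, tnth t i \is e.-homog) ->
  F \mPo t \is (e * d).-homog.
Proof.
move=> hF ht; rewrite comp_mpolyEX big_seq; apply: rpred_sum => m mF.
apply: rpredZ; rewrite comp_mpolyX; have <- : mdeg m = d := dhomog_mf hF mF.
rewrite mdegE big_distrr /=; elim/big_rec2: _ => [|i a p _ IH]; first exact: dhomog1.
by apply: dhomogM => //; apply: dhomogMn.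
Qed.

(** * Maximal rank of Phi in terms of its differential *)

Section Link.
Variables (K : numClosedFieldType) (d e : nat).
Local Notation N := (3 * e.+1)%N.
Local Notation R := {mpoly K[N]}.
Local Notation M3 := 'M[K]_(3, e.+1).
Implicit Type A : M3.
Variable F : dhomog 3 K d.
Hypothesis d_gt0 : (0 < d)%N.
Hypothesis F_neq0 : F != 0.
Local Notation W := (dhomog 2 K (e * d)).

Definition bform n (p : {poly K}) : dhomog 2 K n := DHomog (homog_of_homog n p).

Lemma bform_sum n (p : {poly K}) : (size p <= n.+1)%N ->
  bform n p = \sum_(l < n.+1) p`_l *: bform n 'X^l.
Proof.
move=> sp; apply: val_inj; rewrite raddf_sum /=; apply: eq_bigr => k _ /=.
rewrite /homog_of (bigD1 k) //= coefXn eqxx scale1r big1 ?addr0 // => j ne.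
by rewrite coefXn -val_eqE in ne *; rewrite (negPf ne) scale0r.
Qed.

Definition form_of A : form_triple K e := [ffun i => bform e (line A i)].

Definition coef_mx (iota : form_triple K e) : M3 :=
  \matrix_(i, j) (dehomog (iota i : {mpoly K[2]}))`_j.

Lemma line_coef_mx iota i : line (coef_mx iota) i = dehomog (iota i : {mpoly K[2]}).
Proof.
apply/polyP => j; rewrite /line coef_rVpoly; case: insubP => [j' _ <-|].
  by rewrite !mxE.
rewrite -leqNgt => le; apply/esym; have /leq_sizeP-> // : (size (dehomog (iota i : {mpoly K[2]})) <= e.+1)%N.
exact: size_dehomog (dhomog_is_dhomog _).
Qed.

Lemma coef_mxK : cancel coef_mx form_of.
Proof.
move=> iota; apply/ffunP => i; rewrite ffunE; apply: val_inj => /=.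
by rewrite line_coef_mx dehomogK // dhomog_is_dhomog.
Qed.

Lemma pullback_homog (iota : form_triple K e) : pullback F iota \is (e * d).-homog.
Proof.
apply: dhomog_comp => [|i]; first exact: dhomog_is_dhomog.
by rewrite tnth_mktuple; apply: dhomog_is_dhomog.
Qed.

Lemma dehomog_pullback A : dehomog (pullback F (form_of A)) = ev A F.
Proof.
apply: mmap_morph => [c|i]; first by rewrite /= /dehomog mmapC.
by rewrite tnth_mktuple ffunE /= homog_ofK ?size_poly.
Qed.

Lemma pullback_form_of A : pullback F (form_of A) = bform (e * d) (ev A F).
Proof. by rewrite -dehomog_pullback /= dehomogK // pullback_homog. Qed.

Lemma msize_homog n (P : {mpoly K[n]}) k : P \is k.-homog -> (msize P <= k.+1)%N.
Proof.
move=> hP; rewrite msizeE big_seq; apply/bigmax_leqP_seq => m mP _.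
by rewrite ltnS; have -> : mdeg m = k := dhomog_mf hP mP.
Qed.

Lemma size_evF A : (size (ev A F) <= (e * d).+1)%N.
Proof. by apply: size_ev; apply: msize_homog; apply: dhomog_is_dhomog. Qed.

Lemma nowhere_zero_form A : nowhere_zero A -> no_common_zero (form_of A).
Proof.
move=> [hx [i0 hi]] s s0; have [s1|s1] := eqVneq (s 0 ord_max) 0; last first.
  have [i hi'] := hx (s 0 ord0 / s 0 ord_max); exists i.
  by rewrite ffunE meval_homog_of ?size_poly // mulf_neq0 // expf_neq0.
exists i0; rewrite ffunE meval_homog_of_infty // mulf_neq0 //.
  by rewrite /line (coef_rVpoly_ord _ ord_max) mxE.
rewrite expf_neq0 //; apply: contraNneq s0 => s00; apply/eqP/rowP => i; rewrite mxE.
by case: (unliftP ord0 i) => [j|] ->; rewrite // -s1; congr (s _ _); apply: val_inj; rewrite ord1.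
Qed.

Lemma class_exists (V : vectType K) (v : V) : v != 0 -> exists p : projective V, is_class p v.
Proof.
move=> v0; have h : \dim <[v]> == 1%N by rewrite dim_vline v0.
by exists (Sub <[v]>%VS h).
Qed.

Lemma no_common_zero_neq0 (iota : form_triple K e) : no_common_zero iota -> iota != 0.
Proof.
move=> h; apply/eqP => e0; have [|i] := h (const_mx 1).
  by apply/eqP => /rowP/(_ 0); rewrite !mxE => /eqP; rewrite oner_eq0.
by rewrite e0 ffunE meval0 eqxx.
Qed.

(** Dimension is defined through coordinates along the abstract basis [vbasis], so the space of
    maps, and below the image of Phi, are parametrized in these coordinates by polynomials in the
    [u_ij]. *)
Definition param_form (k : 'I_(\dim {: form_triple K e})) : R :=
  \sum_(a < N) coords (form_of (vec_mx (delta_mx 0 a))) k *: 'X_a.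

Definition param_image (k : 'I_(\dim {: W})) : R :=
  \sum_(l < (e * d).+1) coords (bform (e * d) 'X^l) k *: (tau e F)`_l.

Lemma coords_sum (V : vectType K) I (r : seq I) (c : I -> K) (v : I -> V) k :
  coords (\sum_(i <- r) c i *: v i) k = \sum_(i <- r) c i * coords (v i) k.
Proof. by rewrite /coords raddf_sum; apply: eq_bigr => i _; rewrite /= linearZ. Qed.

Lemma coords_surj (V : vectType K) (w : 'I_(\dim {:V}) -> K) :
  exists v : V, coords v =1 w.
Proof.
exists (\sum_i w i *: (vbasis {:V})`_i) => i; rewrite /coords.
by rewrite coord_sum_free // (basis_free (vbasisP _)).
Qed.

Lemma form_of_is_linear : linear form_of.
Proof.
move=> a A B; apply/ffunP => i; rewrite !ffunE; apply: val_inj => /=.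
by rewrite /line linearP linearP homog_ofD homog_ofZ.
Qed.
HB.instance Definition _ := GRing.isLinear.Build K M3 (form_triple K e) _ form_of form_of_is_linear.

Lemma form_of_sum A : form_of A = \sum_(a < N) pt A a *: form_of (vec_mx (delta_mx 0 a)).
Proof.
rewrite -{1}[A]mxvecK [mxvec A]row_sum_delta !linear_sum.
by apply: eq_bigr => a _; rewrite /= !linearZ.
Qed.

Lemma meval_param_form A k : (param_form k).@[pt A] = coords (form_of A) k.
Proof.
rewrite form_of_sum coords_sum raddf_sum; apply: eq_bigr => a _ /=.
by rewrite mevalZ mevalXU mulrC.
Qed.

Lemma meval_param_image A k : (param_image k).@[pt A] = coords (bform (e * d) (ev A F)) k.
Proof.
rewrite (bform_sum (size_evF A)) coords_sum raddf_sum; apply: eq_bigr => a _ /=.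
by rewrite mevalZ mulrC -ev_tau coef_map.
Qed.

Lemma dim_bform n : \dim {: dhomog 2 K n} = n.+1.
Proof. by rewrite dimvf /dim /= (addn1 n) binSn. Qed.

Lemma trdeg_Mor : has_trdeg (affine_cone (@Mor K e)) N.
Proof.
have <- : \dim {: form_triple K e} = N.
  by rewrite dimvf /dim /= card_ord -(dimvf (dhomog 2 K e)) dim_bform.
apply: has_trdeg_full => P hP.
have E A : (subst param_form P).@[pt A] = P.@[coords (form_of A)].
  by rewrite meval_subst; apply: meval_eq => k; apply: meval_param_form.
have e0 : subst param_form P = 0.
  apply: nowhere_zero_dense => A /nowhere_zero_form nA; rewrite E; apply: hP.
  have [p hp] := class_exists (no_common_zero_neq0 nA).
  by exists p; [exists (form_of A)|rewrite hp memv_line].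
apply: mpoly_zero => w; have [v ev] := coords_surj w.
by rewrite -(meval_eq P ev) -[v]coef_mxK -E e0 meval0.
Qed.

Lemma has_dim_all : has_dim (fun _ : projective W => True) (e * d)%N.
Proof.
rewrite /has_dim -(dim_bform (e * d)); apply: has_trdeg_full => P hP.
apply: (@mpoly_zero_off _ _ _ 'X_(cast_ord (esym (dim_bform _)) ord0)).
  by rewrite -msupp_eq0 msuppX.
move=> w; have [v ev] := coords_surj w; rewrite -(meval_eq P ev) mevalXU => w0.
apply: hP; have [|p hp] := @class_exists W v.
  by apply: contraNneq w0 => v0; rewrite -ev v0 /coords linear0.
by exists p => //; rewrite hp memv_line.
Qed.

(* The differential of [iota |-> iota^* F] at [A] sends the unit tangent vector in
   the direction of the coefficient (i, j) to [x^j F_i(iota)]. *)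
Definition diff_mx A : 'M[K]_(N, (e * d).+1) :=
  \matrix_(k, l) ('X^((ixj k).2) * ev A (F : {mpoly K[3]})^`M((ixj k).1))`_l.

Lemma diff_mxE A i j l : diff_mx A (mxvec_index i j) l =
  ('X^j * ev A (F : {mpoly K[3]})^`M(i))`_l.
Proof. by rewrite mxE ixjE. Qed.

Lemma rank_jacobian_image A : \rank (jacobian param_image (pt A)) = \rank (diff_mx A).
Proof.
pose C : 'M[K]_((e * d).+1, \dim {: W}) := \matrix_(l, k) coords (bform (e * d) 'X^l) k.
have -> : jacobian param_image (pt A) = (diff_mx A *m C)^T.
  apply/matrixP => k a; rewrite !mxE /param_image (raddf_sum (mderiv a)) (raddf_sum (meval (pt A))) /=.
  apply: eq_bigr => l _; rewrite mderivZ mevalZ mulrC.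
  case/mxvec_indexP: a => i j; rewrite diff_mxE [C _ _]mxE; congr (_ * _).
  rewrite -ev_tau -(map_polyXn (meval (pt A))) -rmorphM -mderiv_tau.
  by rewrite !coef_map.
rewrite mxrank_tr mxrankMfree //; apply/row_freeP.
pose D : 'M[K]_(\dim {: W}, (e * d).+1) :=
  \matrix_(k, l) (dehomog (((vbasis {:W})`_k : W) : {mpoly K[2]}))`_l.
exists D; apply/matrixP => l l'; rewrite !mxE.
have /(congr1 (fun v : W => (dehomog (v : {mpoly K[2]}))`_l')) :=
  coord_vbasis (memvf (bform (e * d) 'X^l)).
have sX : (size ('X^l : {poly K}) <= (e * d).+1)%N by rewrite size_polyXn ltn_ord.
rewrite /= homog_ofK // => e1.
rewrite -val_eqE eq_sym -(coefXn K l l'); apply/esym; apply: etrans e1 _.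
rewrite raddf_sum rmorph_sum coef_sum; apply: eq_bigr => k _.
by rewrite !mxE /= dehomogZ coefZ.
Qed.

(** The cone over the image of Phi has the same vanishing polynomials as the image of the affine map
    sending [A] to [ev A F]. *)
Lemma Phi_cone (P : {mpoly K[\dim {: W}]}) :
  (forall v, affine_cone (@Phi_image K d e F) v -> P.@[coords v] = 0) <->
  subst param_image P = 0.
Proof.
have E A : (subst param_image P).@[pt A] = P.@[coords (bform (e * d) (ev A F))].
  by rewrite meval_subst; apply: meval_eq => k; apply: meval_param_image.
split=> [hP|h0 v [q [p [iota [G [hp hz eG hq]]]]]].
  have [l hl] : exists l, (tau e F)`_l != 0.
    apply: exists_neq0 => hl; case/eqP: F_neq0; apply: val_inj => /=.
    by apply: tau_inj; apply/polyP => l; rewrite coef0; apply: hl.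
  suff: subst param_image P * (tau e F)`_l = 0.
    by move=> /eqP; rewrite mulf_eq0 (negPf hl) orbF => /eqP.
  apply: nowhere_zero_dense => A /nowhere_zero_form nA; rewrite mevalM E.
  (* In the first case [iota] maps into the curve and Phi is undefined; the factor [(tau e F)_l]
     vanishes there. *)
  have [e0|ne0] := eqVneq (ev A F) 0.
    have /(congr1 (fun p : {poly K} => p`_l)) := e0.
    by rewrite -ev_tau coef_map coef0 /= => ->; rewrite mulr0.
  rewrite hP ?mul0r //.
  have [p hp] := class_exists (no_common_zero_neq0 nA).
  have [|q hq] := @class_exists W (bform (e * d) (ev A F)).
    apply: contraNneq ne0 => e0; rewrite -(homog_ofK (size_evF A)).
    by have /(congr1 (fun v : W => dehomog (v : {mpoly K[2]}))) /= -> := e0; rewrite rmorph0.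
  exists q; last by rewrite hq memv_line.
  by exists p, (form_of A), (bform (e * d) (ev A F)); split=> //; rewrite pullback_form_of.
rewrite hq => /vlineP[c ->].
(* A multiple [c] of a pullback is again a pullback: scaling [iota] by a [d]-th root of [c] scales
   [F(iota)] by [c]. *)
have [b eb] : exists b : K, b ^+ d = c.
  have [b] := @solve_monicpoly K d (fun i => if i == 0%N then c else 0) d_gt0.
  rewrite -(prednK d_gt0) big_ord_recl /= expr0 mulr1 big1 ?addr0; first by exists b.
  by move=> i _; rewrite mul0r.
have := E (b *: coef_mx iota); rewrite h0 meval0 => ->; apply: meval_eq => k.
suff -> : c *: G = bform (e * d) (ev (b *: coef_mx iota) F) by [].
apply: val_inj; rewrite /= eG -(coef_mxK iota) pullback_form_of /= coef_mxK -homog_ofZ.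
congr homog_of; apply: poly_ext => x; rewrite hornerZ !horner_ev -eb.
rewrite -(meval_homog _ _ (dhomog_is_dhomog F)); apply: meval_eq => i.
by rewrite /line !linearZ /= hornerZ.
Qed.

(** Passing to affine cones adds one to the dimensions of the source, the target and the image,
    hence [N] and [(e * d).+1]; the generic rank is the largest one. *)
Lemma maximal_rank_diff :
  maximal_rank e F <-> exists A, (minn N (e * d).+1 <= \rank (diff_mx A))%N.
Proof.
pose Q r := `[< exists A, \rank (diff_mx A) = r >].
have exQ : exists r, Q r by exists (\rank (diff_mx 0)); apply/asboolP; exists 0.
have ubQ r : Q r -> (r <= N)%N by move=> /asboolP[A <-]; apply: rank_leq_row.
case: (ex_maxnP exQ ubQ) => r /asboolP[A0 eA0] maxr.
have max A : (\rank (diff_mx A) <= r)%N by apply: maxr; apply/asboolP; exists A.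
have tr : has_trdeg (affine_cone (@Phi_image K d e F)) r.
  apply: (has_trdeg_param Phi_cone) => [|c].
    by exists (pt A0); rewrite rank_jacobian_image.
  have [A eA] := pt_surj c; have <- : jacobian param_image (pt A) = jacobian param_image c.
    by apply/matrixP => i j; rewrite !mxE; apply: meval_eq.
  by rewrite rank_jacobian_image.
have le_r : (r <= minn N (e * d).+1)%N.
  by rewrite -eA0 leq_min rank_leq_row rank_leq_col.
split=> [[m [n [hm hn hmn]]]|[A hA]].
  exists A0; rewrite eA0 -(has_trdeg_uniq hmn tr) -(has_trdeg_uniq hm trdeg_Mor).
  by rewrite -(has_trdeg_uniq hn has_dim_all) minnSS.
have er : r = minn N (e * d).+1.
  by apply/eqP; rewrite eqn_leq le_r (leq_trans hA).
have eN : N = (3 * e + 2).+1 by lia.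
exists (3 * e + 2)%N, (e * d)%N; split; [|exact: has_dim_all|].
  by rewrite /has_dim -eN; apply: trdeg_Mor.
by rewrite /has_dim -minnSS -eN -er.
Qed.

End Link.

(** * Coprimality of the partial derivatives of a squarefree form *)

Section SquareFree.
Variable K : numClosedFieldType.

Lemma mpoly_unit_size n (p : {mpoly K[n]}) : p != 0 -> (msize p <= 1)%N -> p \is a GRing.unit.
Proof.
move=> p0 sp; rewrite (msize1_polyC sp) in p0 *; apply: rmorph_unit.
by rewrite unitfE -(mpolyC_eq0 n).
Qed.

Lemma divides_msize n (p q : {mpoly K[n]}) : divides p q -> q != 0 -> (msize p <= msize q)%N.
Proof.
case=> k -> ; rewrite mulf_eq0 negb_or => /andP[k0 p0]; rewrite msizeM //.
have : (0 < msize k)%N by rewrite lt0n msize_poly_eq0.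
by move: (msize k) (msize p) => a b; lia.
Qed.

Lemma exists_prime_divisor n (g : {mpoly K[n]}) : g != 0 -> (1 < msize g)%N ->
  exists2 p, prime_elt p & divides p g.
Proof.
move=> g0 sg; have [u [[|p ps] [uu pps eg]]] := @mpoly_factorial K n g g0.
  exfalso; move: sg; rewrite eg big_nil mulr1; case/unitrPr: uu => v uv.
  have [u0 v0] : u != 0 /\ v != 0.
    by apply/andP; rewrite -negb_or -mulf_eq0 uv oner_eq0.
  have := msizeM u0 v0; rewrite uv msize1.
  have : (0 < msize v)%N by rewrite lt0n msize_poly_eq0.
  by move: (msize u) (msize v) => a b; lia.
exists p; first by apply: pps; rewrite mem_head.
by rewrite eg big_cons mulrCA; exists (u * \prod_(x <- ps) x); rewrite mulrC.
Qed.

(** A prime [p] dividing all partial derivatives divides [F = H p] by Euler's identity, hence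
    divides [H p_i] for each [i]. Some [p_i] is nonzero and of smaller degree than [p], so [p]
    divides [H], and [p ^ 2] divides [F]. *)
Lemma partials_coprime d (F : dhomog 3 K d) (g : {mpoly K[3]}) : (0 < d)%N ->
  reduced_form F -> (forall i, divides g (F : {mpoly K[3]})^`M(i)) -> g != 0 ->
  (msize g <= 1)%N.
Proof.
move=> d0 [F0 sqf] hg g0; rewrite leqNgt; apply/negP => sg.
have [p pp pg] := exists_prime_divisor g0 sg.
have hp i : divides p (F : {mpoly K[3]})^`M(i) := divides_trans pg (hg i).
have [H eF] : divides p (F : {mpoly K[3]}).
  have : divides p ((F : {mpoly K[3]}) *+ d).
    rewrite -(euler_identity (dhomog_is_dhomog F)); apply: divides_sum => i _.
    exact: divides_mull.
  move=> [k ek]; exists (d%:R^-1 *: k).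
  rewrite -scalerAl -ek -scaler_nat scalerA mulVf ?scale1r //.
  by rewrite pnatr_eq0 -lt0n.
have [p0 pu pP] := pp.
have [i pi] : exists i, p^`M(i) != 0.
  apply: exists_neq0 => /mderiv_eq0 eC; case/negP: pu; rewrite eC.
  apply: rmorph_unit; rewrite unitfE; apply: contraNneq p0 => e0.
  by rewrite eC e0 mpolyC0.
have [/divides_msize|[H' eH]] : divides p p^`M(i) \/ divides p H.
- apply: pP; have := hp i; rewrite eF mderivM => h.
  rewrite mulrC -[X in divides p X](addKr (H^`M(i) * p)).
  by rewrite addrC; apply: dividesB => //; exists (H^`M(i)).
- by move/(_ pi); rewrite leqNgt (msize_mderiv pi).
have [c ec] : exists c, p = c%:MP by apply: (sqf p H'); rewrite eF eH; ring.
case/negP: pu; rewrite ec; apply: rmorph_unit; rewrite unitfE.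
by apply: contraNneq p0 => e0; rewrite ec e0 mpolyC0.
Qed.

End SquareFree.

Lemma size_divisor_polyC (A : idomainType) (p q : {poly A}) c :
  c != 0 -> c%:P = q * p -> (size p <= 1)%N.
Proof.
move=> c0 e0.
have [q0 p0] : q != 0 /\ p != 0.
  by apply/andP; rewrite -negb_or -mulf_eq0 -e0 polyC_eq0.
have := size_mul q0 p0; rewrite -e0 size_polyC c0.
have : (0 < size q)%N by rewrite size_poly_gt0.
by move: (size p) (size q) => x y; lia.
Qed.

(** * Divisors of forms pulled back along the universal curve *)

Section TauDivisors.
Variables (K : numClosedFieldType) (e : nat).
Local Notation N := (3 * e.+1)%N.
Local Notation R := {mpoly K[N]}.
Local Notation U i j := ('X_(mxvec_index (i : 'I_3) (j : 'I_e.+1)) : R).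
Local Notation polyMP := (polyC \o @mpolyC N K).

(* The automorphism of K[u][x] over K[x] fixing u_ij for j > 0 and translating
   u_i0 by s * (iota_i(x) - u_i0); [s = -1] carries P(iota(x)) to P(u_i0). *)
Definition shear (s : int) (k : 'I_N) : {poly R} :=
  if (ixj k).2 == ord0 then ('X_k)%:P + (gen K e (ixj k).1 - ('X_k)%:P) *~ s else ('X_k)%:P.

Definition shear_poly (s : int) (G : {poly R}) : {poly R} :=
  (map_poly (mmap polyMP (shear s)) G).['X].
HB.instance Definition _ s := GRing.RMorphism.copy (shear_poly s)
  (horner_eval 'X \o map_poly (mmap polyMP (shear s))).

Lemma shear_polyC s q : shear_poly s q%:P = mmap polyMP (shear s) q.
Proof. by rewrite /shear_poly map_polyC hornerC. Qed.

Lemma shear_polyX s : shear_poly s 'X = 'X.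
Proof. by rewrite /shear_poly map_polyX hornerX. Qed.

Lemma gen_split i : gen K e i = (U i ord0)%:P +
  \sum_(j < e) (U i (lift ord0 j))%:P * 'X^(lift ord0 j).
Proof.
rewrite /gen /rVpoly poly_def big_ord_recl; congr (_ + _).
  by rewrite (insubT (fun k => k < e.+1)%N (ltn0Sn e)) /= mxE -mul_polyC mulr1; congr ('X_(mxvec_index _ _))%:P; apply: val_inj.
apply: eq_bigr => j _; rewrite valK mxE -mul_polyC //.
Qed.

Lemma shear_U s i j : shear_poly s (U i j)%:P =
  if j == ord0 then (U i j)%:P + (gen K e i - (U i j)%:P) *~ s else (U i j)%:P.
Proof. by rewrite shear_polyC mmapXU /shear ixjE. Qed.

Lemma shear_gen s i : shear_poly s (gen K e i) = gen K e i + (gen K e i - (U i ord0)%:P) *~ s.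
Proof.
rewrite {1}gen_split rmorphD /= shear_U eqxx rmorph_sum /=.
have -> : \sum_(j < e) shear_poly s ((U i (lift ord0 j))%:P * 'X^(lift ord0 j)) =
    gen K e i - (U i ord0)%:P.
  rewrite gen_split addrC addKr; apply: eq_bigr => j _.
  by rewrite rmorphM rmorphXn /= shear_polyX shear_U.
ring.
Qed.

Lemma shear_polyK G : shear_poly 1 (shear_poly (-1) G) = G.
Proof.
elim/poly_ind: G => [|G c IH]; first by rewrite !rmorph0.
rewrite !rmorphD !rmorphM /= !shear_polyX; apply: f_equal2; first exact: f_equal2.
rewrite shear_polyC -[in RHS](mmap_var c).
have -> : (mmap (@mpolyC N K) (fun i => 'X_i) c)%:P = mmap polyMP (fun k : 'I_N => ('X_k)%:P) c.
  exact: mmap_morph.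
apply: mmap_morph => [a|k]; first by rewrite /= shear_polyC mmapC.
case/mxvec_indexP: k => i j; rewrite /shear ixjE /=.
have [->|nj] := eqVneq j ord0; last by rewrite shear_U (negPf nj).
rewrite rmorphD rmorphMz rmorphB /= shear_gen shear_U eqxx.
ring.
Qed.

Definition tau0 (P : {mpoly K[3]}) : R := mmap (@mpolyC N K) (fun i => U i ord0) P.
HB.instance Definition _ := GRing.RMorphism.copy tau0
  (mmap (@mpolyC N K) (fun i : 'I_3 => U i ord0)).

Lemma shear_tau P : shear_poly (-1) (tau e P) = (tau0 P)%:P.
Proof.
rewrite /tau0 (mmap_morph (phi := polyC) (f' := polyMP) (h' := fun i => (U i ord0)%:P)) //.
apply: mmap_morph => [a|i]; first by rewrite /= shear_polyC mmapC.
by rewrite /= shear_gen; ring.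
Qed.

Lemma shear_tau0 P : shear_poly 1 (tau0 P)%:P = tau e P.
Proof. by rewrite -shear_tau shear_polyK. Qed.

(** Multiplies the [u_ij] with [j > 0] by [x]: the value at [x = 1] is the identity, the value at
    [x = 0] erases these variables. *)
Definition scale_var (k : 'I_N) : {poly R} :=
  if (ixj k).2 == ord0 then ('X_k)%:P else 'X_k *: 'X.

(** The substitution [scale_var] fixes [tau0 P], so the image of a divisor [a] divides a nonzero
    constant of [{poly R}] and is constant in [x]. Comparing its values at 1 and 0 shows that [a]
    involves the [u_i0] only. *)
Lemma tau0_divisor a P : P != 0 -> divides a (tau0 P) ->
  exists2 g, a = tau0 g & divides g P.
Proof.
move=> P0 [b eab].
pose th := mmap polyMP scale_var.
have th0 Q : th (tau0 Q) = (tau0 Q)%:P.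
  rewrite /tau0 (mmap_morph (phi := polyC) (f' := polyMP) (h' := fun i => (U i ord0)%:P)) //.
  apply: mmap_morph => [c|i]; first by rewrite /= mmapC.
  by rewrite /= mmapXU /scale_var ixjE.
pose rho (q : R) : {mpoly K[3]} :=
  mmap (@mpolyC 3 K) (fun k => if (ixj k).2 == ord0 then 'X_((ixj k).1) else 0) q.
have rho0 Q : rho (tau0 Q) = Q.
  rewrite -[RHS]mmap_var; apply: mmap_morph => [c|i]; first by rewrite /= mmapC.
  by rewrite /= mmapXU ixjE.
have tP0 : tau0 P != 0 by apply: contraNneq P0 => e0; rewrite -(rho0 P) e0 /rho raddf0.
have eth : (tau0 P)%:P = th b * th a by rewrite -th0 eab /th rmorphM.
have sth := size_divisor_polyC tP0 eth.
have th1 : (th a).[1] = a.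
  rewrite -[RHS]mmap_var; apply: (mmap_morph (phi := horner_eval 1)) => [c|k].
    by rewrite /= /horner_eval hornerC.
  rewrite /= /horner_eval /scale_var; case: ifP; rewrite ?hornerC //.
  by rewrite hornerZ hornerX mulr1.
have thz : (th a).[0] = tau0 (rho a).
  transitivity (mmap (@mpolyC N K) (fun k => if (ixj k).2 == ord0 then 'X_k else 0) a).
    apply: (mmap_morph (phi := horner_eval 0)) => [c|k].
      by rewrite /= /horner_eval hornerC.
    rewrite /= /horner_eval /scale_var; case: ifP; rewrite ?hornerC //.
    by rewrite hornerZ hornerX mulr0.
  apply/esym; apply: mmap_morph => [c|k]; first by rewrite /= /tau0 mmapC.
  case/mxvec_indexP: k => i j; rewrite ixjE /=; case: eqP => [->|_]; last exact: rmorph0.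
  by rewrite /tau0 mmapXU.
have ea : a = tau0 (rho a).
  by rewrite -thz -{1}th1 (size1_polyC sth) !hornerC.
exists (rho a) => //; exists (rho b).
by rewrite -[LHS]rho0 eab /rho rmorphM.
Qed.

(** The shear carries [tau P] to a polynomial of degree 0 in [x]; its divisors also have degree 0,
    are described by [tau0_divisor], and are carried back by the inverse shear. *)
Lemma tau_divisor (G : {poly R}) (P : {mpoly K[3]}) : P != 0 -> divides G (tau e P) ->
  exists2 g, G = tau e g & divides g P.
Proof.
move=> P0 [H eGH].
have eS : (tau0 P)%:P = shear_poly (-1) H * shear_poly (-1) G.
  by rewrite -shear_tau eGH rmorphM.
have tP0 : tau0 P != 0.
  apply: contraNneq P0 => e0; apply/eqP/(@tau_inj _ e).
  by rewrite -shear_tau0 e0 rmorph0.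
have sG := size_divisor_polyC tP0 eS.
have sH := size_divisor_polyC tP0 (etrans eS (mulrC _ _)).
have [|g eg dg] := tau0_divisor (a := (shear_poly (-1) G)`_0) P0.
  exists (shear_poly (-1) H)`_0; apply: polyC_inj.
  by rewrite eS {1}(size1_polyC sG) {1}(size1_polyC sH) -polyCM.
exists g => //; rewrite -[LHS]shear_polyK (size1_polyC sG) eg.
exact: shear_tau0.
Qed.

Lemma tau_bezout (P : 'I_3 -> {mpoly K[3]}) : (exists i, P i != 0) ->
  (forall g, g != 0 -> (forall i, divides g (P i)) -> (msize g <= 1)%N) ->
  exists (h : 'I_3 -> {poly R}) (r : R), r != 0 /\ \sum_i h i * tau e (P i) = r%:P.
Proof.
move=> [i0 Pi0] cop; apply: (coprime_bezout (@mpoly_factorial K N)).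
  by exists i0; apply: contraNneq Pi0 => /tau_inj ->.
move=> G hG; have [g eG dg] := tau_divisor Pi0 (hG i0).
have g0 : g != 0.
  by apply: contraNneq Pi0 => e0; case: dg => k ->; rewrite e0 mulr0.
have /msize1_polyC eg : (msize g <= 1)%N.
  apply: cop => // j; have [->|Pj0] := eqVneq (P j) 0; first exact: divides0.
  have [g' eG' dg'] := tau_divisor Pj0 (hG j).
  suff -> : g = g' by [].
  apply/subr0_eq/(@tau_inj _ e).
  by rewrite rmorphB /= -eG -eG' subrr.
by rewrite eG eg tauC size_polyC_leq1.
Qed.

End TauDivisors.

(** * Cross products of triples *)

Lemma sum3 (B : nmodType) (f : 'I_3 -> B) (k : 'I_3) : \sum_i f i = f k + f (k + 1) + f (k + 2%:R).
Proof.
rewrite (bigD1 k) //= (bigD1 (k + 1)) /=; last first.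
  by case: k => -[|[|[|k]]] lt //; rewrite -val_eqE.
rewrite (bigD1 (k + 2%:R)) /=; last first.
  by case: k => -[|[|[|k]]] lt //; rewrite -!val_eqE.
rewrite big1 ?addr0 ?addrA // => i.
by case: k i => -[|[|[|k]]] lt //; case=> -[|[|[|i]]] lti //; rewrite -!val_eqE.
Qed.

Section Cross.
Variable B : comNzRingType.
Implicit Types f X Y : 'I_3 -> B.

Lemma ord3_cases (i k : 'I_3) : [\/ i = k, i = k + 1 | i = k + 2%:R].
Proof.
case: k i => -[|[|[|k]]] lt //; case=> -[|[|[|i]]] lti //;
  by [constructor 1; apply: val_inj | constructor 2; apply: val_inj | constructor 3; apply: val_inj].
Qed.

(** Addition in ['I_3] is modulo 3, so that one formula covers the three coordinates. *)
Definition cross X Y (k : 'I_3) : B :=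
  X (k + 1) * Y (k + 2%:R) - X (k + 2%:R) * Y (k + 1).

Lemma ord3_add (k : 'I_3) : (k + 1 + 1 = k + 2%:R) * (k + 1 + 2%:R = k)
  * (k + 2%:R + 1 = k) * (k + 2%:R + 2%:R = k + 1).
Proof.
by case: k => -[|[|[|k]]] lt //; do !split; apply: val_inj.
Qed.

(* f x (X x Y) = (f . Y) X - (f . X) Y *)
Lemma cross_parallel f X Y : \sum_i X i * f i = 0 -> \sum_i Y i * f i = 0 ->
  forall i j, f i * cross X Y j = f j * cross X Y i.
Proof.
move=> hX hY i j; have [->//|->|->] := ord3_cases i j.
- move: hX hY; rewrite !(sum3 _ j) /cross !ord3_add => hX hY.
  apply: subr0_eq.
  transitivity (Y (j + 2%:R) * (X j * f j + X (j + 1) * f (j + 1) + X (j + 2%:R) * f (j + 2%:R))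
    - X (j + 2%:R) * (Y j * f j + Y (j + 1) * f (j + 1) + Y (j + 2%:R) * f (j + 2%:R))).
    ring.
  by rewrite hX hY !mulr0 subrr.
move: hX hY; rewrite !(sum3 _ j) /cross !ord3_add => hX hY.
apply: subr0_eq.
transitivity (X (j + 1) * (Y j * f j + Y (j + 1) * f (j + 1) + Y (j + 2%:R) * f (j + 2%:R))
  - Y (j + 1) * (X j * f j + X (j + 1) * f (j + 1) + X (j + 2%:R) * f (j + 2%:R))).
  ring.
by rewrite hX hY !mulr0 subrr.
Qed.

Lemma cross_eq0 X Y : (forall k, cross X Y k = 0) <-> (forall i j, X i * Y j = X j * Y i).
Proof.
split=> [h i j|h k]; last by rewrite /cross h subrr.
have [->//|->|->] := ord3_cases i j.
- by have := h (j + 2%:R); rewrite /cross !ord3_add => /eqP; rewrite subr_eq0 => /eqP ->.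
by have := h (j + 1); rewrite /cross !ord3_add => /eqP; rewrite subr_eq0 => /eqP ->.
Qed.

End Cross.

(** * Kernels and generic rank of matrices of polynomials *)

Section ClearDenominators.
Variable A : idomainType.
Local Notation L := {fraction A}.
Local Notation inc := (@tofrac A).

Lemma fraction_denominator (x : L) : exists2 a, a != 0 & exists b, x * inc a = inc b.
Proof.
elim/quotW: x => r; exists r.2; [exact: denom_ratioP|exists r.1].
unlock tofrac; rewrite -[LHS]FracField.pi_mul; apply/eqmodP.
rewrite /= FracField.equivfE /FracField.mulf.
rewrite !numden_Ratio ?oner_neq0 ?mulf_neq0 ?denom_ratioP //.
all: by rewrite ?oner_neq0 ?mulr1 1?mulrC.
Qed.

Lemma common_denominator m (v : 'rV[L]_m) : exists2 a, a != 0 &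
  exists w : 'rV[A]_m, inc a *: v = map_mx inc w.
Proof.
have h i : exists ab : A * A, ab.1 != 0 /\ v 0 i * inc ab.1 = inc ab.2.
  by have [a a0 [b e]] := fraction_denominator (v 0 i); exists (a, b).
have [ab hab] := choice h.
exists (\prod_i (ab i).1); first by apply/prodf_neq0 => i _; case: (hab i).
exists (\row_i (\prod_(j | j != i) (ab j).1 * (ab i).2)).
apply/rowP => i; rewrite !mxE (bigD1 i) //= !tofracM; have [_ <-] := hab i.
by ring.
Qed.

Lemma exists_left_kernel m n (M : 'M[A]_(m, n)) :
  (\rank (map_mx inc M) < m)%N -> exists2 a : 'rV[A]_m, a != 0 & a *m M = 0.
Proof.
move=> rk; have : kermx (map_mx inc M) != 0.
  by rewrite -mxrank_eq0 mxrank_ker subn_eq0 -ltnNge.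
move=> /rowV0Pn[v /sub_kermxP vM v0].
have [a a0 [w e]] := common_denominator v.
exists w.
  apply: contraNneq v0 => w0; move: e; rewrite w0 map_mx0 => /eqP.
  by rewrite scalemx_eq0 tofrac_eq0 (negPf a0).
have h : map_mx inc (w *m M) = 0 by rewrite map_mxM -e -scalemxAl vM scaler0.
apply/rowP => j; have /rowP/(_ j) := h; rewrite [X in X = _ -> _]mxE [X in _ = X -> _]mxE.
by move/eqP; rewrite tofrac_eq0 => /eqP->; rewrite mxE.
Qed.

End ClearDenominators.

Section GenericRank.
Variables (K : numFieldType) (N : nat).
Local Notation R := {mpoly K[N]}.

Lemma mxrank_mxsub (k : fieldType) m n p q (f : 'I_p -> 'I_m) (g : 'I_q -> 'I_n) (M : 'M[k]_(m, n)) :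
  (\rank (mxsub f g M) <= \rank M)%N.
Proof.
have rs m' n' p' (h : 'I_p' -> 'I_m') (B : 'M[k]_(m', n')) : (\rank (rowsub h B) <= \rank B)%N.
  by apply: mxrankS; apply: rowsub_sub.
rewrite (_ : mxsub f g M = rowsub f (rowsub g M^T)^T); last by apply/matrixP => i j; rewrite !mxE.
by apply: leq_trans (rs _ _ _ _ _) _; rewrite mxrank_tr; apply: leq_trans (rs _ _ _ _ _) _; rewrite mxrank_tr.
Qed.

(** A nonzero minor of maximal size stays nonzero at some point. *)
Lemma generic_rank m n (M : 'M[R]_(m, n)) : exists v : 'I_N -> K,
  (\rank (map_mx (@tofrac R) M) <= \rank (map_mx (meval v) M))%N.
Proof.
pose Mf := map_mx (@tofrac R) M; rewrite -/Mf.
pose f := maxrankfun Mf.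
pose B := rowsub f Mf.
have rB : \rank B^T = \rank Mf by rewrite mxrank_tr; apply/eqP; apply: maxrowsub_free.
have fB : row_full B^T by rewrite /row_full rB.
pose g := fullrankfun fB; pose S := mxsub f g M.
have dS : \det S != 0.
  rewrite -tofrac_eq0 -det_map_mx -unitfE -unitmxE -unitmx_tr.
  rewrite (_ : (map_mx _ S)^T = rowsub g B^T) ?fullrowsub_unit //.
  by apply/matrixP => i j; rewrite !mxE.
have [v hv] := mpoly_nonroot dS; exists v.
rewrite -[X in (X <= _)%N](_ : \rank (map_mx (meval v) S) = \rank Mf).
  by rewrite map_mxsub; apply: mxrank_mxsub.
by apply: mxrank_unit; rewrite unitmxE unitfE det_map_mx.
Qed.

End GenericRank.

(** * Syzygies of the partial derivatives along a generic curve *)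

Lemma sum_mxvec (S : nmodType) m n (f : 'I_(m * n) -> S) :
  \sum_k f k = \sum_i \sum_j f (mxvec_index i j).
Proof.
rewrite (reindex _ (curry_mxvec_bij m n)) pair_bigA /=.
by apply: eq_bigr => -[i j] _.
Qed.

(** The Bezout relation turns proportionality into [r X_k = f_k * sum_j h_j X_j]; by degree the sum
    must vanish. *)
Lemma parallel_primitive (A : idomainType) (f h X : 'I_3 -> {poly A}) r k :
  r != 0 -> \sum_i h i * f i = r%:P -> f k != 0 ->
  (forall i j, f i * X j = f j * X i) -> (size (X k) < size (f k))%N ->
  forall j, X j = 0.
Proof.
move=> r0 hr fk0 par sX.
have Xk : X k = 0.
  apply/eqP; apply: contraT => Xk0.
  have eX : r *: X k = f k * \sum_j h j * X j.
    rewrite -mul_polyC -hr mulr_suml mulr_sumr; apply: eq_bigr => j _.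
    by rewrite -mulrA par mulrCA.
  have Y0 : \sum_j h j * X j != 0.
    apply: contraNneq Xk0 => Y0; move/eqP: eX.
    by rewrite Y0 mulr0 -mul_polyC mulf_eq0 polyC_eq0 (negPf r0).
  have sY : (0 < size (\sum_j h j * X j)%R)%N by rewrite size_poly_gt0.
  have := congr1 (fun p : {poly A} => size p) eX.
  rewrite size_scale // size_mul // => e1; move: sX sY; rewrite e1.
  by move: (size _) (size _) => a b; lia.
move=> j; have /eqP := par k j; rewrite Xk mulr0 mulf_eq0 (negPf fk0) /=.
by move/eqP.
Qed.

Lemma size_cross (R : comNzRingType) (S T : 'I_3 -> {poly R}) a b k :
  (forall i, size (S i) <= a.+1)%N -> (forall i, size (T i) <= b.+1)%N ->
  (size (cross S T k) <= (a + b).+1)%N.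
Proof.
move=> hS hT; rewrite /cross; apply: leq_trans (size_polyD _ _) _.
rewrite size_polyN geq_max; apply/andP; split;
  (apply: leq_trans (size_polyMleq _ _) _);
  [have := hS (k + 1); have := hT (k + 2%:R)|have := hS (k + 2%:R); have := hT (k + 1)];
  move: (size _) (size _) => x y; lia.
Qed.

Lemma mxrank_row_mx (k : fieldType) m p q (A : 'M[k]_(m, p)) (B : 'M[k]_(m, q)) :
  (\rank (row_mx A B) <= \rank A + \rank B)%N.
Proof.
rewrite -mxrank_tr tr_row_mx -addsmxE -[\rank A]mxrank_tr -[\rank B]mxrank_tr.
by case: (mxrank_adds_leqif A^T B^T).
Qed.

Lemma deriv_eq0_const (K : numFieldType) (p : {poly K}) : p^`() = 0 -> p = (p`_0)%:P.
Proof.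
move=> e; apply/polyP => -[|i]; rewrite coefC //=.
have /(congr1 (fun r : {poly K} => r`_i)) := e; rewrite coef_deriv coef0 => /eqP.
by rewrite mulrn_eq0 /= => /eqP.
Qed.

(** After division by the gcd, [p] divides [p q' = q p'] and is coprime to [q], so it divides [p'],
    which has smaller degree: in characteristic 0 both quotients are constants. *)
Lemma wronskian_zero (K : numFieldType) (p q : {poly K}) :
  p * q^`() = q * p^`() -> forall x y, p.[x] * q.[y] = p.[y] * q.[x].
Proof.
have [->|p0] := eqVneq p 0; first by move=> _ x y; rewrite !horner0 !mul0r.
have [->|q0] := eqVneq q 0; first by move=> _ x y; rewrite !horner0 !mulr0.
set g := gcdp p q; have g0 : g != 0 by rewrite gcdp_eq0 negb_and p0.
have cop : coprimep (p %/ g) (q %/ g) by rewrite coprimep_div_gcd ?p0.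
have ep : p = p %/ g * g by rewrite divpK ?dvdp_gcdl.
have eq : q = q %/ g * g by rewrite divpK ?dvdp_gcdr.
move: cop ep eq; move: (p %/ g) (q %/ g) => p1 q1 cop ep eq.
have const (a b : {poly K}) : coprimep a b -> a != 0 -> a * b^`() = b * a^`() -> a = (a`_0)%:P.
  move=> cab a0 e; apply: deriv_eq0_const; apply/eqP; apply: contraT => d0.
  have /dvdp_leq : a %| a^`().
    by rewrite -(Gauss_dvdpr _ cab) -e dvdp_mulr.
  by move=> /(_ d0); rewrite leqNgt lt_size_deriv.
rewrite ep eq !derivM => e.
have e1 : p1 * q1^`() = q1 * p1^`().
  apply: (mulIf (mulf_neq0 g0 g0)); apply: subr0_eq.
  transitivity (p1 * g * (q1^`() * g + q1 * g^`()) - q1 * g * (p1^`() * g + p1 * g^`())); first by ring.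
  by rewrite e subrr.
have p10 : p1 != 0 by apply: contraNneq p0 => e2; rewrite ep e2 mul0r.
have q10 : q1 != 0 by apply: contraNneq q0 => e2; rewrite eq e2 mul0r.
have {}cop' : coprimep q1 p1 by rewrite coprimep_sym.
move=> x y; rewrite (const p1 q1 cop p10 e1) (const q1 p1 cop' q10 (esym e1)).
rewrite !hornerM !hornerC; ring.
Qed.

Lemma parallel_trans (A : idomainType) I (x y z : I -> A) m : y m != 0 ->
  (forall k l, x k * y l = x l * y k) -> (forall k l, y k * z l = y l * z k) ->
  forall k l, x k * z l = x l * z k.
Proof.
move=> ym xy yz k l; apply: (mulfI ym).
transitivity (x k * y l * z m); first by rewrite mulrCA (yz m l) mulrA.
by rewrite (xy k l) -mulrA (yz k m) mulrCA.
Qed.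

Lemma horner_minor (A : comNzRingType) (p q r t : {poly A}) a :
  p.[a] * q.[a] = r.[a] * t.[a] -> (p * q - r * t).[a] = 0.
Proof. by move=> h; rewrite hornerD hornerN !hornerM h subrr. Qed.

Section SyzygiesAlongCurves.
Variables (K : numClosedFieldType) (d e : nat) (F : dhomog 3 K d).
Hypothesis d_gt0 : (0 < d)%N.
Hypothesis e_gt0 : (0 < e)%N.
Hypothesis F_red : reduced_form F.
Local Notation P3 := {mpoly K[3]}.
Local Notation N := (3 * e.+1)%N.
Local Notation R := {mpoly K[N]}.
Local Notation M3 := 'M[K]_(3, e.+1).
Local Notation n := (e * d.-1)%N.
Local Notation dF i := ((F : P3)^`M(i)).

(** For the maps with coordinates [v_i x^e] the coefficient of [x^(e k)] is the top homogeneous part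
    of [P] at [v], which is nonzero for some [v]. *)
Lemma size_tau_eq (P : P3) k : msize P = k.+1 -> size (tau e P) = (e * k).+1.
Proof.
move=> sP; apply/eqP; rewrite eqn_leq size_tau ?sP //=.
have top0 : pihomog mdeg k P != 0.
  have P0 : P != 0 by rewrite -msize_poly_eq0 sP.
  apply/eqP => /(congr1 (mcoeff (mlead P))).
  rewrite mcoeff0 pihomogE big_mkcond raddf_sum /=.
  rewrite (bigD1_seq (mlead P)) ?msupp_uniq ?mlead_supp //= ifT; last first.
    by apply/eqP; apply: succn_inj; rewrite mlead_deg.
  rewrite mcoeffZ mcoeffX eqxx mulr1 big1 ?addr0 => [/eqP|m ne].
    by rewrite mleadc_eq0 (negPf P0).
  by case: ifP; rewrite ?mcoeff0 // mcoeffZ mcoeffX (negPf ne) mulr0.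
have [v hv] := mpoly_nonroot top0.
pose A : M3 := \matrix_(i, j) if j == ord_max then v i else 0.
have lA i : line A i = v i *: 'X^e.
  apply/polyP => j; rewrite /line coef_rVpoly coefZ coefXn.
  case: insubP => [j' _ <-|].
    by rewrite !mxE -val_eqE /=; case: eqP; rewrite (mulr1, mulr0).
  by rewrite -leqNgt => lt; rewrite gtn_eqF // mulr0.
have eA : (ev A P)`_(e * k) = (pihomog mdeg k P).@[v].
  rewrite pihomogE raddf_sum /ev /mmap coef_sum /= [RHS]big_mkcond /=.
  apply: eq_bigr => m _; rewrite /mmap1.
  have -> : \prod_i line A i ^+ m i = (\prod_i v i ^+ m i) *: 'X^(e * mdeg m).
    rewrite mdegE big_distrr /= (big_morph _ (exprD 'X) (expr0 'X)).
    rewrite -scaler_prod; apply: eq_bigr => i _.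
    by rewrite lA exprZn exprM.
  rewrite coefCM coefZ coefXn eqn_pmul2l // eq_sym.
  by case: eqP => _; rewrite ?mulr0 // mulr1 mevalZ mevalX.
rewrite ltnNge; apply: contra hv => le; rewrite -eA -ev_tau coef_map.
by have /leq_sizeP/(_ (e * k)%N (leqnn _)) -> := le; rewrite /= meval0.
Qed.

Definition ptl (i : 'I_3) : {poly R} := tau e (dF i).

Lemma partial_exists : exists i, dF i != 0.
Proof.
apply: exists_neq0 => /mderiv_eq0 eC; have [F0 _] := F_red.
case/eqP: F0; apply: val_inj; rewrite /= eC.
rewrite (@dhomog_nemf_coeff _ _ mdeg d) ?mpolyC0 ?dhomog_is_dhomog //.
by rewrite /= mdeg0 eq_sym -lt0n.
Qed.

Lemma size_ptl i : dF i != 0 -> size (ptl i) = n.+1.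
Proof.
move=> h; apply: size_tau_eq; rewrite -(mlead_deg h); congr S.
exact: (dhomog_mf (mderiv_homog i (dhomog_is_dhomog F)) (mlead_supp h)).
Qed.

(** The partial derivatives along the universal curve satisfy a Bezout relation, so that nothing
    proportional to them has smaller degree, except 0. *)
Lemma primitive_multiple (X : 'I_3 -> {poly R}) k : dF k != 0 ->
  (forall i j, ptl i * X j = ptl j * X i) -> (size (X k) <= n)%N -> forall j, X j = 0.
Proof.
move=> k0 par sX.
have [h [r [r0 hr]]] : exists (h : 'I_3 -> {poly R}) (r : R), r != 0 /\ \sum_i h i * ptl i = r%:P.
  apply: tau_bezout; first exact: partial_exists.
  move=> g g0 hg; exact: (partials_coprime d_gt0 F_red hg g0).
apply: (@parallel_primitive _ ptl h X r k r0 hr _ par); last by rewrite size_ptl.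
by rewrite -size_poly_eq0 size_ptl.
Qed.

Definition syz (S : 'I_3 -> {poly R}) : Prop := \sum_i S i * ptl i = 0.

(* Coefficient matrix of the linear map sending a triple of polynomials of
   degree at most e to a polynomial. *)
Definition op_mx (phi : 'I_3 -> {poly R}) q (s : nat) : 'M[R]_(N, q) :=
  \matrix_(k, l) ('X^((ixj k).2) * phi (ixj k).1)`_(l + s).

Definition triple (a : 'rV[R]_N) (i : 'I_3) : {poly R} :=
  rVpoly (row i (vec_mx a)).

Lemma size_triple a i : (size (triple a i) <= e.+1)%N.
Proof. exact: size_poly. Qed.

Lemma triple_eq0 a : (forall i, triple a i = 0) -> a = 0.
Proof.
move=> h; rewrite -[a]vec_mxK (_ : vec_mx a = 0) ?linear0 //.
apply/row_matrixP => i; rewrite row0; apply: (can_inj rVpolyK); rewrite linear0.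
exact: h.
Qed.

Lemma op_mxE phi q s a (l : 'I_q) :
  (a *m op_mx phi q s) 0 l = (\sum_i triple a i * phi i)`_(l + s).
Proof.
rewrite mxE coef_sum sum_mxvec; apply: eq_bigr => i _.
have -> : triple a i = \sum_j a 0 (mxvec_index i j) *: 'X^j.
  rewrite /triple /rVpoly poly_def; apply: eq_bigr => j _.
  by rewrite valK !mxE.
rewrite mulr_suml coef_sum; apply: eq_bigr => j _.
by rewrite mxE ixjE /= -scalerAl coefZ.
Qed.

Lemma ed_eq : (e * d = n + e)%N.
Proof. by rewrite -{1}(prednK d_gt0) mulnS addnC. Qed.

Lemma size_ptl_le i : (size (ptl i) <= n.+1)%N.
Proof. by apply: size_tau; apply: msize_homog; apply: mderiv_homog; apply: dhomog_is_dhomog. Qed.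

Lemma map_op_mx A : map_mx (meval (pt A)) (op_mx ptl (e * d).+1 0) = diff_mx F A.
Proof.
apply/matrixP => k l; case/mxvec_indexP: k => i j; rewrite diff_mxE !mxE ixjE /=.
by rewrite addn0 -ev_tau -(map_polyXn (meval (pt A))) -rmorphM coef_map.
Qed.

Lemma syz_of_kernel a : a *m op_mx ptl (e * d).+1 0 = 0 -> syz (triple a).
Proof.
move=> ea; apply/polyP => l; rewrite coef0.
have [lt|ge] := ltnP l (e * d).+1.
  by have := op_mxE ptl 0 a (Ordinal lt); rewrite ea mxE /= addn0.
apply/leq_sizeP: l ge.
apply: (big_ind (fun p : {poly R} => size p <= (e * d).+1)%N) => [|p q sp sq|i _].
- by rewrite size_poly0.
- by apply: leq_trans (size_polyD _ _) _; rewrite geq_max sp.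
apply: leq_trans (size_polyMleq _ _) _.
have := size_triple a i; have := size_ptl_le i; rewrite ed_eq.
by move: (size _) (size _) => x y; lia.
Qed.

(** Action on the coefficients [u_ij] of the reparametrization [x |-> x + a] of [iota]. *)
Definition shift_var (a : K) : R -> R := mmap (@mpolyC N K)
  (fun c => (gen K e (ixj c).1 \Po ('X + (a%:MP)%:P))`_((ixj c).2)).
HB.instance Definition _ a := GRing.RMorphism.copy (shift_var a) (mmap (@mpolyC N K)
  (fun c => (gen K e (ixj c).1 \Po ('X + (a%:MP)%:P))`_((ixj c).2))).

Lemma shift_gen a i : map_poly (shift_var a) (gen K e i) = gen K e i \Po ('X + (a%:MP)%:P).
Proof.
apply/polyP => j; rewrite coef_map /= {1}/gen coef_rVpoly.
case: insubP => [j' _ <-|]; first by rewrite mxE /shift_var mmapXU ixjE.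
rewrite -leqNgt rmorph0 => le; apply/esym; move: j le; apply/leq_sizeP.
apply: leq_trans (size_comp_poly_leq _ _) _; rewrite size_XaddC muln1.
by have : (size (gen K e i) <= e.+1)%N := size_poly _ _; case: (size _).
Qed.

Lemma shift_tau a P : map_poly (shift_var a) (tau e P) = tau e P \Po ('X + (a%:MP)%:P).
Proof.
pose h i := gen K e i \Po ('X + (a%:MP)%:P).
transitivity (mmap (polyC \o @mpolyC N K) h P).
  apply: mmap_morph => [c|i]; last exact: shift_gen.
  by rewrite /= map_polyC /= /shift_var mmapC.
have hC c : comp_poly ('X + (a%:MP)%:P) ((polyC \o @mpolyC N K) c) = (polyC \o @mpolyC N K) c.
  exact: comp_polyC.
exact: (esym (@mmap_morph K {poly R} {poly R} 3 (comp_poly ('X + (a%:MP)%:P)) _ _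
  (gen K e) h P hC (fun=> erefl))).
Qed.

Lemma shift_var_inj a q : shift_var a q = 0 -> q = 0.
Proof.
move=> e0; apply: R_zero => B.
pose A : M3 := \matrix_(i, j) (line B i \Po ('X - a%:P))`_j.
have lA i : line A i = line B i \Po ('X - a%:P).
  apply/polyP => j; rewrite /line coef_rVpoly; case: insubP => [j' _ <-|].
    by rewrite !mxE.
  rewrite -leqNgt => le; apply/esym; move: j le; apply/leq_sizeP.
  apply: leq_trans (size_comp_poly_leq _ _) _; rewrite size_XsubC muln1.
  by have : (size (rVpoly (row i B)) <= e.+1)%N := size_poly _ _; case: (size _).
have := congr1 (meval (pt A)) e0; rewrite raddf0 => <-.
rewrite [RHS]meval_subst; apply: meval_eq => c.
case/mxvec_indexP: c => i j; rewrite ixjE pt_index /=.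
rewrite -coef_map map_comp_poly rmorphD /= map_polyX map_polyC /= mevalC map_gen lA.
rewrite -comp_polyA comp_polyB comp_polyX comp_polyC addrK comp_polyXr.
by rewrite /line coef_rVpoly_ord mxE.
Qed.

Lemma shift_varM (a : K) (p q : R) :
  shift_var a (p * q) = shift_var a p * shift_var a q.
Proof. exact: rmorphM. Qed.

Lemma poly_zero_const_pts (G : {poly R}) :
  (forall a : K, G.[a%:MP] = 0) -> G = 0.
Proof.
move=> h; apply/polyP => c; rewrite coef0; apply: R_zero => A.
rewrite -(coef_map (meval (pt A))); suff -> : map_poly (meval (pt A)) G = 0 by rewrite coef0.
apply: poly_ext => x; rewrite horner0 -{1}(mevalC (pt A) x) horner_map h.
exact: meval0.
Qed.

Definition parallel (S : 'I_3 -> {poly R}) (s : 'I_3 -> P3) :=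
  forall k l, S k * tau e (s l) = S l * tau e (s k).

(** A representative [s] of least degree has no common factor, so a Bezout relation makes a scalar
    multiple of [S_i] divisible by [s_i(iota)], whose degree in [x] is [e k] for a suitable [i]. *)
Lemma minimal_direction (S : 'I_3 -> {poly R}) D :
  (exists i, S i != 0) -> (forall i, (size (S i) <= D.+1)%N) ->
  (exists s : 'I_3 -> P3, (exists i, s i != 0) /\ parallel S s) ->
  exists k (s : 'I_3 -> P3), [/\ exists i, msize (s i) = k.+1, forall i, (msize (s i) <= k.+1)%N,
    (e * k <= D)%N & parallel S s].
Proof.
move=> [m Sm] sizeS [s1 [s1n par1]].
pose Q k := `[< exists s : 'I_3 -> P3, [/\ exists i, s i != 0, forall i, (msize (s i) <= k.+1)%N & parallel S s] >].
have exQ : exists k, Q k.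
  exists (\max_i msize (s1 i))%N; apply/asboolP; exists s1; split=> // i.
  by apply: leq_trans (leqnSn _); apply: (leq_bigmax i).
case: (ex_minnP exQ) => k /asboolP[s [s0 hs pars]] mink.
have small (t : 'I_3 -> P3) : (exists i, t i != 0) -> (forall i, (msize (t i) <= k)%N) -> parallel S t -> False.
  case: k mink {hs} => [|k] mink [i ti] ht part.
    by have := ht i; rewrite leqn0 msize_poly_eq0 (negPf ti).
  suff /mink : Q k by rewrite ltnn.
  by apply/asboolP; exists t; split=> //; exists i.
have [i0 hi0] : exists i, msize (s i) = k.+1.
  apply: contrapT => /forallNP h; apply: (small s) => // i.
  by have := hs i; rewrite leq_eqVlt => /orP[/eqP /h|].
exists k, s; split=> //; first by exists i0.
have [h [r [r0 hr]]] : exists (h : 'I_3 -> {poly R}) (r : R), r != 0 /\ \sum_i h i * tau e (s i) = r%:P.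
  apply: tau_bezout => // g g0 hg; rewrite leqNgt; apply/negP => sg.
  have [t ht] := choice hg.
  apply: (small t).
  - have [i si] := s0; exists i; apply: contraNneq si => ti; by rewrite ht ti mul0r.
  - move=> i; have [->|ti] := eqVneq (t i) 0; first by rewrite msize0.
    have := hs i; rewrite ht msizeM //.
    by move: sg; move: (msize (t i)) (msize g) => x y; lia.
  move=> a b; have tg : tau e g != 0 by apply: contraNneq g0 => /tau_inj ->.
  apply: (mulIf tg); have := pars a b; rewrite (ht a) (ht b).
  have tM (p q : P3) : tau e (p * q) = tau e p * tau e q by apply: rmorphM.
  rewrite (tM (t a)) (tM (t b)) => e1; exact: etrans (esym (mulrA _ _ _)) (etrans e1 (mulrA _ _ _)).
have ti0 : tau e (s i0) != 0.
  apply/eqP => /tau_inj e0; by move: hi0; rewrite e0 msize0.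
have Si0 : S i0 != 0.
  apply: contraNneq Sm => e0; have := pars m i0; rewrite e0 mul0r => /eqP.
  by rewrite mulf_eq0 (negPf ti0) orbF.
have eS : r *: S i0 = (\sum_l h l * S l) * tau e (s i0).
  rewrite -mul_polyC -hr !mulr_suml; apply: eq_bigr => l _.
  exact: etrans (etrans (esym (mulrA _ _ _)) (congr1 ( *%R (h l)) (etrans (mulrC _ _) (esym (pars l i0)))))
    (mulrA _ _ _).
have q0 : \sum_l h l * S l != 0.
  apply: contraNneq Si0 => q0; move/eqP: eS; rewrite q0 mul0r -mul_polyC mulf_eq0.
  by rewrite polyC_eq0 (negPf r0).
have := sizeS i0; rewrite -(size_scale (S i0) r0) eS size_mul // (size_tau_eq hi0).
have : (0 < size (\sum_l h l * S l)%R)%N by rewrite size_poly_gt0.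
by move: (size _) => x; lia.
Qed.

Lemma syz_descends (S : 'I_3 -> {poly R}) s : syz S -> (exists i, S i != 0) ->
  parallel S s -> \sum_i s i * dF i = 0.
Proof.
move=> sS [k Sk] par; apply: (@tau_inj _ e); apply: (mulfI Sk).
rewrite mulr0 rmorph_sum mulr_sumr -[RHS](mulr0 (tau e (s k))) -[X in _ = _ * X](sS : \sum_i S i * ptl i = 0).
rewrite mulr_sumr; apply: eq_bigr => i _.
have tM (p q : P3) : tau e (p * q) = tau e p * tau e q by apply: rmorphM.
rewrite /= (tM (s i)).
exact: etrans (mulrA _ _ _) (etrans (f_equal2 _ (etrans (par k i) (mulrC _ _)) erefl) (esym (mulrA _ _ _))).
Qed.

Lemma homog_sum_eq0 n k l (p q : {mpoly K[n]}) : p \is k.-homog -> q \is l.-homog ->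
  k != l -> p + q = 0 -> p = 0 /\ q = 0.
Proof.
move=> hp hq ab e0; have eq : q = - p by apply/eqP; rewrite -addr_eq0 addrC e0.
suff p0 : p = 0 by rewrite eq p0 oppr0.
apply/eqP; apply: contraT => p0; case/eqP: ab; apply: (dhomog_uniq p0 hp).
by rewrite -[p]opprK -eq rpredN.
Qed.

Definition linear_form (M : 'M[K]_3) i : P3 := \sum_j M i j *: 'X_j.

Lemma linear_form_homog M i : linear_form M i \is 1.-homog.
Proof. by apply: rpred_sum => j _; apply: rpredZ; rewrite dhomogX /= mdeg1. Qed.

Lemma affine_split (s : 'I_3 -> P3) i : (msize (s i) <= 2)%N ->
  s i = linear_form (\matrix_(i, j) (s i)@_U_(j)) i + ((s i)@_0%MM)%:MP.
Proof.
move=> sz; apply/mpolyP => m; rewrite mcoeffD mcoeffC raddf_sum /=.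
under eq_bigr => j _ do rewrite mcoeffZ mcoeffX mxE.
have [->|m0] := eqVneq m 0%MM.
  by rewrite mulr1 big1 ?add0r // => j _; rewrite mnm1_eq0 mulr0.
rewrite mulr0 addr0; have [/mdeg1P[j /eqP ->]|nm] := boolP (mdeg m == 1%N).
  rewrite (bigD1 j) //= eqxx mulr1 big1 ?addr0 // => j' ne.
  by rewrite eq_mnm1 (negPf ne) mulr0.
rewrite memN_msupp_eq0 ?big1 // => [j _|].
  by case: eqP => [e1|_]; [case/eqP: nm; rewrite -e1 mdeg1|rewrite mulr0].
apply: msize_mdeg_ge; apply: leq_trans sz _.
by move: m0 nm; rewrite -mdeg_eq0; case: (mdeg m) => [|[]].
Qed.

(** * A syzygy of least degree along the universal curve *)

Section RankDrop.
Hypothesis H : forall A : M3, (\rank (diff_mx F A) < minn N (e * d).+1)%N.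

Lemma rank_op_ptl :
  (\rank (map_mx (@tofrac R) (op_mx ptl (e * d).+1 0)) < minn N (e * d).+1)%N.
Proof.
have [v hv] := generic_rank (op_mx ptl (e * d).+1 0).
apply: leq_ltn_trans hv _; have [A eA] := pt_surj v.
rewrite (_ : map_mx (meval v) _ = diff_mx F A) // -map_op_mx.
by apply/matrixP => k l; rewrite !mxE (meval_eq _ eA).
Qed.

Definition syz_deg D := `[< exists S : 'I_3 -> {poly R},
  [/\ syz S, exists i, S i != 0 & forall i, (size (S i) <= D.+1)%N] >].

Lemma minimal_syz : exists D S, [/\ syz S, exists i, S i != 0,
  forall i, (size (S i) <= D.+1)%N, (D <= e)%N &
  forall S', syz S' -> (forall i, (size (S' i) <= D)%N) -> forall i, S' i = 0].
Proof.
have ex0 : syz_deg e.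
  have [|a a0 ea] := @exists_left_kernel _ _ _ (op_mx ptl (e * d).+1 0).
    by apply: leq_trans rank_op_ptl _; apply: geq_minl.
  apply/asboolP; exists (triple a); split; first exact: syz_of_kernel.
    by apply: exists_neq0 => h; case/eqP: a0; apply: triple_eq0.
  exact: size_triple.
have exD : exists D, syz_deg D by exists e.
case: (ex_minnP exD) => D /asboolP[S [sS S0 hS]] minD.
exists D, S; split=> // [|S' sS' hS' i]; first exact: minD.
apply/eqP; apply: contraT => S'0.
case: D hS minD hS' => [|D] hS minD hS'.
  by have := hS' i; rewrite leqn0 size_poly_eq0 (negPf S'0).
have: syz_deg D by apply/asboolP; exists S'; split=> //; exists i.
by move/minD; rewrite ltnn.
Qed.

Section MinimalSyzygy.
Variables (D : nat) (S : 'I_3 -> {poly R}).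
Hypothesis sS : syz S.
Hypothesis S_neq0 : exists i, S i != 0.
Hypothesis size_S : forall i, (size (S i) <= D.+1)%N.
Hypothesis D_le : (D <= e)%N.
Hypothesis S_min : forall S', syz S' -> (forall i, (size (S' i) <= D)%N) -> forall i, S' i = 0.

Lemma S_top : exists i, size (S i) = D.+1.
Proof.
apply: contrapT => /forallNP h; case: S_neq0 => i /eqP; apply; apply: (S_min sS) => j.
by have := size_S j; rewrite leq_eqVlt => /orP[/eqP /h|].
Qed.

(* Counting: otherwise the syzygies A of degree at most e with f-multiple S x A
   zero and with top coefficients of A_i0 zero would be cut out by fewer than N
   equations, yet such a syzygy is a multiple of S of degree less than D. *)
Lemma syz_degree_gap : (D + e + 2 <= n)%N.
Proof.
rewrite leqNgt; apply/negP => lt_n.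
have [i0 si0] := S_top.
have [k0 fk0] := partial_exists.
(* Chosen so that [sum_i A_i phi_i] is the coordinate [k0] of [S x A]. *)
pose phi i := if i == k0 + 2%:R then S (k0 + 1) else
  if i == k0 + 1 then - S (k0 + 2%:R) else 0.
pose psi i : {poly R} := (i == i0)%:R.
(* [M1] imposes the vanishing of the coefficients [n, ..., D + e] of that coordinate, [M2] that of
   the coefficients [D, ..., e] of [A_i0]. As the syzygy condition has rank at most [e d = n + e],
   the total rank is at most [(n + e) + (D + e + 1 - n) + (e - D + 1) = 3 e + 2 < N]. *)
pose M1 := op_mx phi (D + e + 1 - n)%N n.
pose M2 := op_mx psi (e - D).+1 D.
pose M := row_mx (op_mx ptl (e * d).+1 0) (row_mx M1 M2).
have rM : (\rank (map_mx (@tofrac R) M) < N)%N.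
  rewrite /M !map_row_mx; apply: leq_ltn_trans (mxrank_row_mx _ _) _.
  have := rank_op_ptl; rewrite leq_min => /andP[_].
  have := leq_trans (mxrank_row_mx (map_mx (@tofrac R) M1) (map_mx (@tofrac R) M2))
     (leq_add (rank_leq_col _) (rank_leq_col _)).
  rewrite ed_eq; move: (\rank _) (\rank _) => x y; lia.
have [a a0 /eqP ea] := exists_left_kernel rM.
move: ea; rewrite /M !mul_mx_row !row_mx_eq0 => /and3P[/eqP e1 /eqP e2 /eqP e3].
pose A := triple a; have sA : syz A := syz_of_kernel e1.
have cA : \sum_i A i * phi i = cross S A k0.
  have [p0 p1 p2] : [/\ phi k0 = 0, phi (k0 + 1) = - S (k0 + 2%:R)
      & phi (k0 + 2%:R) = S (k0 + 1)].
    by rewrite /phi; case: (k0) => -[|[|[|?]]] ?.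
  rewrite (sum3 _ k0) p0 p1 p2 /cross; ring.
have X0 : forall j : 'I_3, cross S A j = 0.
  refine (@primitive_multiple (cross S A) k0 fk0 _ _).
    by move=> i j; apply: cross_parallel.
  apply/leq_sizeP => l ge; have [lt|ge'] := ltnP l (D + e).+1.
    have lt' : (l - n < D + e + 1 - n)%N by lia.
    have := op_mxE phi n a (Ordinal lt'); rewrite e2 mxE /= subnK // cA.
    by move=> <-.
  by have /leq_sizeP/(_ l ge') := size_cross k0 size_S (size_triple a).
have par := (cross_eq0 S A).1 X0.
have sAi0 : (size (A i0) <= D)%N.
  apply/leq_sizeP => l ge; have [lt|ge'] := ltnP l e.+1; last first.
    by have /leq_sizeP/(_ l ge') := size_triple a i0.
  have lt' : (l - D < (e - D).+1)%N by lia.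
  have := op_mxE psi D a (Ordinal lt'); rewrite e3 mxE /= subnK // (bigD1 i0) //= big1.
    by rewrite /psi eqxx mulr1 addr0 => <-.
  by move=> i ne; rewrite /psi (negPf ne) mulr0.
have Si0 : S i0 != 0 by rewrite -size_poly_eq0 si0.
have [j Aj] : exists j, A j != 0.
  by apply: exists_neq0 => h; case/eqP: a0; apply: triple_eq0.
case/eqP: Aj; apply: (S_min sA) => {}j.
have [->|Aj0] := eqVneq (A j) 0; first by rewrite size_poly0.
have Ai0 : A i0 != 0.
  apply: contraNneq Aj0 => e0; have /eqP := par i0 j.
  by rewrite e0 mulr0 mulf_eq0 (negPf Si0).
have Sj0 : S j != 0.
  apply: contraNneq Aj0 => e0; have /eqP := par i0 j.
  by rewrite e0 mul0r mulf_eq0 (negPf Si0).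
(* [A] is proportional to [S] and [S_i0] has full degree [D], so the drop in degree of [A_i0] below
   [D] spreads to every [A_j]. *)
have := congr1 (fun p : {poly R} => size p) (par i0 j); rewrite !size_mul // si0.
have := size_S j; have : (0 < size (S j))%N by rewrite size_poly_gt0.
move: sAi0; move: (size (A i0)) (size (A j)) (size (S j)) => x y z; lia.
Qed.

(** [S x T] has degree at most [2 D + 1 <= D + e + 1 < n], too small for a nonzero multiple of the
    gradient. *)
Lemma syz_parallel T : syz T -> (forall i, (size (T i) <= D.+2)%N) ->
  forall i j, S i * T j = S j * T i.
Proof.
move=> sT hT; apply/cross_eq0; have [k0 fk0] := partial_exists.
apply: (primitive_multiple (X := cross S T) fk0); first by move=> i j; apply: cross_parallel.
apply: leq_trans (size_cross k0 size_S hT) _.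
by have := syz_degree_gap; move: D_le; lia.
Qed.

(** The syzygy at [x = 0], that is at the point [iota(0)] with coordinates [u_i0]. The aim is that
    its direction does not depend on the other [u_ij]. *)
Definition S0 k : R := (S k)`_0.

Lemma size_map_deriv k (p : {poly R}) : (size (map_poly (mderiv k) p) <= size p)%N.
Proof. exact: size_poly. Qed.

(** The operator [d/du_i(j+1) - x d/du_ij] maps [S] to a syzygy of degree at most [D + 1], hence
    parallel to [S]. At [x = 0] its second term disappears. *)
Lemma S0_transport i (j : 'I_e) k l :
  S0 k * (S0 l)^`M(mxvec_index i (lift ord0 j)) = S0 l * (S0 k)^`M(mxvec_index i (lift ord0 j)).
Proof.
pose a := mxvec_index i (lift ord0 j); pose b := mxvec_index i (widen_ord (leqnSn e) j).
pose T k := map_poly (mderiv a) (S k) - 'X * map_poly (mderiv b) (S k).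
have dsum c : \sum_k (map_poly (mderiv c) (S k) * ptl k + S k * map_poly (mderiv c) (ptl k)) = 0.
  have := congr1 (map_poly (mderiv c)) sS; rewrite raddf0 raddf_sum => e0.
  rewrite -[RHS]e0; by apply: eq_bigr => m _; rewrite [RHS]mderiv_polyM.
have sT : syz T.
  have := dsum a; have := dsum b; rewrite !big_split /=.
  have -> : \sum_k S k * map_poly (mderiv a) (ptl k) =
      'X * \sum_k S k * map_poly (mderiv b) (ptl k).
    rewrite mulr_sumr; apply: eq_bigr => m _; rewrite !mderiv_tau /= exprS; ring.
  move=> eb ea; rewrite /syz /T.
  transitivity (\sum_k map_poly (mderiv a) (S k) * ptl k - 'X * \sum_k map_poly (mderiv b) (S k) * ptl k).
    by rewrite mulr_sumr -sumrB; apply: eq_bigr => m _; rewrite mulrBl mulrA.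
  move/eqP: eb; rewrite addr_eq0 => /eqP ->; rewrite mulrN opprK.
  exact: ea.
have zT m : (size (T m) <= D.+2)%N.
  apply: leq_trans (size_polyD _ _) _; rewrite size_polyN geq_max; apply/andP; split.
    by apply: leq_trans (size_map_deriv _ _) _; apply: leq_trans (size_S m) _.
  apply: leq_trans (size_polyMleq _ _) _; rewrite size_polyX add2n /= ltnS.
  by apply: leq_trans (size_map_deriv _ _) _.
have := congr1 (fun p : {poly R} => p`_0) (syz_parallel sT zT k l).
by rewrite !coef0M /T !coefB !coefXM !subr0 !coef_map.
Qed.

(** Otherwise [S] is divisible by [x], and the quotient is a syzygy of smaller degree. *)
Lemma S0_neq0 : exists k, S0 k != 0.
Proof.
apply: exists_neq0 => h; case: S_neq0 => i /eqP; apply.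
pose S' k := \poly_(l < D) (S k)`_l.+1.
have eS k : S k = S' k * 'X.
  apply/polyP => -[|l]; rewrite coefMX /=; first exact: h.
  rewrite coef_poly; case: ltnP => // le; by have /leq_sizeP/(_ l.+1 le) := size_S k.
rewrite eS S_min ?mul0r // => [|k]; last exact: size_poly.
have X0 : 'X != 0 :> {poly R} by rewrite -size_poly_eq0 size_polyX.
apply: (mulIf X0); rewrite mul0r -[RHS](sS : \sum_i S i * ptl i = 0) mulr_suml.
apply: eq_bigr => m _.
by rewrite eS mulrAC.
Qed.

(* Integrates [S0_transport] along the segment from [A] to [A']. *)
Lemma S0_direction (A A' : M3) k l : (forall i, A i ord0 = A' i ord0) ->
  (S0 k).@[pt A] * (S0 l).@[pt A'] = (S0 l).@[pt A] * (S0 k).@[pt A'].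
Proof.
move=> eA0; pose w (c : 'I_N) : {poly K} := (pt A c)%:P + (pt A' c - pt A c) *: 'X.
pose path k := mmap (@polyC K) w (S0 k).
have ev0 m : (path m).[0] = (S0 m).@[pt A].
  rewrite horner_mmap; apply: meval_eq => c.
  by rewrite /w hornerD hornerC hornerZ hornerX mulr0 addr0.
have ev1 m : (path m).[1] = (S0 m).@[pt A'].
  rewrite horner_mmap; apply: meval_eq => c.
  by rewrite /w hornerD hornerC hornerZ hornerX mulr1 addrC subrK.
rewrite -!ev0 -!ev1 [RHS]mulrC; apply: wronskian_zero.
rewrite !deriv_mmap !mulr_sumr; apply: eq_bigr => c _; rewrite !mulrA.
case/mxvec_indexP: c => i j; case: (unliftP ord0 j) => [j'|] ->.
  by congr (_ * _); rewrite /path -!rmorphM S0_transport.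
by rewrite /w !pt_index eA0 subrr scale0r addr0 derivC !mulr0.
Qed.

Lemma comp_shiftK (a : K) (p : {poly R}) :
  (p \Po ('X + (a%:MP)%:P)) \Po ('X - (a%:MP)%:P) = p.
Proof. by rewrite -comp_polyA comp_polyD comp_polyX comp_polyC subrK comp_polyXr. Qed.

(** Forming [S] for the curve [iota(x + a)] and translating back by [a] gives a syzygy along [iota]
    of the same degree, hence parallel to [S]. Its value at [x = a] is the value at 0 for the
    translated curve. *)
Lemma shifted_parallel (a : K) k l :
  (S k).[a%:MP] * shift_var a (S0 l) = (S l).[a%:MP] * shift_var a (S0 k).
Proof.
pose T k := map_poly (shift_var a) (S k) \Po ('X - (a%:MP)%:P).
have sT : syz T.
  rewrite /syz /T.
  transitivity (map_poly (shift_var a) (\sum_i S i * ptl i) \Po ('X - (a%:MP)%:P)).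
    rewrite rmorph_sum raddf_sum; apply: eq_bigr => i _ /=.
    rewrite rmorphM rmorphM /=; congr (_ * _).
    by rewrite [in RHS]/ptl shift_tau comp_shiftK.
  by rewrite sS rmorph0 comp_poly0.
have zT i : (size (T i) <= D.+2)%N.
  apply: leq_trans (size_comp_poly_leq _ _) _; rewrite size_XsubC muln1.
  have : (size (map_poly (shift_var a) (S i)) <= size (S i))%N := size_poly _ _.
  have := size_S i; move: (size _) (size _) => x y; lia.
have hT m : (T m).[a%:MP] = shift_var a (S0 m).
  by rewrite /T horner_comp hornerXsubC subrr horner_coef0 coef_map.
have e1 := congr1 (fun p : {poly R} => p.[a%:MP]) (syz_parallel sT zT k l).
have e2 := etrans (esym (hornerM (S k) (T l) a%:MP)) (etrans e1 (hornerM (S l) (T k) a%:MP)).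
exact: etrans (f_equal2 _ erefl (esym (hT l))) (etrans e2 (f_equal2 _ erefl (hT k))).
Qed.

(** Take for [s] the triple [S0] with the [u_i0] as variables and the other [u_ij] frozen at a
    matrix [B] where [S0] does not vanish. Then [S0] is parallel to [s(iota(0))]; translation by
    each constant [a] gives [S(a)] parallel to [s(iota(a))], and infinitely many [a] suffice. *)
Lemma direction_descends : exists s : 'I_3 -> P3,
  (exists i, s i != 0) /\ forall k l, S k * tau e (s l) = S l * tau e (s k).
Proof.
have [m Sm0] := S0_neq0.
have [B hB] := R_nonroot Sm0.
pose w (c : 'I_N) : P3 :=
  if (ixj c).2 == ord0 then 'X_((ixj c).1) else (pt B c)%:MP.
pose s k := mmap (@mpolyC 3 K) w (S0 k).
have es k v : (s k).@[v] = (S0 k).@[pt (\matrix_(i, j) if j == ord0 then v i else B i j)].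
  apply: etrans (meval_subst w (S0 k) v) _; apply: meval_eq => c.
  case/mxvec_indexP: c => i j; rewrite /w ixjE !pt_index mxE /=.
  by case: ifP => _; rewrite ?mevalXU ?mevalC.
have par0 k l : S0 k * tau0 e (s l) = S0 l * tau0 e (s k).
  apply/subr0_eq/R_zero => A.
  have et j : (tau0 e (s j)).@[pt A] =
      (S0 j).@[pt (\matrix_(i, j) if j == ord0 then A i ord0 else B i j)].
    rewrite -es; apply: etrans (meval_subst _ _ _) _; apply: meval_eq => i.
    by rewrite mevalXU pt_index.
  have e1 := S0_direction k l (A := A)
    (A' := \matrix_(i, j) if j == ord0 then A i ord0 else B i j).
  rewrite mevalB mevalM mevalM (et l) (et k) e1 ?subrr // => i.
  by rewrite mxE eqxx.
exists s; split.
  exists m; apply: contraNneq hB => e0; have := es m (fun i => B i ord0).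
  rewrite e0 meval0 => ->; apply/eqP; apply: meval_eq => c.
  by congr (pt _ c); apply/matrixP => i j; rewrite mxE; case: eqP => [->|].
move=> k l; apply: subr0_eq.
have vanish (a : K) : (S k).[a%:MP] * (tau e (s l)).[a%:MP] = (S l).[a%:MP] * (tau e (s k)).[a%:MP].
  have sh j : shift_var a (tau0 e (s j)) = (tau e (s j)).[a%:MP].
    transitivity (mmap (@mpolyC N K) (fun i => (gen K e i).[a%:MP]) (s j)).
      apply: mmap_morph => [c|i]; first by rewrite /= /shift_var mmapC.
      by rewrite /= /shift_var mmapXU ixjE -horner_coef0 horner_comp !hornerE.
    apply/esym; apply: (mmap_morph (phi := horner_eval a%:MP)) => [c|i //].
    by rewrite /= /horner_eval hornerC.
  have yz k' l' : shift_var a (S0 k') * (tau e (s l')).[a%:MP] =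
      shift_var a (S0 l') * (tau e (s k')).[a%:MP].
    have e1 := congr1 (shift_var a) (par0 k' l').
    have e2 := etrans (esym (shift_varM a (S0 k') (tau0 e (s l'))))
      (etrans e1 (shift_varM a (S0 l') (tau0 e (s k')))).
    exact: etrans (f_equal2 _ erefl (esym (sh l'))) (etrans e2 (f_equal2 _ erefl (sh k'))).
  have n0 : shift_var a (S0 m) != 0 by apply/eqP => /shift_var_inj/eqP; apply/negP.
  exact: (parallel_trans (x := fun k => (S k).[a%:MP]) n0 (shifted_parallel a) yz k l).
by apply: poly_zero_const_pts => a; apply: horner_minor; apply: vanish.
Qed.

End MinimalSyzygy.

End RankDrop.

Theorem syzygy_of_rank_drop :
  (forall A : M3, (\rank (diff_mx F A) < minn N (e * d).+1)%N) ->
  (exists c : 'I_3 -> K, [/\ exists i, c i != 0, \sum_i c i *: dF i = 0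
     & (e + 2 <= e * d.-1)%N]) \/
  (exists M : 'M[K]_3, [/\ M != 0, \sum_i linear_form M i * dF i = 0
     & (2 * e + 2 <= e * d.-1)%N]).
Proof.
move=> H; have [D [S [sS S0 sizeS De minS]]] := minimal_syz H.
have gap := syz_degree_gap H sS S0 sizeS De minS.
have desc := direction_descends H sS S0 sizeS De minS.
have [k [s [[i0 si0] hs ek pars]]] := minimal_direction S0 sizeS desc.
have ss := syz_descends sS S0 pars.
have k1 : (k <= 1)%N.
  rewrite leqNgt; apply/negP => lt; have : (e * 2 <= e * k)%N by rewrite leq_pmul2l.
  by move: ek De e_gt0; lia.
have dFh i : dF i \is d.-1.-homog by apply: mderiv_homog; apply: dhomog_is_dhomog.
case: k k1 si0 hs ek {pars} => [|[|//]] _ si0 hs ek.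
  left; exists (fun i => (s i)@_0%MM); split; last by lia.
    exists i0; apply/eqP => e0; move: si0; rewrite (msize1_polyC (hs i0)) e0.
    by rewrite mpolyC0 msize0.
  rewrite -[RHS]ss; apply: eq_bigr => i _.
  by rewrite -mul_mpolyC {2}(msize1_polyC (hs i)).
right; exists (\matrix_(i, j) (s i)@_U_(j)); split; last by lia.
  have : mdeg (mlead (s i0)) == 1%N.
    have s0 : s i0 != 0 by rewrite -msize_poly_eq0 si0.
    by have := mlead_deg s0; rewrite si0 => -[->].
  move=> /mdeg1P[j /eqP ej]; apply/eqP => /matrixP/(_ i0 j); rewrite !mxE -ej => /eqP.
  by rewrite mleadc_eq0 -msize_poly_eq0 si0.
set M := \matrix_(i, j) _.
(* [s] need not be homogeneous: its linear and constant parts contribute forms of degrees [d] and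
   [d - 1], which vanish separately. *)
have [] // := @homog_sum_eq0 3 (1 + d.-1) d.-1 (\sum_i linear_form M i * dF i)
  (\sum_i (s i)@_0%MM *: dF i).
- by apply: rpred_sum => i _; apply: dhomogM => //; apply: linear_form_homog.
- by apply: rpred_sum => i _; apply: rpredZ.
- by rewrite add1n neq_ltn ltnSn orbT.
rewrite -big_split /= -[RHS]ss; apply: eq_bigr => i _.
by rewrite [in RHS](affine_split (hs i)) mulrDl mul_mpolyC.
Qed.

(** The multiples of the constant syzygy by [1, x, ..., x^e] are [e + 1] independent elements of the
    left kernel. *)
Lemma constant_syzygy_rank (c : 'I_3 -> K) (A : M3) :
  (exists i, c i != 0) -> \sum_i c i *: dF i = 0 ->
  (\rank (diff_mx F A) <= 2 * e.+1)%N.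
Proof.
move=> [i0 ci0] hc.
pose B : 'M[K]_(e.+1, N) := \matrix_(j, k) (c (ixj k).1 * ((ixj k).2 == j)%:R).
have BD : B *m diff_mx F A = 0.
  apply/matrixP => j l; rewrite !mxE sum_mxvec.
  have := congr1 (fun P => ('X^j * ev A P)`_l) hc; rewrite raddf0 mulr0 coef0 => e0.
  rewrite -[RHS]e0 rmorph_sum mulr_sumr coef_sum; apply: eq_bigr => i _ /=.
  rewrite (bigD1 j) //= big1 ?addr0 => [|j' ne].
    rewrite mxE ixjE eqxx mulr1 diff_mxE -mul_mpolyC (rmorphM (ev A)) /=.
    by rewrite [ev A _%:MP]mmapC mulrCA coefCM.
  by rewrite mxE ixjE (negPf ne) mulr0 mul0r.
have rB : \rank B = e.+1.
  apply/eqP/inj_row_free => v vB; apply/rowP => j; rewrite mxE.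
  have /rowP/(_ (mxvec_index i0 j)) := vB; rewrite !mxE (bigD1 j) //= big1 ?addr0 => [|j' ne].
    by rewrite mxE ixjE eqxx mulr1 => /eqP; rewrite mulf_eq0 (negPf ci0) orbF => /eqP.
  by rewrite mxE ixjE eq_sym (negPf ne) !mulr0.
have := mulmx0_rank_max BD; rewrite rB.
by move: (\rank _) => r; lia.
Qed.

(** [M(iota)] is a kernel vector, but it may vanish for a particular [A]. The argument is therefore
    made over [R]: full row rank at a single [A] would force the universal kernel vector to be zero,
    whence [M = 0]. *)
Lemma linear_syzygy_rank (M : 'M[K]_3) (A : M3) :
  M != 0 -> \sum_i linear_form M i * dF i = 0 -> (\rank (diff_mx F A) < N)%N.
Proof.
move=> M0 hM; rewrite ltn_neqAle rank_leq_row andbT; apply: contra M0 => rk.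
pose a : 'rV[R]_N := \row_k \sum_l (M (ixj k).1 l)%:MP * 'X_(mxvec_index l (ixj k).2).
have ta i : triple a i = tau e (linear_form M i).
  rewrite /linear_form rmorph_sum /triple.
  have -> : row i (vec_mx a) = \sum_l (M i l)%:MP *: \row_j 'X_(mxvec_index l j).
    apply/rowP => j; rewrite summxE !mxE ixjE; apply: eq_bigr => l _.
    by rewrite !mxE.
  rewrite linear_sum; apply: eq_bigr => l _; rewrite linearZ /= -mul_mpolyC.
  by rewrite (rmorphM (tau e)) /= tauX tauC mul_polyC.
have a0 : a = 0.
  apply: (kernel_row_free_at (J := op_mx ptl (e * d).+1 0) (c := pt A)).
    by rewrite map_op_mx.
  apply/rowP => l; rewrite op_mxE mxE.
  suff -> : \sum_i triple a i * ptl i = 0 by rewrite coef0.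
  rewrite -[RHS](raddf0 (tau e)) -[X in _ = _ X]hM raddf_sum; apply: eq_bigr => i _.
  by rewrite /= (rmorphM (tau e)) /= ta.
apply/eqP/matrixP => i l; rewrite mxE.
have : tau e (linear_form M i) = 0 by rewrite -ta a0 /triple !linear0.
move=> /tau_inj /(congr1 (mcoeff U_(l)%MM)); rewrite mcoeff0 raddf_sum /= (bigD1 l) //=.
rewrite mcoeffZ mcoeffX eqxx mulr1 big1 ?addr0 // => j ne.
by rewrite mcoeffZ mcoeffX eq_mnm1 (negPf ne) mulr0.
Qed.

Definition const_syzygy : Prop :=
  exists c : 'I_3 -> K, (exists i, c i != 0) /\ \sum_i c i *: dF i = 0.

Definition lin_syzygy : Prop :=
  exists M : 'M[K]_3, M != 0 /\ \sum_i linear_form M i * dF i = 0.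

(** With [e d = n + e], the two inequalities say exactly that the bounds [2 (e + 1)] and [N - 1] on
    the rank lie below [minn N (e * d).+1]. *)
Theorem nonmaximal_rank_iff : ~ maximal_rank e F <->
  (const_syzygy /\ (e + 2 <= e * d.-1)%N) \/ (lin_syzygy /\ (2 * e + 2 <= e * d.-1)%N).
Proof.
have F0 : F != 0 by case: F_red.
rewrite (maximal_rank_diff e d_gt0 F0); split=> [nmax|].
  have [A|[c [c0 hc h]]|[M [M0 hM h]]] := syzygy_of_rank_drop.
  - by rewrite ltnNge; apply/negP => hA; apply: nmax; exists A.
  - by left; split=> //; exists c.
  - by right; split=> //; exists M.
move=> [[[c [c0 hc]] h]|[[M [M0 hM]] h]] [A].
  have := constant_syzygy_rank A c0 hc; move: (\rank _) => r.
  by rewrite geq_min ed_eq; lia.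
have := linear_syzygy_rank A M0 hM; move: (\rank _) => r.
by rewrite geq_min ed_eq; lia.
Qed.

End SyzygiesAlongCurves.

(** * Reduced forms and cones *)

Lemma meval_row (R : comNzRingType) n (v : 'I_n -> R) (P : {mpoly R[n]}) :
  P.@[(\row_i v i) 0] = P.@[v].
Proof. by apply: meval_eq => i; rewrite mxE. Qed.

Lemma row_coord_neq0 (K : nzRingType) n (v : 'rV[K]_n) : v != 0 -> exists j, v 0 j != 0.
Proof.
move=> v0; apply: exists_neq0 => h; case/eqP: v0.
by apply/rowP => i; rewrite h mxE.
Qed.

Section ReducedForms.
Variables (K : numClosedFieldType) (d : nat) (F : dhomog 3 K d).
Hypothesis d_gt0 : (0 < d)%N.
Hypothesis F_red : reduced_form F.
Local Notation P3 := {mpoly K[3]}.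
Local Notation N := (3 * 2)%N.
Local Notation R := {mpoly K[N]}.
Local Notation M3 := 'M[K]_(3, 2).
Local Notation dF i := ((F : P3)^`M(i)).
Local Notation U i j := ('X_(mxvec_index (i : 'I_3) (j : 'I_2)) : R).
Local Notation tau := (@tau K 1).
Local Notation polyMP := (polyC \o @mpolyC (3 * 2) K).

Lemma ev_coef0 e (A : 'M[K]_(3, e.+1)) P : (ev A P)`_0 = P.@[fun i => A i ord0].
Proof.
rewrite -horner_coef0 horner_ev; apply: meval_eq => i.
by rewrite horner_coef0 /line (coef_rVpoly_ord _ ord0) mxE.
Qed.

Lemma ev_coef_top e k (P : dhomog 3 K k) (A : 'M[K]_(3, e.+1)) :
  (ev A P)`_(e * k) = (P : P3).@[fun i => A i ord_max].
Proof.
pose s (i : 'I_2) : K := (i == ord0)%:R.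
have := congr1 (meval s) (pullback_form_of P A); rewrite /= meval_homog_of_infty //.
rewrite expr1n mulr1 => <-; rewrite comp_mpoly_meval; apply: meval_eq => i.
rewrite tnth_mktuple ffunE /= meval_homog_of_infty // expr1n mulr1.
by rewrite /line (coef_rVpoly_ord _ ord_max) mxE.
Qed.

Lemma gen1 i : gen K 1 i = (U i ord0)%:P + (U i ord_max)%:P * 'X.
Proof.
rewrite gen_split big_ord1 expr1; congr (_ + (U i _)%:P * _); exact: val_inj.
Qed.

Lemma deriv_tau1 P : (tau P)^`() = \sum_i (U i ord_max)%:P * tau P^`M(i).
Proof.
rewrite (@mmap_derivation _ _ _ polyMP (gen K 1) (@deriv R)).
- apply: eq_bigr => i _; rewrite gen1 derivD derivM !derivC derivX mul0r !add0r mulr1.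
  exact: mulrC.
- exact: derivD.
- exact: derivM.
by move=> c; exact: derivC.
Qed.

(** On the universal line ([e = 1]), a common divisor of the restriction of [F] and of its
    derivative is some [gg(iota)]. The derivative is [sum_i u_i1 F_i(iota)]; after the shear,
    putting [u_k1 = (k == i)] shows that [gg] divides [F_i]. *)
Lemma tau1_coprime_deriv : exists h1 h2 r, r != 0 /\
  h1 * tau F + h2 * (tau F)^`() = r%:P.
Proof.
have [F0 _] := F_red.
have F0' : (F : P3) != 0.
  by apply: contraNneq F0 => e0; apply/eqP/val_inj.
pose g (i : 'I_2) := if i == ord0 then tau F else (tau F)^`().
have [|G hG|h [r [r0 hr]]] := @coprime_bezout _ (@mpoly_factorial K N) 2 g.
- by exists ord0; apply/eqP => /tau_inj/eqP; apply/negP.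
- have [gg eG dg] := tau_divisor F0' (hG ord0).
  have [H eH] := hG ord_max; rewrite /g /= in eH.
  have e1 : (\sum_i U i ord_max * tau0 1 (dF i))%:P = shear_poly (-1) H * (tau0 1 gg)%:P.
    rewrite -shear_tau -eG -rmorphM -eH deriv_tau1 !rmorph_sum; apply: eq_bigr => i _.
    by rewrite /= polyCM [RHS]rmorphM /= shear_tau shear_U.
  have dg' i : divides gg (dF i).
    pose rho : {rmorphism R -> P3} := mmap (@mpolyC 3 K)
      (fun k => if (ixj k).2 == ord0 then 'X_((ixj k).1) else ((ixj k).1 == i)%:R).
    have rho0 Q : rho (tau0 1 Q) = Q.
      rewrite -[RHS]mmap_var; apply: mmap_morph => [c|j]; first by rewrite /= mmapC.
      by rewrite /= mmapXU ixjE.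
    exists (rho (shear_poly (-1) H)`_0).
    have := congr1 (fun p : {poly R} => rho p`_0) e1.
    rewrite coefC coefMC /= rmorphM rho0 => <-.
    rewrite rmorph_sum (bigD1 i) //= big1 ?addr0 => [|j ne].
      by rewrite rmorphM rho0 /= mmapXU ixjE /= eqxx mul1r.
    by rewrite rmorphM /= mmapXU ixjE /= (negPf ne) mul0r.
  have gg0 : gg != 0.
    by apply: contraNneq F0' => e0; case: dg => k ->; rewrite e0 mulr0.
  rewrite eG (msize1_polyC (partials_coprime d_gt0 F_red dg' gg0)) tauC.
  by rewrite size_polyC_leq1.
exists (h ord0), (h ord_max), r; split=> //; rewrite -hr big_ord_recl big_ord1.
by rewrite (_ : lift ord0 ord0 = ord_max); last exact: val_inj.
Qed.

(** A general line meets the curve in [d] distinct points, all in the affine chart, since the point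
    at infinity, the last column of [A], is off the curve. *)
Lemma simple_line : exists r : R, r != 0 /\ forall A : M3, r.@[pt A] != 0 ->
  (F : P3).@[fun i => A i ord_max] != 0 /\ coprimep (ev A F) (ev A F)^`().
Proof.
have [h1 [h2 [r [r0 hr]]]] := tau1_coprime_deriv.
have [F0 _] := F_red.
pose t1 := subst (fun i : 'I_3 => U i ord_max) F.
have t1E (A : M3) : t1.@[pt A] = (F : P3).@[fun i => A i ord_max].
  by rewrite meval_subst; apply: meval_eq => i; rewrite mevalXU pt_index.
have t10 : t1 != 0.
  apply: contraNneq F0 => e0; apply/eqP/val_inj/mpoly_zero => v.
  have := t1E (\matrix_(i, j) v i); rewrite e0 meval0 => e1; apply: etrans (esym e1).
  by apply: meval_eq => i; rewrite mxE.
exists (r * t1); split=> [|A]; first by rewrite mulf_neq0.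
rewrite mevalM mulf_eq0 negb_or t1E => /andP[rA fA]; split=> //.
apply/Bezout_eq1_coprimepP.
pose m := map_poly (meval (pt A)).
exists ((r.@[pt A])^-1 *: m h1, (r.@[pt A])^-1 *: m h2) => /=.
rewrite -!scalerAl -scalerDr -ev_tau deriv_map -!rmorphM -rmorphD /= hr map_polyC /=.
by rewrite -mul_polyC -polyCM mulVf.
Qed.

Lemma simple_roots (f : {poly K}) : f != 0 -> coprimep f f^`() ->
  exists2 rs, uniq rs & f = lead_coef f *: \prod_(z <- rs) ('X - z%:P).
Proof.
move=> f0 sep; have [rs ers] := closed_field_poly_normal f; exists rs => //.
rewrite -separable_prod_XsubC separable_poly.unlock.
have -> : \prod_(z <- rs) ('X - z%:P) = (lead_coef f)^-1 *: f.
  by rewrite {2}ers scalerA mulVf ?scale1r ?lead_coef_eq0.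
by rewrite derivZ coprimepZl ?coprimepZr ?invr_eq0 ?lead_coef_eq0.
Qed.

Lemma all_roots_dvdp (f p : {poly K}) : f != 0 -> coprimep f f^`() ->
  (forall x, root f x -> root p x) -> f %| p.
Proof.
move=> f0 sep hr; have [rs urs ers] := simple_roots f0 sep.
rewrite ers dvdpZl ?lead_coef_eq0 //; apply: uniq_roots_dvdp.
  apply/allP => x xs; apply: hr; rewrite ers rootZ ?lead_coef_eq0 //.
  by rewrite root_prod_XsubC.
by rewrite uniq_rootsE.
Qed.

Lemma size_evF1 (A : M3) : (F : P3).@[fun i => A i ord_max] != 0 ->
  size (ev A F) = d.+1.
Proof.
move=> h; apply/eqP; rewrite eqn_leq; apply/andP; split.
  by have := size_evF F A; rewrite mul1n.
rewrite ltnNge; apply: contra h => /leq_sizeP/(_ d (leqnn _)) e0.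
by rewrite -ev_coef_top mul1n e0.
Qed.

(** On a general line [F] has [d] simple zeros, all zeros of [P], so there [P] is a constant
    multiple of [F]. Comparing the extreme coefficients gives [P(p) F(q) = P(q) F(p)] for general,
    hence for all points [p], [q]. *)
Theorem form_nullstellensatz (P : dhomog 3 K d) :
  (forall v, (F : P3).@[v] = 0 -> (P : P3).@[v] = 0) ->
  exists c, (P : P3) = c *: (F : P3).
Proof.
move=> hP; have [r [r0 hr]] := simple_line; have [F0 _] := F_red.
have [t0 t0E] : exists t0 : P3 -> R, forall (A : M3) Q,
    (t0 Q).@[pt A] = Q.@[fun i => A i ord0].
  exists (subst (fun i : 'I_3 => U i ord0)) => A Q.
  by rewrite meval_subst; apply: meval_eq => i; rewrite mevalXU pt_index.
have [t1 t1E] : exists t1 : P3 -> R, forall (A : M3) Q,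
    (t1 Q).@[pt A] = Q.@[fun i => A i ord_max].
  exists (subst (fun i : 'I_3 => U i ord_max)) => A Q.
  by rewrite meval_subst; apply: meval_eq => i; rewrite mevalXU pt_index.
have id0 : r * (t0 P * t1 F - t1 P * t0 F) = 0.
  apply: R_zero => A; rewrite mevalM; have [->|rA] := eqVneq r.@[pt A] 0.
    by rewrite mul0r.
  have [qA cA] := hr A rA; have sA := size_evF1 qA.
  have f0 : ev A F != 0 by rewrite -size_poly_eq0 sA.
  have /dvdpP[k ek] : ev A F %| ev A P.
    apply: all_roots_dvdp => // x; rewrite /root !horner_ev => /eqP/hP ->; exact: eqxx.
  have sk : (size k <= 1)%N.
    have [->|k0] := eqVneq k 0; first by rewrite size_poly0.
    have := size_evF P A; rewrite mul1n ek size_mul // sA; move: (size k) => x; lia.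
  have ec j : (ev A P)`_j = k`_0 * (ev A F)`_j by rewrite ek {1}(size1_polyC sk) coefCM.
  rewrite mevalB !mevalM !t0E !t1E -!ev_coef0 -!ev_coef_top !ec; ring.
have {}id0 : t0 P * t1 F = t1 P * t0 F.
  by move/eqP: id0; rewrite mulf_eq0 (negPf r0) subr_eq0 => /eqP.
have F0' : (F : P3) != 0.
  by apply: contraNneq F0 => e0; apply/eqP/val_inj.
have [q hq] := mpoly_nonroot F0'.
exists ((P : P3).@[q] / (F : P3).@[q]).
apply/subr0_eq/mpoly_zero => v.
pose A : M3 := \matrix_(i, j) if j == ord0 then v i else q i.
have := congr1 (meval (pt A)) id0; rewrite !mevalM !t0E !t1E.
have e0 Q : Q.@[fun i => A i ord0] = Q.@[v] by apply: meval_eq => i; rewrite mxE.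
have e1 Q : Q.@[fun i => A i ord_max] = Q.@[q] by apply: meval_eq => i; rewrite mxE.
rewrite !e0 !e1 mevalB mevalZ => e2; apply/eqP; rewrite subr_eq0; apply/eqP.
by rewrite mulrAC -e2 mulfK.
Qed.

Local Notation Fv v := ((F : P3).@[(v : 'rV[K]_3) 0]).

Lemma meval_form_scale k (P : P3) (a : K) (v : 'rV[K]_3) : P \is k.-homog ->
  P.@[(a *: v) 0] = a ^+ k * P.@[v 0].
Proof.
by move=> hP; rewrite -(meval_homog _ _ hP); apply: meval_eq => i; rewrite mxE.
Qed.

Lemma FvZ a v : Fv (a *: v) = a ^+ d * Fv v.
Proof. exact: meval_form_scale (dhomog_is_dhomog F). Qed.

Lemma Fv0 : Fv 0 = 0.
Proof. by rewrite -(scale0r 0) FvZ expr0n gtn_eqF // mul0r. Qed.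

Lemma curve_class (p : projective 'rV[K]_3) v : is_class p v -> curve F p <-> Fv v = 0.
Proof.
move=> hv; split=> [[w hw Fw]|]; last by exists v.
have /vlineP[a ->] : v \in <[w]>%VS by rewrite -hw hv memv_line.
by rewrite FvZ Fw mulr0.
Qed.

Lemma class_neq0 (V : vectType K) (p : projective V) v : is_class p v -> v != 0.
Proof.
move=> hp; apply/eqP => v0; case: p hp => W hW; rewrite /is_class /= v0 => eW.
by move: hW; rewrite eW dim_vline eqxx.
Qed.

Lemma class_of (V : vectType K) (p : projective V) : exists v, is_class p v.
Proof.
case: p => W hW; exists (vpick W); rewrite /is_class /=.
apply/esym/eqP; rewrite eqEdim (eqP hW) -memvE memv_pick dim_vline.
by rewrite vpick0 -dimv_eq0 (eqP hW).
Qed.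

Definition on_line (v w : 'rV[K]_3) (P : P3) : {poly K} :=
  mmap (@polyC K) (fun i => (v 0 i)%:P + (w 0 i)%:P * 'X) P.

Lemma horner_on_line v w P x : (on_line v w P).[x] = P.@[(v + x *: w) 0].
Proof.
rewrite horner_mmap; apply: meval_eq => i.
by rewrite hornerD hornerM !hornerC hornerX !mxE mulrC.
Qed.

Lemma deriv_on_line v w P :
  (on_line v w P)^`() = \sum_i (w 0 i)%:P * on_line v w P^`M(i).
Proof.
rewrite deriv_mmap; apply: eq_bigr => i _; rewrite derivD derivM !derivC derivX.
by rewrite mul0r !add0r mulr1 mulrC.
Qed.

(** The derivative [DF] of [F] towards the common point [c] vanishes on the curve, since a point of
    the curve stays on it when moved towards [c]. *)
Lemma lines_const_syzygy n : union_of_concurrent_lines n (curve F) -> const_syzygy F.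
Proof.
move=> [L [_ _ [p hp] hL]]; have [c hc] := class_of p.
have c0 := class_neq0 hc.
pose DF : P3 := \sum_i c 0 i *: dF i.
have hDF : DF \is d.-1.-homog.
  by apply: rpred_sum => i _; apply: rpredZ; apply: mderiv_homog; apply: dhomog_is_dhomog.
have van (v : 'rV[K]_3) : v != 0 -> Fv v = 0 -> DF.@[v 0] = 0.
  move=> v0 Fv0'; have [q hq] := class_exists v0.
  have /hL[i qL] : curve F q by apply/(curve_class hq).
  have cL : c \in L i by have := hp i; rewrite hc -memvE.
  have vL : v \in L i by move: qL; rewrite hq -memvE.
  have zero : on_line v c F = 0.
    apply: poly_ext => t; rewrite horner0 horner_on_line.
    have [->|w0] := eqVneq (v + t *: c) 0; first exact: Fv0.
    have [q' hq'] := class_exists w0; apply/(curve_class hq')/hL; exists i.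
    by rewrite hq' -memvE memvD ?memvZ.
  have := congr1 (fun p : {poly K} => p^`().[0]) zero.
  rewrite /= deriv0 horner0 deriv_on_line horner_sum => e0; rewrite -[RHS]e0.
  rewrite raddf_sum; apply: eq_bigr => j _ /=.
  by rewrite mevalZ hornerM hornerC horner_on_line scale0r addr0.
(* Multiplication by a variable brings [DF] to degree [d], where it must be a multiple of [F]. Two
   different variables give incompatible multiples unless [DF = 0]. *)
have hX l : 'X_l * DF \is d.-homog.
  suff : 'X_l * DF \is (1 + d.-1).-homog by rewrite add1n prednK.
  by apply: dhomogM => //; rewrite dhomogX /= mdeg1.
have mult l : exists a, 'X_l * DF = a *: (F : P3).
  have [|a ea] := form_nullstellensatz (P := DHomog (hX l)).
    move=> v Fv'; rewrite /= mevalM mevalXU; pose w : 'rV[K]_3 := \row_i v i.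
    have [w0|w0] := eqVneq w 0; first by have := congr1 (fun m : 'rV_3 => m 0 l) w0; rewrite !mxE => ->; rewrite mul0r.
    by rewrite -(meval_row v DF) van ?mulr0 // meval_row.
  by exists a.
exists (fun i => c 0 i); split.
  exact: row_coord_neq0.
have [a0 e0] := mult ord0; have [a1 e1] := mult ord_max.
apply/eqP; apply: contraT => DF0.
have : a1%:MP * 'X_ord0 - a0%:MP * 'X_ord_max = 0 :> P3.
  apply: (mulIf DF0); rewrite mul0r mulrBl -!mulrA e0 e1 !mul_mpolyC !scalerA.
  by rewrite mulrC subrr.
move=> /(congr1 (mcoeff U_(ord_max)%MM)); rewrite mcoeffB !mul_mpolyC !mcoeffZ !mcoeffX.
rewrite !eq_mnm1 /= mulr0 mulr1 sub0r mcoeff0 => /eqP; rewrite oppr_eq0 => /eqP a00.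
move: e0; rewrite a00 scale0r => /eqP; rewrite mulf_eq0 (negPf DF0) orbF.
by rewrite -msupp_eq0 msuppX.
Qed.

(** [F] is invariant under translation by [c], so the curve is the cone with vertex [c] over its [d]
    points on a general line through [p] and [q]. *)
Lemma const_syzygy_lines : (1 < d)%N -> const_syzygy F ->
  union_of_concurrent_lines d (curve F).
Proof.
move=> d1 [cf [[i0 ci0] hc]]; pose c : 'rV[K]_3 := \row_i cf i.
have c0 : c != 0 by apply: contraNneq ci0 => /rowP/(_ i0); rewrite !mxE => ->.
have inv v t : Fv (v + t *: c) = Fv v.
  have : (on_line v c F)^`() = 0.
    rewrite deriv_on_line -[RHS](raddf0 (mmap (@polyC K) (fun i => (v 0 i)%:P + (c 0 i)%:P * 'X))).
    rewrite -hc raddf_sum; apply: eq_bigr => i _; rewrite /= mmapZ /c mxE //.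
  move=> /deriv_eq0_const eC; rewrite -horner_on_line eC hornerC.
  by rewrite -horner_coef0 horner_on_line scale0r addr0.
have [r [r0 hr]] := simple_line.
have [A rA] := R_nonroot r0; have [qA cA] := hr A rA.
pose p : 'rV[K]_3 := \row_i A i ord0; pose q : 'rV[K]_3 := \row_i A i ord_max.
have eA P : ev A P = on_line p q P.
  apply: poly_ext => x; rewrite horner_ev horner_on_line; apply: meval_eq => i.
  rewrite -map_gen gen1 rmorphD rmorphM /= map_polyX !map_polyC /= !mevalXU !pt_index.
  by rewrite hornerD hornerM !hornerC hornerX !mxE mulrC.
have sf := size_evF1 qA; set f := ev A F in cA sf.
have f0 : f != 0 by rewrite -size_poly_eq0 sf.
(* A relation between [c], [p], [q] makes [b p + g q] annihilate the restriction [f] of [F], that is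
   [b d f = (b x - g) f']. As [f] is coprime to [f'], it divides [b x - g], of degree less than
   [d]. *)
have ind a b g : a *: c + b *: p + g *: q = 0 -> [/\ a = 0, b = 0 & g = 0].
  move=> rel.
  have rel0 : \sum_i (b *: p + g *: q) 0 i *: ev A (dF i) = 0.
    have -> : b *: p + g *: q = - (a *: c) by apply/eqP; rewrite -addr_eq0 addrC addrA rel.
    have := congr1 (ev A) hc; rewrite raddf_sum rmorph0 => e0.
    rewrite -[RHS](scaler0 _ (- a)) -[X in _ = _ *: X]e0 scaler_sumr; apply: eq_bigr => i _.
    by rewrite /= -mul_mpolyC (rmorphM (ev A)) /= [ev A _%:MP]mmapC mul_polyC scalerA !mxE mulNr.
  have df : f^`() = \sum_i q 0 i *: ev A (dF i).
    by rewrite /f eA deriv_on_line; apply: eq_bigr => i _; rewrite mul_polyC eA.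
  have ef : \sum_i p 0 i *: ev A (dF i) = f *+ d - 'X * f^`().
    have := congr1 (ev A) (euler_identity (dhomog_is_dhomog F)).
    rewrite raddf_sum raddfMn /= => <-; rewrite df mulr_sumr -sumrB; apply: eq_bigr => i _.
    rewrite (rmorphM (ev A)) /= [ev A 'X_i]mmapXU -map_gen gen1 rmorphD rmorphM /= map_polyX !map_polyC /=.
    rewrite !mevalXU !pt_index mulrDl -mulrA -!mul_polyC !mxE; ring.
  have key : f * (b *+ d)%:P = (b *: 'X - g%:P) * f^`().
    apply: subr0_eq.
    transitivity (b *: (\sum_i p 0 i *: ev A (dF i)) + g *: (\sum_i q 0 i *: ev A (dF i))).
      by rewrite ef -df -!mul_polyC polyCMn; ring.
    rewrite -[RHS]rel0 !scaler_sumr -big_split /=; apply: eq_bigr => i _.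
    by rewrite !scalerA -scalerDl !mxE.
  have /dvdp_leq : f %| b *: 'X - g%:P.
    by rewrite -(Gauss_dvdpl _ cA) -key dvdp_mulr.
  have [e0 _|n0 /(_ isT)] := eqVneq (b *: 'X - g%:P) 0; last first.
    rewrite sf => lt; have : (size (b *: 'X - g%:P)%R <= 2)%N.
      apply: leq_trans (size_polyD _ _) _; rewrite geq_max size_polyN.
      rewrite (leq_trans (size_scale_leq _ _)) ?size_polyX //=.
      by rewrite (leq_trans (size_polyC_leq1 _)).
    by move/(leq_trans lt); rewrite ltnS leqNgt d1.
  have b0 : b = 0.
    by have := congr1 (fun p : {poly K} => p`_1) e0; rewrite coefB coefZ coefX coefC mulr1 subr0 coef0.
  have g0 : g = 0.
    have := congr1 (fun p : {poly K} => p`_0) e0.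
    by rewrite coefB coefZ coefX coefC mulr0 sub0r coef0 => /eqP; rewrite oppr_eq0 => /eqP.
  split=> //; move: rel; rewrite b0 g0 !scale0r !addr0 => /eqP.
  by rewrite scaler_eq0 (negPf c0) orbF => /eqP.
have span v : exists a b g, v = a *: c + b *: p + g *: q.
  pose bs (i : 'I_3) := if i == 0 then c else if i == 1 then p else q.
  pose B := \matrix_i bs i.
  have eB w : w *m B = w 0 0 *: c + w 0 1 *: p + w 0 2%:R *: q.
    by rewrite mulmx_sum_row (sum3 _ 0) !rowK !add0r.
  have uB : B \in unitmx.
    rewrite -row_free_unit; apply/inj_row_free => w; rewrite eB => /ind[w0 w1 w2].
    by apply/rowP => i; rewrite mxE; have [->|->|->] := ord3_cases i 0; rewrite ?add0r.
  by exists ((v *m invmx B) 0 0), ((v *m invmx B) 0 1), ((v *m invmx B) 0 2%:R); rewrite -eB mulmxKV.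
have [rs urs ers] := simple_roots f0 cA.
have srs : size rs = d.
  by have := sf; rewrite ers size_scale ?lead_coef_eq0 // size_prod_XsubC => -[].
have froot x : (f.[x] == 0) = (x \in rs).
  by rewrite -/(root f x) ers rootZ ?lead_coef_eq0 // root_prod_XsubC.
have fE x : f.[x] = Fv (p + x *: q) by rewrite /f eA horner_on_line.
pose L (i : 'I_d) := (<[c]> + <[p + rs`_i *: q]>)%VS.
have memL i v : v \in L i -> exists s t, v = s *: c + t *: (p + rs`_i *: q).
  by move=> /memv_addP[_ /vlineP[s ->] [_ /vlineP[t ->] ->]]; exists s, t.
have cL i : c \in L i by rewrite (subvP (addvSl _ _)) ?memv_line.
have wL (i : 'I_d) : p + rs`_i *: q \in L i by rewrite (subvP (addvSr _ _)) ?memv_line.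
have qL i : q \notin L i.
  apply/negP => /memL[s [t e0]]; have [] := ind s t (t * rs`_i - 1).
    by rewrite scalerBl scale1r -scalerA addrA -[s *: c + t *: p + _]addrA -scalerDr -e0 subrr.
  by move=> _ -> /eqP; rewrite mul0r sub0r oppr_eq0 oner_eq0.
exists L; split.
- move=> i j eL; suff /eqP er : rs`_i - rs`_j == 0.
    apply/val_inj/eqP; rewrite -(nth_uniq 0 _ _ urs) ?srs ?ltn_ord //.
    by rewrite -subr_eq0 er.
  apply: contraT => ne; case/negP: (qL i).
  have : (rs`_i - rs`_j) *: q \in L i.
    have -> : (rs`_i - rs`_j) *: q = (p + rs`_i *: q) - (p + rs`_j *: q).
      by rewrite opprD addrACA subrr add0r scalerBl.
    by rewrite memvB // eL.
  by rewrite rpredZeq (negPf ne).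
- move=> i; have w0 : p + rs`_i *: q != 0.
    apply/eqP => w0; have [] := ind 0 1 rs`_i; last by move=> _ /eqP; rewrite oner_eq0.
    by rewrite scale0r add0r scale1r.
  rewrite dimv_disjoint_sum ?dim_vline ?c0 ?w0 //.
  apply/eqP; rewrite -subv0; apply/subvP => w; rewrite memv_cap => /andP[/vlineP[s ->] /vlineP[t e0]].
  have [|-> _ _] := ind s (- t) (- (t * rs`_i)); last by rewrite scale0r mem0v.
  by rewrite e0 scalerDr scalerA !scaleNr -addrA -opprD subrr.
- have [p0 hp0] := class_exists c0; exists p0 => i; by rewrite hp0 -memvE.
move=> P; have [v hv] := class_of P; apply: iff_trans (curve_class hv) _.
rewrite (hv : val P = _).
have Fabg a b g : Fv (a *: c + b *: p + g *: q) = Fv (b *: p + g *: q).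
  by rewrite -addrA addrC inv.
split; last first.
  move=> [i +]; rewrite -memvE => /memL[s [t ->]]; rewrite addrC inv FvZ -fE.
  have /eqP -> : f.[rs`_i] == 0 by rewrite froot mem_nth // srs.
  by rewrite mulr0.
have [a [b [g ->]]] := span v; rewrite Fabg.
(* As [F(q)] is nonzero, this case is the vertex, which lies on every line. *)
have [->|b0] := eqVneq b 0.
  rewrite scale0r add0r FvZ => /eqP; rewrite mulf_eq0 expf_eq0 d_gt0 /=.
  have /negPf -> : Fv q != 0.
    by move: qA; rewrite (meval_eq (v2 := q 0)) // => i; rewrite mxE.
  rewrite orbF => /eqP->; exists (Ordinal d_gt0).
  by rewrite !scale0r !addr0 -memvE memvZ.
have -> : b *: p + g *: q = b *: (p + (g / b) *: q).
  by rewrite scalerDr scalerA mulrCA mulfV // mulr1.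
rewrite FvZ -fE => /eqP; rewrite mulf_eq0 expf_eq0 (negPf b0) andbF /= froot => gb.
have lt : (index (g / b) rs < d)%N by rewrite -srs index_mem.
exists (Ordinal lt); rewrite -memvE -addrA memvD ?memvZ //.
have -> : b *: p + g *: q = b *: (p + rs`_(Ordinal lt) *: q).
  by rewrite /= nth_index // scalerDr scalerA mulrCA mulfV // mulr1.
exact/memvZ/wL.
Qed.

End ReducedForms.

(** * Velocity fields of actions *)

(** Here [c = -1/3]; the second hypothesis is the derivative of [X . Q = 0] in direction [k], the
    third is Euler's identity for [Q_k], of degree 2. *)
Lemma quadratic_field_identity (A : comNzRingType) (c q x b x1 q1 a1 b1 x2 q2 a2 b2 : A) :
  c * 3%:R = -1 ->
  1 * q + x * b + (0 * q1 + x1 * a1) + (0 * q2 + x2 * a2) = 0 ->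
  x * b + x1 * b1 + x2 * b2 = q *+ 2 ->
  q = x1 * (c * (a1 - b1)) - x2 * (c * (b2 - a2)).
Proof.
move=> hc h1 h2; have <- : - (c * 3%:R) * q = q by rewrite hc opprK mul1r.
transitivity (c * (0 - q *+ 2 - q)); first by ring.
rewrite -h1 -h2; ring.
Qed.

Section Parallel.
Variable K : numClosedFieldType.
Local Notation X3 := (fun i : 'I_3 => 'X_i : {mpoly K[3]}).

Lemma parallel_scale n (v : 'rV[K]_n) (w : 'I_n -> K) : v != 0 ->
  (forall i j, v 0 i * w j = v 0 j * w i) -> exists a, forall i, w i = a * v 0 i.
Proof.
move=> /row_coord_neq0[j vj] h; exists (w j / v 0 j) => i.
by apply: (mulfI vj); rewrite h [RHS]mulrCA mulrA mulfVK // mulrC.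
Qed.

Lemma same_class (p q : projective 'rV[K]_3) v w : is_class p v -> is_class q w ->
  (forall i j, v 0 i * w 0 j = v 0 j * w 0 i) -> p = q.
Proof.
move=> hp hq h; apply/val_inj; rewrite hp hq; have v0 := class_neq0 hp.
have [a wa] := parallel_scale v0 h; have ew : w = a *: v.
  by apply/rowP => i; rewrite wa mxE.
have := class_neq0 hq; rewrite ew scaler_eq0 negb_or => /andP[a0 _].
by apply/eqP; rewrite eqEdim !dim_vline v0 scaler_eq0 (negPf a0) v0 leqnn -memvE
  -[v in v \in _]scale1r -(mulVf a0) -scalerA memvZ ?memv_line.
Qed.

Lemma class_parallel (p : projective 'rV[K]_3) v w : is_class p v -> is_class p w ->
  forall i j, v 0 i * w 0 j = v 0 j * w 0 i.
Proof.
move=> hv hw i j; have /vlineP[a ->] : w \in <[v]>%VS by rewrite -hv hw memv_line.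
by rewrite !mxE mulrCA [RHS]mulrCA [v 0 i * _]mulrC.
Qed.

Definition euler n (p : {mpoly K[n]}) : {mpoly K[n]} := \sum_i 'X_i * p^`M(i).

Lemma eulerM n (p q : {mpoly K[n]}) : euler (p * q) = euler p * q + p * euler q.
Proof.
rewrite /euler mulr_suml mulr_sumr -big_split /=; apply: eq_bigr => i _.
by rewrite mderivM mulrDr !mulrA [p * 'X_i]mulrC.
Qed.

Lemma mcoeff_euler n (p : {mpoly K[n]}) m : (euler p)@_m = p@_m *+ mdeg m.
Proof.
elim/mpolyind: p => [|c m' p _ _ IH].
  by rewrite /euler big1 ?mcoeff0 ?mul0rn // => i _; rewrite mderiv0 mulr0.
have -> : euler (c *: 'X_[m'] + p) = c *: ('X_[m'] *+ mdeg m') + euler p.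
  rewrite -(euler_identity (d := mdeg m') (p := 'X_[m'])); last by rewrite dhomogX.
  rewrite /euler scaler_sumr -big_split /=; apply: eq_bigr => i _.
  by rewrite mderivD mderivZ mulrDr scalerAr.
rewrite !mcoeffD IH mulrnDl !mcoeffZ mcoeffMn mcoeffX mulrnAr.
by case: eqP => [->|] //; rewrite mulr0 !mul0rn.
Qed.

Lemma homog_of_euler n d (p : {mpoly K[n]}) : euler p = p *+ d -> p \is d.-homog.
Proof.
move=> ep; apply/dhomogP => m; rewrite mcoeff_msupp => pm.
have := congr1 (mcoeff m) ep; rewrite mcoeff_euler mcoeffMn -!(mulr_natr p@_m).
by move=> /(mulfI pm)/eqP; rewrite eqr_nat => /eqP.
Qed.

Lemma map_mpoly_homog n (R : nzRingType) (f : {additive R -> K}) d (p : {mpoly R[n]}) :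
  p \is d.-homog -> map_mpoly f p \is d.-homog.
Proof.
move=> hp; apply/dhomogP => m; rewrite mcoeff_msupp mcoeff_map_mpoly => pm.
apply: (dhomog_mf hp); rewrite mcoeff_msupp; apply: contraNneq pm => ->.
by rewrite raddf0.
Qed.

Lemma homog1_linear_form (p : 'I_3 -> {mpoly K[3]}) : (forall i, p i \is 1.-homog) ->
  exists M, forall i, p i = linear_form M i.
Proof.
move=> hp; exists (\matrix_(i, j) (p i)@_U_(j)) => i.
have s2 := msize_homog (hp i).
by rewrite {1}(affine_split s2) (dhomog_nemf_coeff (hp i)) ?mf0 ?mdeg0 // mpolyC0 addr0.
Qed.

Lemma ord3_neq (k : 'I_3) : ((k + 1 == k) = false) * ((k + 2%:R == k) = false).
Proof. by split; rewrite -subr_eq0 addrAC subrr add0r. Qed.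

(** On a line in direction [i] along which [p] is not constant there is a root; a nonzero coordinate
    [i + 1], constant along the line, keeps it away from 0. *)
Lemma nonzero_zero (p : {mpoly K[3]}) : p != 0 -> (1 < msize p)%N ->
  exists2 v : 'rV[K]_3, v != 0 & p.@[v 0] = 0.
Proof.
move=> p0 sp; have [i pi0] : exists i, p^`M(i) != 0.
  apply: exists_neq0 => /mderiv_eq0 e0.
  by move: sp; rewrite e0 msizeC; case: (_ == _).
have X0 : 'X_(i + 1) != 0 :> {mpoly K[3]} by rewrite -msupp_eq0 msuppX.
have [v] := mpoly_nonroot (mulf_neq0 pi0 X0).
rewrite mevalM mevalXU mulf_eq0 negb_or => /andP[piv vi].
pose w : 'rV[K]_3 := \row_j v j; pose u : 'rV[K]_3 := delta_mx 0 i.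
have dq : (on_line w u p)^`().[0] != 0.
  rewrite deriv_on_line horner_sum (bigD1 i) //= big1 => [|j ji].
    by rewrite addr0 mxE !eqxx mul1r horner_on_line scale0r addr0 meval_row.
  by rewrite mxE eqxx (negPf ji) mul0r horner0.
have /closed_rootP[x /rootP qx] : size (on_line w u p) != 1.
  apply: contra dq => /size_poly1P[c c0 ->]; by rewrite derivC horner0.
exists (w + x *: u); last by rewrite -horner_on_line.
apply: contraNneq vi => /rowP/(_ (i + 1)); rewrite !mxE.
by rewrite ord3_neq mulr0 addr0 => ->.
Qed.

(* For quadratic forms with [X . Q = 0], [X x curl Q = - 3 Q]. *)
Lemma quadratic_field (Q : 'I_3 -> {mpoly K[3]}) : \sum_k 'X_k * Q k = 0 ->
  (forall k, euler (Q k) = Q k *+ 2) ->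
  exists M : 'M[K]_3, forall k, Q k = cross X3 (linear_form M) k.
Proof.
move=> XQ EQ; have hQ k : Q k \is 2.-homog by apply: homog_of_euler.
pose W k : {mpoly K[3]} := - (3%:R)^-1 *: ((Q (k + 2%:R))^`M(k + 1) - (Q (k + 1))^`M(k + 2%:R)).
have [|M WM] := @homog1_linear_form W.
  by move=> k; apply: rpredZ; apply: rpredB; apply: (@mderiv_homog _ _ 2).
exists M => k; rewrite /cross -!WM /W !ord3_add.
have := EQ k; rewrite /euler (sum3 _ k).
have := congr1 (mderiv k) XQ; rewrite raddf0 (sum3 _ k) !mderivD !mderivM.
rewrite !mderiv_var eqxx !ord3_neq -!mul_mpolyC.
have : (- 3%:R^-1)%:MP * 3%:R = -1 :> {mpoly K[3]}.
  by rewrite mulr_natr -mpolyCMn mulNrn -[_ *+ 3]mulr_natr mulVf ?pnatr_eq0 // mpolyCN.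
exact: quadratic_field_identity.
Qed.

End Parallel.

Section Velocity.
Variable K : numClosedFieldType.
Local Notation P2 := (projective 'rV[K]_3).
Local Notation P3 := {mpoly K[3]}.
Local Notation X3 := (fun i : 'I_3 => 'X_i : P3).
Implicit Types (A : 'I_3 -> {mpoly {poly K}[3]}) (v : 'rV[K]_3) (t : K).

Lemma meval_map_mpoly n (f : {additive {poly K} -> K}) (p : {mpoly {poly K}[n]}) (v : 'I_n -> K) :
  (forall c a, f (c * a%:P) = f c * a) ->
  (map_mpoly f p).@[v] = f p.@[fun j => (v j)%:P].
Proof.
move=> hf; rewrite (map_mpolyE f (leqnn _)) raddf_sum [p.@[_]](@mmapE _ _ _ _ _ p _ (leqnn _)) raddf_sum.
apply: eq_bigr => m _; rewrite /= mevalZ mevalX.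
have -> : mmap1 (fun j => (v j)%:P) m = (\prod_i v i ^+ m i)%:P.
  by rewrite rmorph_prod; apply: eq_bigr => i _; rewrite rmorphXn.
by rewrite -hf.
Qed.

Definition path A v i : {poly K} := (A i).@[fun j => (v 0 j)%:P].
Definition position A t i : P3 := map_mpoly (horner_eval t) (A i).
Definition velocity A t i : P3 := map_mpoly (horner_eval t \o @deriv K) (A i).

Lemma horner_path A v t i : (path A v i).[t] = (eval_forms A t v) 0 i.
Proof.
by rewrite mxE meval_map_mpoly // => c a; rewrite /= /horner_eval hornerM hornerC.
Qed.

Lemma meval_position A t v i : (position A t i).@[v 0] = (path A v i).[t].
Proof. by rewrite horner_path mxE. Qed.

Lemma meval_velocity A t v i : (velocity A t i).@[v 0] = (path A v i)^`().[t].
Proof.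
rewrite meval_map_mpoly // => c a.
by rewrite /= /horner_eval derivM derivC mulr0 addr0 hornerM hornerC.
Qed.

Lemma cross_deriv (P Q : 'I_3 -> {poly K}) t : (forall i j, P i * Q j = P j * Q i) ->
  forall i j, (P i)^`().[t] * (Q j).[t] + (P i).[t] * (Q j)^`().[t] =
              (P j)^`().[t] * (Q i).[t] + (P j).[t] * (Q i)^`().[t].
Proof.
move=> h i j; have := congr1 (fun p : {poly K} => p^`().[t]) (h i j).
by rewrite /= !derivM !hornerD !hornerM.
Qed.

(** Common setting for both groups: [g] is ['X] for Gm and 1 for Ga, [t0] is the neutral element,
    and translation in the group is an affine change of the parameter. *)
Variables (G : {pred K}) (t0 : K) (s : K -> P2 -> P2) (g : {poly K}).
Hypothesis g_neq0 : g != 0.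
Hypothesis gG : forall t, g.[t] != 0 -> t \in G.
Hypothesis t0G : t0 \in G.
Hypothesis s_id : forall p, s t0 p = p.
Hypothesis s_translate : forall t1, t1 \in G -> exists a b : K, [/\ a != 0, a * t1 + b = t0
  & forall t p, t \in G -> a * t + b \in G /\ s t p = s (a * t + b) (s t1 p)].
Hypothesis s_reg : regular_map G s.

Definition local_chart m A : Prop := (forall i, A i \is m.-homog) /\
  forall t p v, t \in G -> is_class p v -> eval_forms A t v != 0 ->
    is_class (s t p) (eval_forms A t v).

Lemma exists_chart t v : t \in G -> v != 0 -> exists m A, local_chart m A /\ eval_forms A t v != 0.
Proof.
move=> tG v0; have [p hp] := class_exists v0; have [m [A [hA [w hw Aw] sA]]] := s_reg p tG.
exists m, A; split=> //; have /vlineP[a ea] : w \in <[v]>%VS by rewrite -hp hw memv_line.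
apply: contraNneq Aw => Av; apply/eqP/rowP => i; rewrite !mxE ea.
rewrite (meval_form_scale _ _ (map_mpoly_homog _ (hA i))).
by have /rowP/(_ i) := Av; rewrite !mxE => ->; rewrite mulr0.
Qed.

Lemma chart_position m A v : local_chart m A -> v != 0 ->
  exists a, forall i, (path A v i).[t0] = a * v 0 i.
Proof.
move=> [_ cA] v0; have [p hp] := class_exists v0; apply: parallel_scale => // i j.
rewrite !horner_path; have [->|A0] := eqVneq (eval_forms A t0 v) 0; first by rewrite !mxE !mulr0.
by have := cA t0 p v t0G hp A0; rewrite s_id => hp'; apply: class_parallel hp hp' i j.
Qed.

Lemma charts_agree m A m' A' v : local_chart m A -> local_chart m' A' -> v != 0 ->
  forall i j, path A v i * path A' v j = path A v j * path A' v i.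
Proof.
move=> [_ cA] [_ cA'] v0 i j; have [p hp] := class_exists v0.
apply: (poly_ext_off g_neq0) => t /gG tG; rewrite !hornerM !horner_path.
have [->|A0] := eqVneq (eval_forms A t v) 0; first by rewrite !mxE !mul0r.
have [->|A0'] := eqVneq (eval_forms A' t v) 0; first by rewrite !mxE !mulr0.
by apply: (class_parallel (p := s t p)); [apply: cA|apply: cA'].
Qed.

(* A chart gives [A(t0, v) = a v], and [drift A / a = v x dA/dt (t0, v) / a] does
   not depend on the chart: it is the velocity of the action modulo [v]. *)
Definition drift A := cross X3 (velocity A t0).

Lemma meval_cross (P Q : 'I_3 -> P3) v k : (cross P Q k).@[v 0] =
  cross (fun i => (P i).@[v 0]) (fun i => (Q i).@[v 0]) k.
Proof. by rewrite /cross mevalB !mevalM. Qed.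

Lemma meval_drift A v k :
  (drift A k).@[v 0] = cross (fun i => v 0 i) (fun i => (path A v i)^`().[t0]) k.
Proof. by rewrite meval_cross /cross !mevalXU !meval_velocity. Qed.

(** Obtained by differentiating at [t0] the proportionality of the paths of [v] in the two charts,
    both of which pass through multiples of [v]. *)
Lemma drift_compatible m A m' A' i j k : local_chart m A -> local_chart m' A' ->
  position A t0 i * ('X_j * drift A' k) = 'X_i * drift A k * position A' t0 j.
Proof.
move=> cA cA'; apply: subr0_eq.
apply: (@mpoly_zero_off _ _ _ 'X_ord0); first by rewrite -msupp_eq0 msuppX.
move=> w; rewrite mevalXU => w0; pose v : 'rV[K]_3 := \row_i w i.
have v0 : v != 0 by apply: contraNneq w0 => /rowP/(_ ord0); rewrite !mxE => ->.
rewrite -meval_row -/v mevalB !mevalM !mevalXU !meval_position !meval_drift.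
have [a ea] := chart_position cA v0; have [a' ea'] := chart_position cA' v0.
have := cross_deriv t0 (charts_agree cA cA' v0) (k + 1) (k + 2%:R).
rewrite /cross !ea !ea'.
move: (_^`().[_]) (_^`().[_]) (_^`().[_]) (_^`().[_]) => x y z u h.
apply/eqP; rewrite subr_eq0; apply/eqP.
have {}h : a * (v 0 (k + 1) * z - v 0 (k + 2%:R) * x) = a' * (v 0 (k + 1) * y - v 0 (k + 2%:R) * u).
  apply/eqP; rewrite -subr_eq0.
  by have /eqP := h; rewrite -subr_eq0 => /eqP {}h; apply/eqP; rewrite -[RHS]h; ring.
transitivity (v 0 i * v 0 j * (a' * (v 0 (k + 1) * y - v 0 (k + 2%:R) * u))); last by ring.
by rewrite -h; ring.
Qed.

(* A prime factor of a reduced denominator would have a zero [v != 0], where a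
   chart around [v] gives a denominator that does not vanish. *)
Lemma drift_quotient : exists Q : 'I_3 -> P3, forall m A j k,
  local_chart m A -> 'X_j * drift A k = Q k * position A t0 j.
Proof.
have n0 n (D : P3) (P : 'I_3 -> P3) : (msize D <= n)%N -> D != 0 ->
    (forall m A j k, local_chart m A -> D * ('X_j * drift A k) = P k * position A t0 j) ->
    exists Q : 'I_3 -> P3, forall m A j k,
      local_chart m A -> 'X_j * drift A k = Q k * position A t0 j.
  elim: n D P => [|n IH] D P sD D0 hP; first by case/negP: D0; rewrite -msize_poly_eq0 -leqn0.
  have [s1|s1] := leqP (msize D) 1.
    have [/eqP/msize_poly1P[c c0 eD]] : msize D = 1%N.
      by apply/eqP; rewrite eqn_leq s1 lt0n msize_poly_eq0.
    exists (fun k => c^-1 *: P k) => m A j k /hP h.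
    by rewrite -scalerAl -h eD mul_mpolyC scalerA mulVf // scale1r.
  have [p pp [D' eD]] := exists_prime_divisor D0 s1.
  have [p0 _ pM] := pp.
  have sp : (1 < msize p)%N by rewrite ltnNge; apply/negP => /(mpoly_unit_size p0); case: pp => _ /negP.
  have [v v0 pv] := nonzero_zero p0 sp.
  have [m [A [cA /row_coord_neq0[j Aj]]]] := exists_chart t0G v0.
  have dP k : exists c, P k = c * p.
    have : divides p (P k * position A t0 j) by rewrite -(hP m) // eD -mulrA; apply/divides_mull/divides_mulr/divides_refl.
    move=> /pM[//|[c ec]]; case/eqP: Aj.
    by rewrite -horner_path -meval_position ec mevalM pv mulr0.
  have [P' eP] := choice dP.
  move: D0 sD; rewrite eD mulf_eq0 negb_or => /andP[D'0 _] sD.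
  apply: (IH D' P') => //; first by move: sD sp; rewrite msizeM //; move: (msize _) (msize _) => x y; lia.
  by move=> m' A' i k cA'; apply: (mulfI p0); rewrite !mulrA [p * D']mulrC [p * P' k]mulrC -eD -eP -mulrA; apply: hP cA'.
have [v v0] : exists v : 'rV[K]_3, v != 0.
  by exists (const_mx 1); apply/eqP => /rowP/(_ ord0)/eqP; rewrite !mxE oner_eq0.
have [m [A [cA /row_coord_neq0[j Aj]]]] := exists_chart t0G v0.
apply: (n0 _ (position A t0 j) (fun k => 'X_j * drift A k) (leqnn _)).
  by apply: contraNneq Aj => e0; rewrite -horner_path -meval_position e0 meval0.
by move=> m' A' i k cA'; apply: drift_compatible cA cA'.
Qed.

(** The quotient [Q] is orthogonal to [X] because [drift A] is a cross product with [X], and its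
    degree is [(m + 2) - m = 2]; so [quadratic_field] applies. *)
Lemma drift_field : exists M : 'M[K]_3, forall m A j k, local_chart m A ->
  'X_j * drift A k = cross X3 (linear_form M) k * position A t0 j.
Proof.
have [Q hQ] := drift_quotient.
have [v v0] : exists v : 'rV[K]_3, v != 0.
  by exists (const_mx 1); apply/eqP => /rowP/(_ ord0)/eqP; rewrite !mxE oner_eq0.
have [m [A [cA /row_coord_neq0[j Aj]]]] := exists_chart t0G v0.
have pA : position A t0 j != 0.
  by apply: contraNneq Aj => e0; rewrite -horner_path -meval_position e0 meval0.
have [||M hM] := @quadratic_field K Q.
- apply: (mulIf pA); rewrite mul0r mulr_suml.
  transitivity ('X_j * \sum_k 'X_k * drift A k).
    by rewrite mulr_sumr; apply: eq_bigr => k _; rewrite -mulrA -(hQ m A j k cA) mulrCA.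
  rewrite (sum3 _ 0) /drift /cross !ord3_add; ring.
- move=> k; apply: (mulIf pA).
  have hp : position A t0 j \is m.-homog by apply: map_mpoly_homog; case: cA.
  have hd : 'X_j * drift A k \is (1 + (1 + m)).-homog.
    have hX i : ('X_i : P3) \is 1.-homog by rewrite dhomogX /= mdeg1.
    have hv i : velocity A t0 i \is m.-homog by apply: map_mpoly_homog; case: cA.
    by apply: dhomogM => //; apply: rpredB; apply: dhomogM.
  have := eulerM (Q k) (position A t0 j); rewrite -(hQ m A j k cA).
  rewrite /euler (euler_identity hd) (euler_identity hp) -!/(euler _) (hQ m A j k cA).
  by move=> e1; apply/eqP; rewrite -subr_eq0 -[X in X - _](addrK (Q k * (position A t0 j *+ m))) -e1; apply/eqP; ring.
by exists M => m' A' i k cA'; rewrite -hM (hQ m' A' i k cA').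
Qed.

(** The group law moves [t] to [t0]: the path of [v] near [t] is proportional to an affine
    reparametrization of the path of [w = A(t, v)] near [t0], whose velocity is a multiple of
    [w]. *)
Lemma drift0_stationary m A t v : local_chart m A -> t \in G -> v != 0 ->
  (forall m A k, local_chart m A -> drift A k = 0) ->
  forall i j, (path A v i).[t] * (path A v j)^`().[t] = (path A v j).[t] * (path A v i)^`().[t].
Proof.
move=> cA tG v0 D0 i j.
have [A0|A0] := eqVneq (eval_forms A t v) 0; first by rewrite !horner_path A0 !mxE !mul0r.
have [a [b [a0 eab hab]]] := s_translate tG.
set w := eval_forms A t v in A0.
have [m' [A' [cA' A'0]]] := exists_chart t0G A0.
have [c hc] := chart_position cA' A0.
have c0 : c != 0.
  have [l] := row_coord_neq0 A'0; rewrite -horner_path hc.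
  by apply: contraNneq => ->; rewrite mul0r.
have [p hp] := class_exists v0; have hw : is_class (s t p) w by case: cA => _ h; exact: h hp A0.
pose q i := path A' w i \Po (a *: 'X + b%:P).
have qE i' x : (q i').[x] = (path A' w i').[a * x + b].
  by rewrite horner_comp hornerD hornerZ hornerX hornerC.
have pq i' j' : path A v i' * q j' = path A v j' * q i'.
  apply: (poly_ext_off g_neq0) => x /gG xG; rewrite !hornerM !qE !horner_path.
  have [->|n1] := eqVneq (eval_forms A x v) 0; first by rewrite !mxE !mul0r.
  have [->|n2] := eqVneq (eval_forms A' (a * x + b) w) 0; first by rewrite !mxE !mulr0.
  have [xG' es] := hab x p xG.
  apply: (class_parallel (p := s x p)); first by case: cA => _; apply.
  by rewrite es; case: cA' => _; apply.
have dw i' j' : w 0 i' * (path A' w j')^`().[t0] = w 0 j' * (path A' w i')^`().[t0].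
  move: i' j'; apply/(cross_eq0 (fun i => w 0 i) (fun i => (path A' w i)^`().[t0])) => k.
  by rewrite -meval_drift (D0 _ _ _ cA') meval0.
have l0 : (a *: 'X + b%:P).[t] = t0 by rewrite hornerD hornerZ hornerX hornerC.
have l1 : (a *: 'X + b%:P)^`().[t] = a by rewrite derivD derivZ derivX derivC addr0 hornerZ hornerC mulr1.
have := cross_deriv t pq i j; rewrite !qE eab !hc !deriv_comp !hornerM !horner_comp l0 l1.
rewrite ![(path A v _).[t]]horner_path -/w; have := dw i j.
move: (_^`().[t0]) (_^`().[t0]) (_^`().[t]) (_^`().[t]) => y y' z z' h1 h2.
apply: (mulfI c0); apply/eqP; rewrite -subr_eq0.
have h3 : a * (w 0 i * y') - a * (w 0 j * y) = 0 by rewrite h1 subrr.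
have /eqP := h2; rewrite -subr_eq0 => /eqP {}h2.
apply/eqP; rewrite -[RHS](subrr (0 : K)) -{1}h3 -h2; ring.
Qed.

(** In one chart the direction of the path is constant by [wronskian_zero]. Charts around [t1] and
    around [t0] have a parameter [x] in common, so [s t1 p = s t0 p = p]. *)
Lemma drift0_trivial : (forall m A k, local_chart m A -> drift A k = 0) ->
  forall t p, t \in G -> s t p = p.
Proof.
move=> D0 t1 p t1G; have [v hv] := class_of p; have v0 := class_neq0 hv.
have chart_const t m A : local_chart m A -> t \in G -> eval_forms A t v != 0 ->
    exists2 q : {poly K}, q != 0 & forall x, q.[x] != 0 -> x \in G -> s x p = s t p.
  move=> cA tG At; have [i Ai] := row_coord_neq0 At.
  exists (path A v i); first by apply: contraNneq Ai => e0; rewrite -horner_path e0 horner0.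
  move=> x; rewrite horner_path => xi xG.
  have Ax : eval_forms A x v != 0 by apply: contraNneq xi => ->; rewrite mxE.
  case: (cA) => _ cA'; apply: (same_class (cA' x p v xG hv Ax) (cA' t p v tG hv At)) => j l.
  suff /wronskian_zero/(_ x t) : path A v j * (path A v l)^`() = path A v l * (path A v j)^`().
    by rewrite !horner_path [X in _ = X -> _]mulrC.
  apply: (poly_ext_off g_neq0) => y /gG yG.
  by rewrite !hornerM (drift0_stationary cA yG v0 D0 j l).
have [m [A [cA At]]] := exists_chart t1G v0.
have [m' [A' [cA' At']]] := exists_chart t0G v0.
have [q q0 hq] := chart_const _ _ _ cA t1G At.
have [q' q0' hq'] := chart_const _ _ _ cA' t0G At'.
have [x] := poly_nonroot (mulf_neq0 g_neq0 (mulf_neq0 q0 q0')).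
rewrite !hornerM !mulf_eq0 !negb_or => /and3P[/gG xG qx qx'].
by rewrite -(hq x qx xG) (hq' x qx' xG) s_id.
Qed.

Variables (d : nat) (F : dhomog 3 K d).
Hypothesis d_gt0 : (0 < d)%N.
Hypothesis F_red : reduced_form F.
Hypothesis curve_stable : forall t p, t \in G -> curve F p -> curve F (s t p).
Hypothesis s_nontrivial : nontrivial_action G s.
Local Notation dF i := ((F : P3)^`M(i)).

Lemma velocity_tangent m A v : local_chart m A -> v != 0 -> (F : P3).@[v 0] = 0 ->
  \sum_i (path A v i)^`().[t0] * (dF i).@[fun j => (path A v j).[t0]] = 0.
Proof.
move=> [_ cA] v0 Fv; have [p hp] := class_exists v0.
have Cp : curve F p by exists v.
have e0 : mmap (@polyC K) (path A v) F = 0.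
  apply: (poly_ext_off g_neq0) => t /gG tG; rewrite horner0.
  have -> : (mmap (@polyC K) (path A v) F).[t] = (F : P3).@[eval_forms A t v 0].
    by rewrite horner_mmap; apply: meval_eq => i; apply: horner_path.
  have [->|A0] := eqVneq (eval_forms A t v) 0; first exact: (Fv0 F d_gt0).
  by apply/(curve_class F (cA t p v tG hp A0))/curve_stable.
have := congr1 (fun p : {poly K} => p^`().[t0]) e0.
rewrite /= deriv0 horner0 deriv_mmap horner_sum => e1; rewrite -[RHS]e1.
by apply: eq_bigr => i _; rewrite hornerM mulrC horner_mmap.
Qed.

Lemma flow_lin_syzygy : lin_syzygy F.
Proof.
have [M hM] := drift_field.
pose DF : P3 := \sum_i linear_form M i * dF i.
have hF := dhomog_is_dhomog F.
have hDF : DF \is d.-homog.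
  suff : DF \is (1 + d.-1).-homog by rewrite add1n prednK.
  apply: rpred_sum => i _; apply: dhomogM; first exact: linear_form_homog.
  exact: mderiv_homog.
have [|c ec] := form_nullstellensatz d_gt0 F_red (P := DHomog hDF).
  move=> u Fu; pose v : 'rV[K]_3 := \row_i u i.
  have [v0|v0] := eqVneq v 0.
    rewrite -meval_row -/v v0 -(scale0r (0 : 'rV[K]_3)) (meval_form_scale _ _ hDF).
    by rewrite expr0n gtn_eqF // mul0r.
  have [m [A [cA /row_coord_neq0[l Al]]]] := exists_chart t0G v0.
  have [a ha] := chart_position cA v0; rewrite -horner_path ha in Al.
  have [a0 vl] : a != 0 /\ v 0 l != 0 by move: Al; rewrite mulf_eq0 negb_or => /andP[].
  rewrite -meval_row -/v; rewrite -meval_row -/v in Fu; have tg := velocity_tangent cA v0 Fu.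
  have euler_v : \sum_i v 0 i * (dF i).@[v 0] = 0.
    have := congr1 (meval (v 0)) (euler_identity hF).
    rewrite raddf_sum mevalMn Fu mul0rn => e1; rewrite -[RHS]e1; apply: eq_bigr => i _.
    by rewrite /= mevalM mevalXU.
  (* The velocity is [a M v] modulo [v], and Euler's identity makes multiples of [v] irrelevant on
     the curve. *)
  have par i j : v 0 i * ((path A v j)^`().[t0] - a * (linear_form M j).@[v 0]) =
                 v 0 j * ((path A v i)^`().[t0] - a * (linear_form M i).@[v 0]).
    move: i j; apply/(cross_eq0 (fun i => v 0 i) (fun i => (path A v i)^`().[t0] - a * (linear_form M i).@[v 0])) => k.
    have := congr1 (meval (v 0)) (hM _ _ l k cA).
    rewrite !mevalM mevalXU meval_drift meval_cross meval_position ha /cross !mevalXU => e1.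
    apply: (mulfI vl); apply/eqP; rewrite mulr0; apply/eqP.
    have /eqP := e1; rewrite -subr_eq0 => /eqP {}e1; rewrite -[RHS]e1; ring.
  have [b hb] := parallel_scale v0 par.
  have ha' P k : P \is k.-homog -> P.@[fun j => (path A v j).[t0]] = a ^+ k * P.@[v 0].
    by move=> hP; rewrite -(meval_homog _ _ hP); apply: meval_eq => i; rewrite ha.
  have tg' : \sum_i (path A v i)^`().[t0] * (dF i).@[v 0] = 0.
    apply: (mulfI (expf_neq0 d.-1 a0)); rewrite mulr0 mulr_sumr -[RHS]tg.
    apply: eq_bigr => i _; rewrite mulrCA; congr (_ * _).
    by rewrite (ha' _ _ (mderiv_homog i hF)).
  apply: (mulfI a0); rewrite mulr0 /= /DF raddf_sum mulr_sumr.
  transitivity (\sum_i (path A v i)^`().[t0] * (dF i).@[v 0] - b * (\sum_i v 0 i * (dF i).@[v 0])).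
    rewrite mulr_sumr -sumrB; apply: eq_bigr => i _.
    by rewrite /= mevalM [RHS]addrC mulrA -mulNr -mulrDl -hb opprB addrNK -mulrA.
  by rewrite tg' euler_v mulr0 subrr.
have d0 : d%:R != 0 :> K by rewrite pnatr_eq0 -lt0n.
have lfE a i : linear_form (M - a%:M) i = linear_form M i - a *: 'X_i.
  rewrite /linear_form (bigD1 i) //= [X in _ = X - _](bigD1 i) //= !mxE eqxx mulr1n scalerBl.
  rewrite addrAC; congr (_ + _ - _); apply: eq_bigr => j ji.
  by rewrite !mxE eq_sym (negPf ji) mulr0n subr0.
exists (M - (c / d%:R)%:M); split; last first.
  transitivity (DF - (c / d%:R) *: (\sum_i 'X_i * dF i)).
    rewrite scaler_sumr -sumrB; apply: eq_bigr => i _.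
    by rewrite lfE mulrBl -scalerAl.
  rewrite (euler_identity hF) -scaler_nat scalerA mulfVK //.
  by apply/eqP; rewrite subr_eq0; apply/eqP.
(* Were [M] scalar, [X x M X] would be 0, so the drift of every chart would vanish and the action
   would be trivial. *)
apply/eqP => /eqP; rewrite subr_eq0 => /eqP eM.
have [t [p [tG]]] := s_nontrivial; apply; apply: drift0_trivial => // m A k cA.
have X0 : 'X_ord0 != 0 :> P3 by rewrite -msupp_eq0 msuppX.
have lfX i : linear_form M i = (c / d%:R) *: 'X_i.
  have := lfE (c / d%:R) i; rewrite eM subrr.
  have -> : linear_form 0 i = 0 :> P3 by apply: big1 => j _; rewrite mxE scale0r.
  by move/eqP; rewrite eq_sym subr_eq0 => /eqP.
apply: (mulfI X0); rewrite mulr0 (hM _ _ ord0 k cA) /cross !lfX -!scalerAr.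
by rewrite -scalerBr ['X_(k + 1) * _]mulrC subrr scaler0 mul0r.
Qed.

End Velocity.

Section OrbitsToSyzygy.
Variables (K : numClosedFieldType) (d : nat) (F : dhomog 3 K d).
Hypothesis d_gt0 : (0 < d)%N.
Hypothesis F_red : reduced_form F.

Lemma orbits_stable (G : {pred K}) op e s (C : projective 'rV[K]_3 -> Prop) :
  (forall t u, t \in G -> u \in G -> op t u \in G) ->
  algebraic_action G op e s -> union_of_orbits G s C ->
  forall t p, t \in G -> C p -> C (s t p).
Proof.
move=> opG [_ sM _] [S hS] t p tG /hS[q Sq [u uG ->]].
by apply/hS; exists q => //; exists (op t u); [apply: opG|rewrite sM].
Qed.

Lemma orbits_lin_syzygy : union_of_Gm_or_Ga_orbits (curve F) -> lin_syzygy F.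
Proof.
move=> [s [[act nt orb]|[act nt orb]]]; have [s1 sM reg] := act.
- apply: (@flow_lin_syzygy K (@Gm K) 1 s 'X) => //.
  + by rewrite polyX_eq0.
  + by move=> t; rewrite hornerX.
  + by rewrite inE oner_eq0.
  + move=> t t0; exists t^-1, 0; rewrite addr0 invr_eq0 mulVf //; split=> // u p u0.
    have tu : t^-1 * u \in @Gm K by rewrite inE mulf_neq0 ?invr_eq0.
    by rewrite addr0 -sM // mulrAC mulVf ?mul1r.
  apply: orbits_stable act orb => t u; rewrite !inE; exact: mulf_neq0.
apply: (@flow_lin_syzygy K (@Ga K) 0 s 1) => //.
- exact: oner_neq0.
- move=> t _; exists 1, (- t); rewrite mul1r subrr oner_neq0; split=> // u p _.
  by rewrite mul1r -sM // subrK.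
exact: orbits_stable act orb.
Qed.

End OrbitsToSyzygy.

(** * Linear vector fields *)

Section JordanChevalley.
Variable K : numClosedFieldType.

(** Chinese remainder theorem, one root at a time. At a matrix with these eigenvalues, [p] produces
    the semisimple part. *)
Lemma interpolate_powers m (rs : seq K) : uniq rs -> exists p : {poly K},
  forall x, x \in rs -> ('X - x%:P) ^+ m %| p - x%:P.
Proof.
elim: rs => [_|y rs IH /= /andP[yrs /IH[p hp]]]; first by exists 0.
pose Q := \prod_(x <- rs) ('X - x%:P) ^+ m.
have QE x : x \in rs -> ('X - x%:P) ^+ m %| Q.
  by move=> xrs; rewrite /Q (perm_big _ (perm_to_rem xrs)) big_cons dvdp_mulIl.
have /Bezout_eq1_coprimepP[[u w] /= e1] : coprimep Q (('X - y%:P) ^+ m).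
  apply: coprimep_expr; rewrite coprimep_XsubC /root horner_prod prodf_seq_neq0.
  apply/allP => x xrs; rewrite /= horner_exp hornerXsubC expf_neq0 // subr_eq0.
  by apply: contraNneq yrs => ->.
exists (p + (y%:P - p) * (u * Q)) => x; rewrite inE => /predU1P[->|xrs].
  have -> : p + (y%:P - p) * (u * Q) - y%:P = (p - y%:P) * (u * Q + w * ('X - y%:P) ^+ m - u * Q).
    by rewrite e1; ring.
  by rewrite addrAC subrr add0r mulrA dvdp_mulIr.
by rewrite addrAC; apply: dvdp_add; [apply: hp|apply/dvdp_mull/dvdp_mull/QE].
Qed.

Lemma prod_XsubC_dvd_exp (s u : seq K) : {subset s <= u} ->
  \prod_(z <- s) ('X - z%:P) %| (\prod_(z <- u) ('X - z%:P)) ^+ size s.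
Proof.
elim: s => [|z s IH] su; first by rewrite big_nil expr0.
rewrite big_cons exprS dvdp_mul //; last by apply: IH => x xs; rewrite su // inE xs orbT.
by rewrite dvdp_XsubCl root_prod_XsubC su ?mem_head.
Qed.

(** [S] and [N] are the values at [B] of [p] and [X - p]. Multiples of [r ^ (n + 1)] vanish at [B]
    by Cayley-Hamilton; both the product of the [p - z] and the power of [X - p] are such
    multiples. *)
Lemma jordan_chevalley n (B : 'M[K]_n.+1) : exists S N : 'M[K]_n.+1,
  [/\ B = S + N, S * N = N * S, diagonalizable S & N ^+ n.+1 = 0].
Proof.
have [s es] := closed_field_poly_normal (char_poly B).
rewrite (monicP (char_poly_monic B)) scale1r in es.
have ss : size s = n.+1 by have := size_char_poly B; rewrite es size_prod_XsubC => -[].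
pose r := \prod_(z <- undup s) ('X - z%:P).
have cr : char_poly B %| r ^+ n.+1.
  by rewrite es -ss; apply: prod_XsubC_dvd_exp => x; rewrite mem_undup.
have killed q : r ^+ n.+1 %| q -> horner_mx B q = 0.
  move=> rq; have /dvdpP[q' ->] := dvdp_trans cr rq.
  by rewrite rmorphM /= Cayley_Hamilton mulr0.
have [p hp] := interpolate_powers n.+1 (undup_uniq s).
exists (horner_mx B p), (horner_mx B ('X - p)); split.
- by rewrite -rmorphD /= addrC subrK horner_mx_X.
- by rewrite -!rmorphM mulrC.
- apply/diagonalizableP; exists (undup s); first exact: undup_uniq.
  apply: mxminpoly_min; rewrite rmorph_prod /=.
  transitivity (horner_mx B (\prod_(z <- undup s) (p - z%:P))).
    rewrite rmorph_prod; apply: eq_bigr => z _.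
    by rewrite !rmorphB /= horner_mx_X !horner_mx_C.
  apply: killed; rewrite /r -prodrXl big_seq [X in _ %| X]big_seq.
  by elim/big_ind2: _ => // x1 x2 y1 y2; apply: dvdp_mul.
rewrite -rmorphXn; apply: killed; rewrite dvdp_exp2r //.
apply: uniq_roots_dvdp; last by rewrite uniq_rootsE undup_uniq.
apply/allP => x /hp; rewrite exprS => /(dvdp_trans (dvdp_mulIl _ _)).
rewrite dvdp_XsubCl => /rootP; rewrite hornerD hornerN hornerC => /eqP.
by rewrite subr_eq0 => /eqP e1; apply/rootP; rewrite hornerD hornerN hornerX e1 subrr.
Qed.

End JordanChevalley.

Section LinearFields.
Variables (K : numClosedFieldType).
Local Notation P3 := {mpoly K[3]}.

(** The derivation along the field [v |-> v B]; points are row vectors, hence the transpose. *)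
Definition der (B : 'M[K]_3) (P : P3) : P3 := \sum_i linear_form B^T i * P^`M(i).

Lemma meval_linear_form (M : 'M[K]_3) (v : 'rV[K]_3) i :
  (linear_form M i).@[v 0] = (v *m M^T) 0 i.
Proof.
rewrite raddf_sum mxE; apply: eq_bigr => j _.
by rewrite /= mevalZ mevalXU mxE mulrC.
Qed.

Lemma meval_der B P (v : 'rV[K]_3) :
  (der B P).@[v 0] = \sum_i (v *m B) 0 i * P^`M(i).@[v 0].
Proof.
rewrite raddf_sum; apply: eq_bigr => i _.
by rewrite /= mevalM meval_linear_form trmxK.
Qed.

Lemma linear_formD M1 M2 i : linear_form (M1 + M2) i = linear_form M1 i + linear_form M2 i :> P3.
Proof. by rewrite -big_split; apply: eq_bigr => j _; rewrite mxE scalerDl. Qed.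

Lemma derD A B P : der (A + B) P = der A P + der B P.
Proof.
by rewrite /der -big_split; apply: eq_bigr => i _; rewrite linearD linear_formD mulrDl.
Qed.

Lemma der_scale B c P : der B (c *: P) = c *: der B P.
Proof. by rewrite scaler_sumr; apply: eq_bigr => i _; rewrite mderivZ scalerAr. Qed.

Lemma mderiv_linear_form M i k : (linear_form M i)^`M(k) = (M i k)%:MP :> P3.
Proof.
rewrite raddf_sum (bigD1 k) //= mderivZ mderiv_var eqxx big1 => [|j jk].
  by rewrite addr0 alg_mpolyC.
by rewrite mderivZ mderiv_var (negPf jk) scaler0.
Qed.

(** The second-order part is symmetric in [A] and [B], so only the product of the matrices can
    obstruct commutation. *)
Lemma der_der A B P : der A (der B P) = der (A *m B) P +
  \sum_i \sum_j linear_form A^T i * linear_form B^T j * P^`M(i)^`M(j).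
Proof.
rewrite {1}/der; under eq_bigr => i _.
  rewrite {1}/der raddf_sum mulr_sumr.
  under eq_bigr => j _ do rewrite /= mderivM mulrDr mderiv_linear_form.
  rewrite big_split /=; over.
rewrite big_split /=; congr (_ + _); last first.
  by apply: eq_bigr => i _; apply: eq_bigr => j _; rewrite mulrA mderiv_comm.
rewrite exchange_big /der; apply: eq_bigr => j _ /=.
under eq_bigr => i _ do rewrite mulrA.
rewrite -mulr_suml; congr (_ * _).
rewrite /linear_form; under eq_bigr => i _ do rewrite mulr_suml.
rewrite exchange_big /=; apply: eq_bigr => k _.
rewrite mxE [in RHS]mxE scaler_suml; apply: eq_bigr => i _.
by rewrite !mxE -scalerAl mulrC mul_mpolyC scalerA.
Qed.

Lemma der_comm A B P : A *m B = B *m A -> der A (der B P) = der B (der A P).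
Proof.
move=> AB; rewrite !der_der AB; congr (_ + _); rewrite exchange_big.
by apply: eq_bigr => i _; apply: eq_bigr => j _; rewrite mderiv_comm [X in X * _]mulrC.
Qed.

Lemma mmap_der (h : 'I_3 -> {poly K}) (B : 'M[K]_3) P :
  (forall i, (h i)^`() = \sum_j h j * (B j i)%:P) ->
  (mmap (@polyC K) h P)^`() = mmap (@polyC K) h (der B P).
Proof.
move=> hB; rewrite deriv_mmap raddf_sum; apply: eq_bigr => i _.
rewrite /= (rmorphM (mmap (@polyC K) h)) mulrC /=; congr (_ * _).
rewrite hB raddf_sum; apply: eq_bigr => j _.
by rewrite /= mmapZ mmapXU mxE mulrC.
Qed.

Definition precomp (Q : 'M[K]_3) (P : P3) : P3 := mmap (@mpolyC 3 K) (linear_form Q^T) P.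

Lemma meval_precomp Q P (v : 'rV[K]_3) : (precomp Q P).@[v 0] = P.@[(v *m Q) 0].
Proof.
apply: (mmap_morph (phi := meval (v 0))) => [c|i] /=; first exact: mevalC.
by rewrite meval_linear_form trmxK.
Qed.

Lemma poly_row_ext (P Q : P3) : (forall v : 'rV[K]_3, P.@[v 0] = Q.@[v 0]) -> P = Q.
Proof.
move=> h; apply/subr0_eq/mpoly_zero => v.
by rewrite mevalB -(meval_row v P) -(meval_row v Q) h subrr.
Qed.

Lemma der_precomp A Q P : Q \in unitmx ->
  der A (precomp Q P) = precomp Q (der (invmx Q *m A *m Q) P).
Proof.
move=> uQ; apply: poly_row_ext => v; rewrite meval_precomp !meval_der.
have -> : v *m Q *m (invmx Q *m A *m Q) = v *m A *m Q by rewrite !mulmxA mulmxK.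
have dE i : (precomp Q P)^`M(i).@[v 0] = \sum_k Q i k * P^`M(k).@[(v *m Q) 0].
  rewrite /precomp (@mmap_derivation _ _ _ (@mpolyC 3 K) _ (mderiv i)).
  - rewrite raddf_sum; apply: eq_bigr => k _.
    by rewrite /= mevalM mderiv_linear_form mevalC mxE mulrC -(meval_precomp Q).
  - exact: mderivD.
  - by move=> x y; rewrite mderivM.
  exact: mderivC.
under eq_bigr => i _ do rewrite dE mulr_sumr.
rewrite exchange_big; apply: eq_bigr => k _ /=; rewrite mxE mulr_suml.
by apply: eq_bigr => i _; rewrite mulrA.
Qed.

Lemma mcoeff_der_diag (a : 'rV[K]_3) P m :
  (der (diag_mx a) P)@_m = (\sum_i a 0 i * (m i)%:R) * P@_m.
Proof.
have lf i : linear_form (diag_mx a)^T i = a 0 i *: 'X_i :> P3.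
  rewrite tr_diag_mx /linear_form (bigD1 i) //= mxE eqxx big1 ?addr0 // => j ji.
  by rewrite mxE eq_sym (negPf ji) scale0r.
elim/mpolyind: P => [|c m' P _ _ IH].
  by rewrite /der big1 ?mcoeff0 ?mulr0 // => i _; rewrite mderiv0 mulr0.
have -> : der (diag_mx a) (c *: 'X_[m'] + P) =
    (c * \sum_i a 0 i * (m' i)%:R) *: 'X_[m'] + der (diag_mx a) P.
  rewrite /der mulr_sumr scaler_suml -big_split /=; apply: eq_bigr => i _.
  rewrite mderivD mderivZ mulrDr; congr (_ + _); rewrite lf mderivX.
  rewrite -scalerAl -!scalerAr !scalerA -mpolyXD.
  have [->|mi] := eqVneq (m' i) 0%N; first by rewrite !mulr0 !scale0r.
  rewrite addmC submK; last by rewrite lep1mP.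
  by congr (_ *: _); ring.
rewrite !mcoeffD IH mulrDr !mcoeffZ mcoeffX; congr (_ + _).
by case: eqP => [->|]; rewrite ?mulr0 ?mulr1 // mulrC.
Qed.

End LinearFields.

(** * Actions preserving a form annihilated by a linear field *)

Section LinearActions.
Variables (K : numClosedFieldType) (d : nat) (F : dhomog 3 K d).
Local Notation P2 := (projective 'rV[K]_3).
Local Notation P3 := {mpoly K[3]}.
Local Notation Fv v := ((F : P3).@[(v : 'rV[K]_3) 0]).

Definition mx_at (E : 'M[{poly K}]_3) t : 'M[K]_3 := map_mx (horner_eval t) E.

(** Common construction of the Gm- and Ga-actions from a polynomial family of matrices. Matrices act
    on rows from the right, hence the reversed order in the multiplicativity assumption. *)
Lemma linear_action (G : {pred K}) op e (E : 'M[{poly K}]_3) (c : K -> K) t1 (v1 : 'rV[K]_3) :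
  e \in G -> mx_at E e = 1%:M ->
  (forall t u, t \in G -> u \in G -> mx_at E (op t u) = mx_at E u *m mx_at E t) ->
  (forall t, t \in G -> mx_at E t \in unitmx) ->
  (forall t (v : 'rV[K]_3), t \in G -> Fv (v *m mx_at E t) = c t * Fv v) ->
  t1 \in G -> v1 *m mx_at E t1 \notin <[v1]>%VS ->
  exists s, [/\ algebraic_action G op e s, nontrivial_action G s
    & union_of_orbits G s (curve F)].
Proof.
move=> eG E1 EM Eu EF t1G v1E.
(* For [t] outside [G] the matrix may be singular, and any point will do. *)
have act t (p : P2) : exists q : P2, mx_at E t \in unitmx ->
    forall v, is_class p v -> is_class q (v *m mx_at E t).
  have [u|] := boolP (mx_at E t \in unitmx); last by exists p.
  have [w hw] := class_of p.
  have w0 : w *m mx_at E t != 0.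
    apply: contraNneq (class_neq0 hw) => e0.
    by rewrite -[w](mulmxK u) e0 mul0mx.
  have [q hq] := class_exists w0; exists q => _ v hv; rewrite /is_class hq.
  have /vlineP[a ea] : w \in <[v]>%VS by rewrite -hv hw memv_line.
  have a0 : a != 0.
    by apply: contraNneq (class_neq0 hw) => a0; rewrite ea a0 scale0r.
  have v0 : v *m mx_at E t != 0 by apply: contraNneq w0 => e0; rewrite ea -scalemxAl e0 scaler0.
  apply/eqP; rewrite eqEdim !dim_vline w0 v0 leqnn -memvE andbT.
  by rewrite ea -scalemxAl memvZ ?memv_line.
have [s hs1] : exists s : K -> P2 -> P2, forall t p, mx_at E t \in unitmx ->
    forall v, is_class p v -> is_class (s t p) (v *m mx_at E t).
  by exists (fun t => projT1 (choice (act t))) => t p; apply: (projT2 (choice (act t))).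
have hs t p v : t \in G -> is_class p v -> is_class (s t p) (v *m mx_at E t).
  by move=> tG; apply: hs1 (Eu t tG) v.
have uniq_class (p q : P2) v : is_class p v -> is_class q v -> p = q.
  by move=> hp hq; apply/val_inj; rewrite hp hq.
have se p : s e p = p.
  have [v hv] := class_of p; apply: uniq_class (hv).
  by rewrite -[v]mulmx1 -E1; apply: hs.
exists s; split.
- split=> // [t u p tG uG|t0 p0 t0G].
    have [v hv] := class_of p.
    have hq := hs t _ _ tG (hs u _ _ uG hv).
    apply: uniq_class hq; rewrite -mulmxA -EM //; apply: hs1 hv.
    by rewrite EM // unitmx_mul !Eu.
  exists 1%N, (fun i => \sum_j E j i *: 'X_j).
  have evE t (v : 'rV[K]_3) : eval_forms (fun i => \sum_j E j i *: 'X_j) t v = v *m mx_at E t.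
    apply/rowP => i; rewrite -horner_path /path raddf_sum horner_sum mxE.
    by apply: eq_bigr => j _; rewrite /= mevalZ mevalXU hornerM hornerC mxE mulrC.
  split=> [i||t p v tG hp _].
  + by apply: rpred_sum => j _; apply: rpredZ; rewrite dhomogX /= mdeg1.
  + have [v hv] := class_of p0; exists v => //; rewrite evE.
    apply: contraNneq (class_neq0 hv) => e0.
    by rewrite -[v](mulmxK (Eu t0 t0G)) e0 mul0mx.
  by rewrite evE; apply: hs.
- have v10 : v1 != 0 by apply: contraNneq v1E => ->; rewrite mul0mx mem0v.
  have [p hp] := class_exists v10; exists t1, p; split=> // ep; case/negP: v1E.
  by rewrite -hp -ep (hs t1 _ _ t1G hp) memv_line.
exists (curve F) => p; split=> [Cp|[q Cq [t tG ->]]]; first by exists p => //; exists e.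
have [v hv] := class_of q; apply/(curve_class F (hs t q v tG hv)).
by rewrite EF // (proj1 (curve_class F hv) Cq) mulr0.
Qed.

Section NilpotentField.
Variable N : 'M[K]_3.
Hypothesis N3 : N ^+ 3 = 0.

Lemma mul_nilpotent (w : 'rV[K]_3) : w *m N *m N *m N = 0.
Proof. by rewrite -!mulmxA (N3 : N *m (N *m N) = 0) mulmx0. Qed.

(** Coordinates of [v exp(x N)], whose series stops at [x^2] because [N^3 = 0]. *)
Definition exp_coord (v : 'rV[K]_3) i : {poly K} := (v 0 i)%:P +
  ((v *m N) 0 i)%:P * 'X + (2%:R^-1 * (v *m N *m N) 0 i)%:P * 'X ^+ 2.

Lemma size_exp_coord v i : (size (exp_coord v i) <= 3)%N.
Proof.
rewrite /exp_coord !mul_polyC; apply: leq_trans (size_polyD _ _) _; rewrite geq_max.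
apply/andP; split; last by apply: leq_trans (size_scale_leq _ _) _; rewrite size_polyXn.
apply: leq_trans (size_polyD _ _) _; rewrite geq_max.
rewrite (leq_trans (size_polyC_leq1 _)) //.
by apply: leq_trans (size_scale_leq _ _) _; rewrite size_polyX.
Qed.

Lemma deriv_exp_coord v i : (exp_coord v i)^`() = \sum_j exp_coord v j * (N j i)%:P.
Proof.
have two : (2%:R : K) != 0 by rewrite pnatr_eq0.
have E (w : 'rV[K]_3) : ((w *m N) 0 i)%:P = \sum_j (w 0 j)%:P * (N j i)%:P :> {poly K}.
  by rewrite mxE raddf_sum; apply: eq_bigr => j _; rewrite /= polyCM.
transitivity (((v *m N) 0 i)%:P + ((v *m N *m N) 0 i)%:P * 'X + (2%:R^-1)%:P * ((v *m N *m N *m N) 0 i)%:P * 'X ^+ 2).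
  rewrite mul_nilpotent [(0 : 'rV[K]_3) 0 i]mxE polyC0 mulr0 mul0r addr0 /exp_coord !mul_polyC !derivD derivC !derivZ derivX derivXn add0r.
  rewrite expr1 -!mul_polyC mulr1 polyCM; congr (_ + _).
  have h : (2%:R^-1)%:P * 2%:R = 1 :> {poly K} by rewrite -polyC_natr -polyCM mulVf.
  by rewrite -[RHS]mul1r -h; ring.
rewrite !E mulr_suml mulr_sumr mulr_suml -!big_split /=; apply: eq_bigr => j _.
rewrite /exp_coord polyCM; ring.
Qed.

(** Along the path [v exp(x N)] the form [F] is a polynomial in [x] of degree at most [2 d], and its
    derivatives are the iterates of [der N] on [F]. *)
Lemma iter_der_nilpotent : iter (2 * d).+1 (der N) F = 0.
Proof.
apply: poly_row_ext => v; rewrite meval0.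
have flow k (P : P3) : (mmap (@polyC K) (exp_coord v) P)^`(k) = mmap (@polyC K) (exp_coord v) (iter k (der N) P).
  elim: k P => [|k IH] P; first by rewrite derivn0.
  by rewrite derivSn (mmap_der _ (deriv_exp_coord v)) IH iterSr.
have := flow (2 * d).+1 F; rewrite derivn_poly0; last first.
  apply: size_mmap_le => [c|i|]; [exact: size_polyC_leq1|exact: size_exp_coord|].
  exact: msize_homog (dhomog_is_dhomog F).
move=> /(congr1 (horner_eval 0)); rewrite raddf0 => e0; rewrite [RHS]e0.
rewrite /= /horner_eval horner_mmap; apply: meval_eq => i.
by rewrite /exp_coord expr2 mulrA !(hornerD, hornerM, hornerC, hornerX) !mulr0 !addr0.
Qed.

Definition exp_poly (t : K) : {poly K} := 1 + t *: 'X + (t ^+ 2 / 2%:R) *: 'X ^+ 2.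

Lemma exp_polyD t u : horner_mx N (exp_poly (t + u)) = horner_mx N (exp_poly u) *m horner_mx N (exp_poly t).
Proof.
have two : (2%:R : K) != 0 by rewrite pnatr_eq0.
have -> : exp_poly (t + u) = exp_poly u * exp_poly t -
    'X ^+ 3 * ((t * u ^+ 2 / 2%:R + u * t ^+ 2 / 2%:R)%:P + (t ^+ 2 * u ^+ 2 / 4%:R) *: 'X).
  have e2 : (t + u) ^+ 2 / 2%:R = t ^+ 2 / 2%:R + u ^+ 2 / 2%:R + t * u by field.
  have e4 : t ^+ 2 * u ^+ 2 / 4%:R = (t ^+ 2 / 2%:R) * (u ^+ 2 / 2%:R) by field.
  rewrite /exp_poly e2 e4 -!mul_polyC; have -> : t * u ^+ 2 / 2%:R = t * (u ^+ 2 / 2%:R) by rewrite mulrA.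
  have -> : u * t ^+ 2 / 2%:R = u * (t ^+ 2 / 2%:R) by rewrite mulrA.
  move: (_ / 2%:R) (_ / 2%:R) => x y; rewrite !(polyCD, polyCM); ring.
have X3 : horner_mx N ('X ^+ 3) = 0 by rewrite rmorphXn /= horner_mx_X N3.
by rewrite rmorphB rmorphM (rmorphM _ ('X ^+ 3)) /= X3 mul0r subr0.
Qed.

Lemma nilpotent_orbits : N != 0 -> der N F = 0 -> union_of_Gm_or_Ga_orbits (curve F).
Proof.
move=> N0 dN.
have two : (2%:R : K) != 0 by rewrite pnatr_eq0.
pose E : 'M[{poly K}]_3 := \matrix_(i, j)
  (((1%:M : 'M[K]_3) i j)%:P + (N i j)%:P * 'X + (2%:R^-1 * (N *m N) i j)%:P * 'X ^+ 2).
have EtE t : mx_at E t = 1%:M + t *: N + (t ^+ 2 / 2%:R) *: (N *m N).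
  rewrite /mx_at /E; move: (N *m N) (1%:M : 'M[K]_3) => N2 I3.
  apply/matrixP => i j; rewrite !mxE /horner_eval !(hornerD, hornerM, hornerC, hornerXn, hornerX).
  ring.
have Ep t : mx_at E t = horner_mx N (exp_poly t).
  by rewrite EtE /exp_poly !rmorphD /= !horner_mxZ [horner_mx N 1]rmorph1 rmorphXn /= horner_mx_X.
have E0 : mx_at E 0 = 1%:M by rewrite EtE expr0n mul0r !scale0r !addr0.
have ED t u : mx_at E (t + u) = mx_at E u *m mx_at E t by rewrite !Ep exp_polyD.
have Einv t : mx_at E t \in unitmx.
  have : mx_at E (- t) *m mx_at E t = 1%:M by rewrite -ED subrr E0.
  by case/mulmx1_unit.
have vE v t i : (exp_coord v i).[t] = (v *m mx_at E t) 0 i.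
  rewrite EtE !mulmxDr mulmx1 -!scalemxAr mulmxA /exp_coord; move: (v *m N *m N) (v *m N) => x y.
  rewrite !mxE !(hornerD, hornerM, hornerC, hornerXn, hornerX); ring.
have [i Ni] : exists i, row i N != 0.
  by apply: exists_neq0 => h; case/eqP: N0; apply/row_matrixP => i; rewrite row0.
have [|||||||s [act nt orb]] := @linear_action (@Ga K) +%R 0 E (fun=> 1) 1 (delta_mx 0 i).
- by [].
- exact: E0.
- by move=> t u _ _; apply: ED.
- by [].
- move=> t v _; rewrite mul1r.
  have FE x : (mmap (@polyC K) (exp_coord v) F).[x] = Fv (v *m mx_at E x).
    by rewrite horner_mmap; apply: meval_eq => j; apply: vE.
  have /deriv_eq0_const eC : (mmap (@polyC K) (exp_coord v) F)^`() = 0.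
    by rewrite (mmap_der _ (deriv_exp_coord v)) dN raddf0.
  by rewrite -FE -[in RHS](mulmx1 v) -E0 -FE eC !hornerC.
- by [].
(* If [w exp(N) = a w], repeated multiplication by [N] gives first [w N^2 = 0], then [w N = 0]. *)
- apply/negP => /vlineP[a]; rewrite EtE expr1n scale1r !mulmxDr mulmx1 => e1.
  set w := delta_mx 0 i in e1; have wN : w *m N != 0 by rewrite -rowE.
  have {}e1 : w *m N + (1 / 2%:R) *: (w *m N *m N) = (a - 1) *: w.
    by rewrite scalerBl scale1r -e1 -scalemxAr mulmxA -[w + _ + _]addrA [w + _]addrC addrK.
  have e2 := congr1 (fun x => x *m N) e1; rewrite /= mulmxDl -!scalemxAl mul_nilpotent scaler0 addr0 in e2.
  have e3 := congr1 (fun x => x *m N) e2; rewrite /= -!scalemxAl mul_nilpotent in e3.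
  have wNN : w *m N *m N = 0.
    have /eqP := esym e3; rewrite scaler_eq0 => /orP[/eqP a0|/eqP //].
    by rewrite e2 a0 scale0r.
  rewrite wNN scaler0 addr0 in e1.
  case/negP: wN; move/eqP: e2; rewrite wNN eq_sym scaler_eq0 => /orP[/eqP a0|//].
  by rewrite e1 a0 scale0r.
by exists s; right.
Qed.

End NilpotentField.

End LinearActions.

(** * Natural weights for a diagonal field *)

Section IntegerWeights.
Variable K : numClosedFieldType.

Lemma clear_rat_denominators n (x : 'rV[rat]_n) : x != 0 ->
  exists (D : int) (z : 'I_n -> int), [/\ exists i, z i != 0
    & forall i, (z i)%:~R = D%:~R * x 0 i :> rat].
Proof.
move=> x0; pose z i := numq (x 0 i) * \prod_(j | j != i) denq (x 0 j).
exists (\prod_j denq (x 0 j)), z.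
have zE i : (z i)%:~R = (\prod_j denq (x 0 j))%:~R * x 0 i :> rat.
  by rewrite /z [X in _ = X%:~R * _](bigD1 i) //= !intrM numqE; ring.
split=> //; apply: exists_neq0 => h; case/eqP: x0; apply/rowP => i; rewrite mxE.
have := zE i; rewrite h => /esym/eqP.
rewrite mulf_eq0 => /orP[|/eqP //]; rewrite intr_eq0 prodf_seq_eq0 => /hasP[j _ /=].
by rewrite denq_eq0.
Qed.

(** The conditions on the weights form a linear system with integer coefficients, whose rank is the
    same over the rationals and over [K]. *)
Lemma integer_weights n (ms : seq 'X_{1..n}) (a : 'rV[K]_n) : a != 0 ->
  (forall m, m \in ms -> \sum_i a 0 i * (m i)%:R = 0) ->
  exists z : 'I_n -> int, (exists i, z i != 0) /\
    forall m, m \in ms -> \sum_i z i * (m i)%:Z = 0.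
Proof.
move=> a0 ha; pose A : 'M[rat]_(n, size ms) := \matrix_(i, k) (nth 0%MM ms k i)%:R.
have aA : a *m map_mx ratr A = 0.
  apply/rowP => k; rewrite !mxE -[RHS](ha (nth 0%MM ms k)) ?mem_nth //.
  by apply: eq_bigr => i _; rewrite !mxE ratr_nat.
have nfree : ~~ row_free A.
  apply: contra a0 => fA; have : row_free (map_mx (ratr : rat -> K) A) by rewrite /row_free mxrank_map.
  by move=> /row_free_inj inj; apply/eqP/inj; rewrite aA mul0mx.
have [x x0 xA] : exists2 x : 'rV[rat]_n, x != 0 & x *m A = 0.
  move: nfree; rewrite -kermx_eq0 => /rowV0Pn[x /sub_kermxP xA x0]; by exists x.
have [D [z [z0 zE]]] := clear_rat_denominators x0; exists z; split=> // m mms.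
apply/eqP; rewrite -(intr_eq0 rat) rmorph_sum /=; apply/eqP.
have lt : (index m ms < size ms)%N by rewrite index_mem.
have /rowP/(_ (Ordinal lt)) := xA; rewrite !mxE => e0.
rewrite -[RHS](mulr0 D%:~R) -[X in _ = _ * X]e0 mulr_sumr; apply: eq_bigr => i _.
by rewrite intrM zE mxE /= nth_index // mulrA.
Qed.

(** Adding a constant [Z] to all integer weights makes them nonnegative and, all monomials having
    degree [d], gives them the common weight [Z d]. Equal weights would mean a constant nonzero [z]
    with [z d = 0]. *)
Lemma natural_weights n d (ms : seq 'X_{1..n}) (a : 'rV[K]_n) m0 : (0 < d)%N -> m0 \in ms ->
  (forall m, m \in ms -> mdeg m = d) -> a != 0 ->
  (forall m, m \in ms -> \sum_i a 0 i * (m i)%:R = 0) ->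
  exists (k : 'I_n -> nat) (w : nat), (exists i j, k i != k j) /\
    forall m, m \in ms -> (\sum_i k i * m i)%N = w.
Proof.
move=> d0 m0ms degm a0 ha; have [z [[i0 zi0] hz]] := integer_weights a0 ha.
pose Z := (\sum_j absz (z j))%N; pose k i := absz (z i + Z%:Z).
have ZS (f : 'I_n -> nat) : (\sum_i f i)%N%:Z = \sum_i (f i)%:Z.
  exact: (big_morph Posz PoszD (erefl _)).
have kE i : (k i)%:Z = z i + Z%:Z.
  have : (absz (z i) <= Z)%N by rewrite /Z (bigD1 i) //= leq_addr.
  rewrite /k; lia.
exists k, (Z * d)%N; split; last first.
  move=> m mms; apply/eqP; rewrite -eqz_nat; apply/eqP.
  transitivity (\sum_i z i * (m i)%:Z + Z%:Z * (mdeg m)%:Z).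
    rewrite ZS mdegE ZS mulr_sumr -big_split.
    by apply: eq_bigr => i _; rewrite /= PoszM kE mulrDl.
  by rewrite (hz m mms) add0r (degm m mms) PoszM.
apply: contrapT => h; have zc i : z i = z i0.
  have [e1|ne] := eqVneq (k i) (k i0); last by case: h; exists i, i0.
  by have := kE i; rewrite e1 kE => /addIr.
have := hz m0 m0ms; under eq_bigr => i _ do rewrite zc.
rewrite -mulr_sumr -ZS -mdegE (degm m0 m0ms) => /eqP; rewrite mulf_eq0 (negPf zi0) /=.
by rewrite eqz_nat gtn_eqF.
Qed.

End IntegerWeights.

(** * Orbits from a linear field *)

Section LinSyzygyOrbits.
Variables (K : numClosedFieldType) (d : nat) (F : dhomog 3 K d).
Hypothesis d_gt0 : (0 < d)%N.
Hypothesis F_neq0 : (F : {mpoly K[3]}) != 0.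
Local Notation P3 := {mpoly K[3]}.

Lemma diagonal_scaling (P : P3) (k : 'I_3 -> nat) w (v : 'rV[K]_3) t :
  (forall m, m \in msupp P -> (\sum_i k i * m i)%N = w) ->
  P.@[(v *m diag_mx (\row_i t ^+ k i)) 0] = t ^+ w * P.@[v 0].
Proof.
move=> hw; rewrite [LHS]mevalE [X in _ = _ * X]mevalE mulr_sumr !big_seq.
apply: eq_bigr => m mP; rewrite mulrCA; congr (_ * _).
rewrite -(hw m mP) expr_sum -big_split; apply: eq_bigr => i _ /=.
by rewrite mul_mx_diag !mxE exprMn mulrC exprM.
Qed.

Lemma linear_form1 i : linear_form 1%:M i = 'X_i :> P3.
Proof.
rewrite /linear_form (bigD1 i) //= mxE eqxx scale1r big1 ?addr0 // => j ji.
by rewrite mxE eq_sym (negPf ji) scale0r.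
Qed.

Lemma der1 k (Q : P3) : Q \is k.-homog -> der 1%:M Q = Q *+ k.
Proof.
move=> hQ; rewrite -(euler_identity hQ); apply: eq_bigr => i _; congr (_ * _).
by rewrite trmx1 linear_form1.
Qed.

Lemma precomp_homog k (Q : 'M[K]_3) (P : P3) : Q \in unitmx -> P \is k.-homog ->
  precomp Q P \is k.-homog.
Proof.
move=> uQ hP; apply: homog_of_euler; transitivity (der 1%:M (precomp Q P)).
  apply: eq_bigr => i _; congr (_ * _).
  by rewrite trmx1 linear_form1.
by rewrite der_precomp // mulmx1 mulVmx // (der1 hP) /precomp raddfMn.
Qed.

Lemma diagonal_orbits (P : 'M[K]_3) (a : 'rV[K]_3) : P \in unitmx -> a != 0 ->
  der (diag_mx a) (precomp P F) = 0 -> union_of_Gm_or_Ga_orbits (curve F).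
Proof.
move=> uP a0 dF0; set F1 := precomp P F in dF0.
have F1E (v : 'rV[K]_3) : F1.@[v 0] = (F : P3).@[(v *m P) 0] by apply: meval_precomp.
have F1h : F1 \is d.-homog by apply: precomp_homog (dhomog_is_dhomog F).
have F10 : F1 != 0.
  apply: contraNneq F_neq0 => e0; apply/eqP/poly_row_ext => v.
  by rewrite -[v](mulmxKV uP) -F1E e0 !meval0.
have [m0 m0s] : exists m, m \in msupp F1.
  move: F10; rewrite -msupp_eq0; case: (msupp F1) => // m s _; exists m; exact: mem_head.
have [||k [w [[i [j kij]] hk]]] := @natural_weights K 3 d (msupp F1) a m0 d_gt0 m0s _ a0.
- by move=> m mF; apply: (dhomog_mf F1h mF).
- move=> m; rewrite mcoeff_msupp => mF; have := mcoeff_der_diag a F1 m.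
  by rewrite dF0 mcoeff0 => /esym/eqP; rewrite mulf_eq0 (negPf mF) orbF => /eqP.
pose E : 'M[{poly K}]_3 := map_mx (@polyC K) (invmx P) *m diag_mx (\row_i 'X ^+ k i) *m map_mx (@polyC K) P.
have EtE t : mx_at E t = invmx P *m diag_mx (\row_i t ^+ k i) *m P.
  have hC (A : 'M[K]_3) : map_mx (horner_eval t) (map_mx (@polyC K) A) = A.
    by apply/matrixP => r c; rewrite !mxE /horner_eval hornerC.
  rewrite /mx_at /E !map_mxM !hC map_diag_mx.
  have -> : map_mx (horner_eval t) (\row_i 'X ^+ k i) = \row_i t ^+ k i.
    by apply/rowP => r; rewrite !mxE /horner_eval hornerXn.
  by [].
have E1 : mx_at E 1 = 1%:M.
  rewrite EtE (_ : \row_i _ = const_mx 1); last by apply/rowP => r; rewrite !mxE expr1n.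
  by rewrite diag_const_mx mulmx1 mulVmx.
have EM t u : mx_at E (t * u) = mx_at E u *m mx_at E t.
  rewrite !EtE !mulmxA mulmxK // -[_ *m diag_mx _ *m diag_mx _]mulmxA mulmx_diag.
  by congr (_ *m diag_mx _ *m _); apply/rowP => r; rewrite !mxE exprMn mulrC.
(* In eigencoordinates this is [e_i + e_j]; the parameter 2 moves it to [2^k_i e_i + 2^k_j e_j], a
   different point as [k_i] and [k_j] differ. *)
pose v1 : 'rV[K]_3 := (delta_mx 0 i + delta_mx 0 j) *m P.
have [|||||||s [act nt orb]] := @linear_action K d F (@Gm K) *%R 1 E (fun t => t ^+ w) 2%:R v1.
- by rewrite inE oner_eq0.
- exact: E1.
- by move=> t u _ _; apply: EM.
- move=> t t0; have : mx_at E t *m mx_at E t^-1 = 1%:M by rewrite -EM mulVf.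
  by case/mulmx1_unit.
- by move=> t v _; rewrite EtE !mulmxA -F1E (diagonal_scaling _ _ hk) F1E mulmxKV.
- by rewrite inE pnatr_eq0.
- apply/negP => /vlineP[b]; rewrite EtE /v1 !mulmxA mulmxK // scalemxAl => /(can_inj (mulmxK uP)).
  rewrite mul_mx_diag => /rowP e1; have := e1 i; have := e1 j.
  rewrite !mxE !eqxx; have ij : i != j by apply: contraNneq kij => ->.
  rewrite eq_sym (negPf ij) !addr0 !add0r !mul1r mulr1 => <- /eqP.
  by rewrite -!natrX eqr_nat eqn_exp2l // (negPf kij).
by exists s; left.
Qed.

Lemma iter_der_precomp k A Q (P : P3) : Q \in unitmx ->
  iter k (der A) (precomp Q P) = precomp Q (iter k (der (invmx Q *m A *m Q)) P).
Proof. by move=> uQ; elim: k => //= k ->; rewrite der_precomp. Qed.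

(** In eigencoordinates each monomial is an eigenvector of the derivation, and an eigenvalue with a
    zero power is zero. *)
Lemma der_semisimple_iter k (S : 'M[K]_3) (P : P3) : diagonalizable S ->
  iter k (der S) P = 0 -> der S P = 0.
Proof.
move=> [Q uQ /(diagonalizable_forLR uQ)[a ->]]; rewrite mxpoly.conjumx ?unitmx_inv // invmxK => h.
suff e0 : der (diag_mx a) (precomp Q P) = 0.
  apply: poly_row_ext => v; rewrite -[v](mulmxKV uQ) -meval_precomp -der_precomp // e0.
  by rewrite !meval0.
apply/mpolyP => m; rewrite mcoeff_der_diag mcoeff0.
have e1 : iter k (der (diag_mx a)) (precomp Q P) = 0 by rewrite iter_der_precomp // h /precomp raddf0.
have : (iter k (der (diag_mx a)) (precomp Q P))@_m = (\sum_i a 0 i * (m i)%:R) ^+ k * (precomp Q P)@_m.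
  by elim: k {h e1} => [|k IH]; rewrite ?mul1r //= mcoeff_der_diag IH exprS mulrA.
rewrite e1 mcoeff0 => /esym/eqP; rewrite mulf_eq0 expf_eq0.
by move=> /orP[/andP[_ /eqP ->]|/eqP ->]; rewrite ?mul0r ?mulr0.
Qed.

(* For large [k], [der S ^ k F = (- der N) ^ k F = 0]; as [der S] is
   diagonalizable, both [S] and [N] annihilate [F]. *)
Lemma lin_syzygy_orbits : lin_syzygy F -> union_of_Gm_or_Ga_orbits (curve F).
Proof.
move=> [M [M0 MF]]; have dM : der M^T F = 0.
  by rewrite -[RHS]MF; apply: eq_bigr => i _; rewrite trmxK.
have [S [N [eM SN dS N3]]] := jordan_chevalley M^T.
have dSN : der S F = -1 *: der N F.
  by apply/eqP; rewrite scaleN1r -addr_eq0 -derD -eM dM.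
have comm_iter k P : der S (iter k (der N) P) = iter k (der N) (der S P).
  by elim: k => //= k <-; apply: der_comm.
have iterZ k c P : iter k (der N) (c *: P) = c *: iter k (der N) P.
  by elim: k => //= k ->; rewrite der_scale.
have iS k : iter k (der S) F = (-1) ^+ k *: iter k (der N) F.
  elim: k => [|k IH]; first by rewrite scale1r.
  by rewrite /= IH der_scale comm_iter dSN iterZ scalerA -exprSr -iterSr.
have dS0 : der S F = 0.
  apply: (der_semisimple_iter (k := (2 * d).+1) dS).
  by rewrite iS (iter_der_nilpotent _ N3) scaler0.
have dN0 : der N F = 0.
  by have /esym/eqP := dSN; rewrite dS0 scaleN1r oppr_eq0 => /eqP.
have [N0|N0] := eqVneq N 0; last exact: nilpotent_orbits N3 N0 dN0.
move: dS => [Q uQ /(diagonalizable_forLR uQ)[a]]; rewrite mxpoly.conjumx ?unitmx_inv // invmxK => Sa.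
apply: (diagonal_orbits uQ (a := a)); last by rewrite der_precomp // -Sa dS0 /precomp raddf0.
apply: contraNneq M0 => a0; rewrite -[M]trmxK eM N0 addr0 Sa a0.
by rewrite (_ : diag_mx 0 = 0) ?mulmx0 ?mul0mx ?trmx0 //; apply/matrixP => r c; rewrite !mxE mul0rn.
Qed.

End LinSyzygyOrbits.

(** A constant field times the coordinate [X_0] is a linear field. *)
Lemma const_lin_syzygy (K : numClosedFieldType) (d : nat) (F : dhomog 3 K d) :
  const_syzygy F -> lin_syzygy F.
Proof.
move=> [c [[i ci] hc]]; exists (\matrix_(i, j) (c i *+ (j == 0))); split.
  by apply: contraNneq ci => /matrixP/(_ i 0); rewrite !mxE eqxx mulr1n => ->.
transitivity ('X_0 * \sum_i c i *: (F : {mpoly K[3]})^`M(i)); last by rewrite hc mulr0.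
rewrite mulr_sumr; apply: eq_bigr => l _.
rewrite /linear_form (bigD1 0) //= mxE eqxx big1 ?addr0 => [|j /negPf j0].
  by rewrite -scalerAl scalerAr.
by rewrite mxE j0 scale0r.
Qed.

(** The arithmetic: [e + 2 <= e (d - 1)] fails for [d <= 2], means [e >= 2] for [d = 3], and always
    holds from [d = 4] on; [2 e + 2 <= e (d - 1)] fails for [d <= 3], means [e >= 2] for [d = 4],
    and always holds from [d = 5] on. *)
Lemma syzygy_cases (d e : nat) (const lin orb : Prop) (lines : nat -> Prop) :
  (0 < d)%N -> (0 < e)%N -> (const -> lin) -> (lin <-> orb) ->
  (forall n, lines n -> const) -> ((1 < d)%N -> const -> lines d) ->
  (const /\ (e + 2 <= e * d.-1)%N) \/ (lin /\ (2 * e + 2 <= e * d.-1)%N) <->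
  [\/ (5 <= d)%N /\ orb, [/\ d = 4%N, e = 1%N & lines 4%N],
      [/\ d = 4%N, (2 <= e)%N & orb]
    | [/\ d = 3%N, (2 <= e)%N & exists n, lines n]].
Proof.
move=> d_gt0 e_gt0 cl lo lc c_lines; split; last first.
  case=> [[d5 /lo h]|[d4 e1 /lc h]|[d4 e2 /lo h]|[d3 e2 [n /lc h]]].
  - by right; split=> //; nia.
  - by left; split=> //; rewrite d4 e1.
  - by right; split=> //; rewrite d4; lia.
  - by left; split=> //; rewrite d3; lia.
have [d5 h|d5] := leqP 5 d.
  by apply: Or41; split=> //; apply/lo; case: h => -[h _] //; apply: cl.
have [d4|d4] := eqVneq d 4%N.
  rewrite {}d4 in c_lines *; have [->|e1] := eqVneq e 1%N.
    by case=> -[h] // _; apply: Or42; split=> //; apply: c_lines.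
  move=> h; apply: Or43; split=> //; first by lia.
  by apply/lo; case: h => -[h _] //; apply: cl.
have [d3|d3] := eqVneq d 3%N; last by case=> -[_]; nia.
rewrite {}d3 in c_lines *; have [->|e1] := eqVneq e 1%N; first by case=> -[].
case=> -[h]; last by lia.
by move=> _; apply: Or44; split=> //; [lia|exists 3%N; apply: c_lines].
Qed.

Theorem theorem4p2 (R : realType) (d e : nat) (F : dhomog 3 R[i] d)
    (d_ge1 : (1 <= d)%N) (e_ge1 : (1 <= e)%N) (F_red : reduced_form F) :
  ~ maximal_rank e F <->
  [\/ (5 <= d)%N /\ union_of_Gm_or_Ga_orbits (curve F),
      [/\ d = 4%N, e = 1%N & union_of_concurrent_lines 4 (curve F)],
      [/\ d = 4%N, (2 <= e)%N & union_of_Gm_or_Ga_orbits (curve F)]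
    | [/\ d = 3%N, (2 <= e)%N
        & exists n : nat, union_of_concurrent_lines n (curve F)]].
Proof.
have F0 : (F : {mpoly R[i][3]}) != 0.
  by case: F_red => + _; apply: contraNneq => F0; apply/eqP/val_inj.
apply: iff_trans (nonmaximal_rank_iff d_ge1 e_ge1 F_red) _.
apply: syzygy_cases => //.
- exact: const_lin_syzygy.
- by split; [exact: (lin_syzygy_orbits d_ge1 F0)|exact: (orbits_lin_syzygy d_ge1 F_red)].
- by move=> n; apply: lines_const_syzygy.
exact: const_syzygy_lines.
Qed.
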